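(* In the one-sided Gaussian contamination model with $\sigma=1$, there exist universal positive constants $c_1,c_2,c_3,n_0$ such that for any $n\ge n_0$, any integer $k\in[1,n-1]$, any $\theta\in\mathbb R$ and any $\mu\in\mathcal M_k$, the adaptive estimator $\widehat\theta_{\mathrm{ad}}=\widehat\theta_{\widehat q}$ satisfies $$\mathbb P_{\theta,\mu}\left[|\widehat\theta_{\mathrm{ad}}-\theta|>c_1\frac{\log^{2}\big(1+\sqrt{\frac{k}{n-k}}\big)}{\log^{3/2}\big(1+(\frac{k}{\sqrt n})^{2/3}\big)}\right]\le c_2\left(\frac{\sqrt n}{k\vee\sqrt n}\right)^{4/3}\log^{3}\left(\frac{k\vee(2\sqrt n)}{\sqrt n}\right)$$ and $$\mathbb E_{\theta,\mu}\big[|\widehat\theta_{\mathrm{ad}}-\theta|\big]\le c_3\,\frac{\log^{2}\big(1+\sqrt{\frac{k}{n-k}}\big)}{\log^{3/2}\big(1+(\frac{k}{\sqrt n})^{2/3}\big)}.$$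
   Context: Model: $Y_i=\theta+\mu_i+\xi_i$, $1\le i\le n$, with $\xi_i$ i.i.d. $\mathcal N(0,1)$, $\theta\in\mathbb R$, $\mu\in\mathbb R_+^n$; $\mathbb P_{\theta,\mu},\mathbb E_{\theta,\mu}$ denote probability and expectation. $\mathcal M_k=\{\mu\in\mathbb R_+^n:\ \sum_i\mathbf 1\{\mu_i\ne0\}\le k\}$. $Y_{(j)}$ is the $j$-th smallest element among $Y_1,\dots,Y_n$. $\lfloor x\rfloor_{\mathrm{even}}$ is the largest even integer not larger than $x$; $x\vee y=\max(x,y)$. $\overline\Phi$ is the upper tail function of $\mathcal N(0,1)$. Constants: $a=3[1+\log(3+2\sqrt2)]$ and $q_{\max}=\lfloor\frac{1}{2a}\log n\rfloor_{\mathrm{even}}-2$. Rough estimators: $\widehat\theta_{\mathrm{med}}=Y_{(\lceil n/2\rceil)}$; $\widehat\theta_{\mathrm{up}}=Y_{(1)}+2\sqrt{\log n}$; for positive even $q$, $\widehat\theta_{\mathrm{low},q}=\widehat\theta_{\mathrm{med}}-\overline v$ with $\overline v=\pi^2/(144\,q_{\max}^{3/2})$ ($\pi=3.14159\ldots$) if $q\le\frac{3}{10a}\log n$, and $\widehat\theta_{\mathrm{low},q}=-\infty$ otherwise. For even $q\ge2$ and $0\le j\le q$ let $a_{j,q}=(-4)^j\frac{q\,(q+j-1)!}{(q-j)!\,(2j)!}$. For $\lambda\ge0$, $u\in\mathbb R$ let $\widehat\eta_\lambda(u)=\frac1n\sum_{i=1}^n e^{\lambda(u-Y_i)-\lambda^2/2}$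 and $\widehat\psi_{q,\lambda}(u)=\sum_{j=0}^q a_{j,q}\,\widehat\eta_{j\lambda}(u)$. For even $q\in\{2,\dots,q_{\max}\}$ put $\lambda_q=\sqrt{2/q}$ and $$\widehat\theta_q=\inf\Big\{u\in[\widehat\theta_{\mathrm{low},q},\widehat\theta_{\mathrm{up}}]:\ \widehat\psi_{q,\lambda_q}(u)>1+\frac{e^{aq}}{\sqrt n}\Big\},\qquad \inf\emptyset=\widehat\theta_{\mathrm{up}}$$ (if $\widehat\theta_{\mathrm{low},q}=-\infty$ the interval is $(-\infty,\widehat\theta_{\mathrm{up}}]$). In addition, $\widehat\theta_0=\widehat\theta_{\mathrm{med}}$ and $\widehat\theta_{q_{\max}+2}=Y_{(1)}+\overline\Phi^{-1}(1/n)$. Thresholds: $\delta_q=10\,\frac{e^{a(q+2)}}{\sqrt n\,q^{3/2}}$ for even $q\in\{2,\dots,q_{\max}-2\}$, $\delta_{q_{\max}}=25/q_{\max}^{3/2}$, $\delta_{q_{\max}+2}=4\sqrt{2\log n}$. Selected index: $$\widehat q=\min\big\{q\in\{0,2,\dots,q_{\max},q_{\max}+2\}:\ |\widehat\theta_q-\widehat\theta_{q'}|\le\delta_{q'}\ \text{for all } q'>q \text{ in } \{0,2,\dots,q_{\max}+2\}\big\}.$$ Universal constants do not depend on $n,k,\theta,\mu$. *)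

(* Defs.v *)
From HB Require Import structures.
From mathcomp Require Import all_boot all_order all_algebra.
From mathcomp Require Import all_classical all_reals all_analysis.

Set Implicit Arguments.
Unset Strict Implicit.
Unset Printing Implicit Defensive.

Import Order.TTheory GRing.Theory Num.Theory.
Import numFieldNormedType.Exports.

Local Open Scope classical_set_scope.
Local Open Scope ring_scope.

Definition sparse_nonneg (R : realType) (n k : nat) : set ('I_n -> R) :=
  [set mu | (forall i, 0 <= mu i) /\ (#|[pred i | mu i != 0%R]| <= k)%N].

Definition mutually_independent (R : realType) (n : nat) (d : measure_display)
    (T : measurableType d) (P : probability T R) (X : 'I_n -> T -> R) : Prop :=
  forall (J : {set 'I_n}) (B : 'I_n -> set R),
    (forall i, measurable (B i)) ->
    (P (\bigcap_(i in [set` J]) (X i @^-1` B i)) =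
     \prod_(i in J) P (X i @^-1` B i))%E.

Definition iid_std_normal (R : realType) (n : nat) (d : measure_display)
    (T : measurableType d) (P : probability T R) (xi : 'I_n -> {RV P >-> R}) :
    Prop :=
  mutually_independent P xi /\
  forall (i : 'I_n) (B : set R), measurable B ->
    distribution P (xi i) B = normal_prob 0 1 B.

Definition observation (R : realType) (n : nat) (T : Type) (theta : R)
    (mu : 'I_n -> R) (xi : 'I_n -> T -> R) (w : T) : 'I_n -> R :=
  fun i => theta + mu i + xi i w.

(** [order_stat y j] is [Y_(j)], with [j] counted from 1; the value for [j]
    outside [1, n] is junk. *)
Definition order_stat (R : realType) (n : nat) (y : 'I_n -> R) (j : nat) : R :=
  nth 0 (sort <=%R [seq y i | i <- enum 'I_n]) j.-1.

(** The largest even integer not larger than [x], for [0 <= x]. *)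
Definition floor_even (R : realType) (x : R) : nat :=
  \max_(m < (Num.truncn x).+1 | ~~ odd m) m.

Definition Phibar (R : realType) (x : R) : R :=
  fine (normal_prob (0 : R) 1 `]x, +oo[).

(** [Phibar] is injective with range ]0, 1[; the value at [p] outside ]0, 1[
    is junk. *)
Definition Phibar_inv (R : realType) (p : R) : R :=
  xget 0 [set x | Phibar x = p].

Definition a_const (R : realType) : R := 3 * (1 + ln (3 + 2 * Num.sqrt 2)).

(** The subtraction is truncated at 0, which only matters when
    [ln n < 4 * a_const]. *)
Definition qmax (R : realType) (n : nat) : nat :=
  (floor_even (1 / (2 * a_const R) * ln (n%:R : R)) - 2)%N.

Definition theta_med (R : realType) (n : nat) (y : 'I_n -> R) : R :=
  order_stat y (uphalf n).

Definition theta_up (R : realType) (n : nat) (y : 'I_n -> R) : R :=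
  order_stat y 1 + 2 * Num.sqrt (ln n%:R).

Definition vbar (R : realType) (n : nat) : R :=
  pi ^+ 2 / (144 * (qmax R n)%:R `^ (3 / 2)).

Definition theta_low (R : realType) (n : nat) (y : 'I_n -> R) (q : nat) :
    \bar R :=
  if q%:R <= 3 / (10 * a_const R) * ln n%:R
  then (theta_med y - vbar R n)%:E else -oo%E.

Definition cheb_coef (R : realType) (j q : nat) : R :=
  (-4) ^+ j * (q%:R * (q + j - 1)`!%:R) / ((q - j)`!%:R * (2 * j)`!%:R).

Definition eta_hat (R : realType) (n : nat) (y : 'I_n -> R) (lambda u : R) : R :=
  n%:R^-1 * \sum_(i < n) expR (lambda * (u - y i) - lambda ^+ 2 / 2).

Definition psi_hat (R : realType) (n : nat) (y : 'I_n -> R) (q : nat)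
    (lambda u : R) : R :=
  \sum_(j < q.+1) cheb_coef R j q * eta_hat y (j%:R * lambda) u.

Definition lambda_ (R : realType) (q : nat) : R := Num.sqrt (2 / q%:R).

Definition crossing_set (R : realType) (n : nat) (y : 'I_n -> R) (q : nat) :
    set R :=
  [set u | [/\ (theta_low y q <= u%:E)%E, u <= theta_up y &
      1 + expR (a_const R * q%:R) / Num.sqrt n%:R
        < psi_hat y q (lambda_ R q) u]].

(** The infimum over an empty set is [theta_up y].  A nonempty [crossing_set] is
    always bounded below, since [psi_hat] tends to 1 at -oo, so [inf] is then
    the genuine infimum. *)
Definition theta_hat (R : realType) (n : nat) (y : 'I_n -> R) (q : nat) : R :=
  if q == 0%N then theta_med y
  else if q == (qmax R n + 2)%N then order_stat y 1 + Phibar_inv n%:R^-1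
  else if `[< crossing_set y q !=set0 >] then inf (crossing_set y q)
  else theta_up y.

(** Only used for [q] even with [2 <= q <= qmax + 2]. *)
Definition delta (R : realType) (n q : nat) : R :=
  if (q < qmax R n)%N then
    10 * (expR (a_const R * (q%:R + 2)) / (Num.sqrt n%:R * q%:R `^ (3 / 2)))
  else if q == qmax R n then 25 / (qmax R n)%:R `^ (3 / 2)
  else 4 * Num.sqrt (2 * ln n%:R).

Definition index_range (R : realType) (n : nat) : seq nat :=
  [seq q <- iota 0 (qmax R n + 2).+1 | ~~ odd q].

Definition admissible (R : realType) (n : nat) (y : 'I_n -> R) (q : nat) : bool :=
  all (fun q' => (q < q')%N ==>
         (`|theta_hat y q - theta_hat y q'| <= delta R n q'))
      (index_range R n).

(** The default [qmax + 2] of the minimum is always an admissible index. *)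
Definition q_hat (R : realType) (n : nat) (y : 'I_n -> R) : nat :=
  \big[minn/(qmax R n + 2)%N]_(q <- index_range R n | admissible y q) q.

Definition theta_ad (R : realType) (n : nat) (y : 'I_n -> R) : R :=
  theta_hat y (q_hat y).

Definition rate (R : realType) (n k : nat) : R :=
  ln (1 + Num.sqrt (k%:R / (n%:R - k%:R))) ^+ 2 /
  ln (1 + (k%:R / Num.sqrt n%:R) `^ (2 / 3)) `^ (3 / 2).

Definition tail_bound (R : realType) (n k : nat) : R :=
  (Num.sqrt n%:R / Num.max k%:R (Num.sqrt n%:R)) `^ (4 / 3) *
  ln (Num.max k%:R (2 * Num.sqrt n%:R) / Num.sqrt n%:R) ^+ 3.

(* Main.v *)
(** Idea.  Since [cheb_coef j q] are the coefficients of [T_q(1 - 2x)], which lies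
    in [[-1, 1]] on [[0, 1]], the mean of [psi_hat] at a point [u <= theta] is at
    most 1, while past [theta] the uncontaminated observations alone make it grow
    like a Chebyshev polynomial outside [[-1, 1]].  Hence [theta_hat q] lies in
    [theta, theta + v] with [v] of order [delta q] as soon as the centred
    empirical exponential moments are at most [e^(aq) / sqrt n]; this fails only
    if a nonnegative variable [zeta q] of mean at most [e^(-4aq/3)] exceeds 1.
    Two more such variables control the extreme and the median observations.

    Let [qs] be the least even [q] with [k <= sqrt n * e^(aq)].  If every [zeta q]
    with [q >= qs] is below 1, Lepski's argument gives an error of at most
    [2 * delta qs], which is of the order of the rate; if [q] is the largest
    index with [zeta q >= 1], the same argument started at [q + 2] gives
    [2 * delta (q + 2)].  So the error is at most
    [2 * delta qs + sum_(q >= qs) 2 * delta (q + 2) * zeta q] plus remainders,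
    and both claims follow by taking expectations, because
    [delta (q + 2) * e^(-4aq/3)] decays geometrically from [1 / sqrt n].  When no
    such [qs <= qmax - 2] exists, the selection starts at [qmax] or [qmax + 2],
    depending on [ln (n / (n - k))]. *)

Require Import Defs.
From HB Require Import structures.
From mathcomp Require Import all_boot all_order all_algebra.
From mathcomp Require Import all_classical all_reals all_analysis.
From mathcomp Require Import measurable_realfun.
From mathcomp Require Import ring lra zify.

Set Implicit Arguments.
Unset Strict Implicit.
Unset Printing Implicit Defensive.

Import Order.TTheory GRing.Theory Num.Theory.
Import numFieldNormedType.Exports.

Local Open Scope classical_set_scope.
Local Open Scope ring_scope.

(** The scale [lambda_ q = sqrt (2 / q)] fixes every exponent. As all frequencies are multiples of
    it, the mean of [psi_hat] is an average of [chebP q] at the points [exp (lambda * (v - mu i))].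
    The largest frequency satisfies [(q * lambda)^2 = 2 * q], so second moments are at most
    [e^(2q)]. The coefficients have total mass at most [(3 + 2 sqrt 2)^q], and [a] is chosen so that
    squared mass times moment is at most [e^(2aq/3)]; division by the squared margin [e^(2aq)]
    leaves the [e^(-4aq/3)]. The slope of [chebP q] at 1 is [2 q^2], so a shift [v] gains about
    [2 q^2 * lambda * v], of order [q^(3/2) * v]: hence the [q^(3/2)] in [delta]. Deviations are
    kept as nonnegative variables rather than events: the same pointwise argument applies to the
    error and to the indicator of a large error, and independence enters through variances. The
    estimators err on one side only: two points of [[theta, theta + v]] differ by at most [v], so
    [delta] can be the radius itself rather than its double. *)

(** * Chebyshev polynomials *)

(* [(T_q(y), U_(q-1)(y))], generated by the Pell-type recursion that preserves
   [T^2 - (y^2 - 1) U^2 = 1]. *)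
Fixpoint chebTU (R : comPzRingType) (y : R) (q : nat) : R * R :=
  if q is p.+1 then
    let: (t, u) := chebTU y p in (y * t + (y ^+ 2 - 1) * u, t + y * u)
  else (1, 0).

Definition chebT (R : comPzRingType) (y : R) (q : nat) : R := (chebTU y q).1.
Definition chebU (R : comPzRingType) (y : R) (q : nat) : R := (chebTU y q).2.

Lemma chebTS (R : comPzRingType) (y : R) (q : nat) :
  chebT y q.+1 = y * chebT y q + (y ^+ 2 - 1) * chebU y q.
Proof. by rewrite /chebT /chebU /=; case: (chebTU y q). Qed.

Lemma chebUS (R : comPzRingType) (y : R) (q : nat) :
  chebU y q.+1 = chebT y q + y * chebU y q.
Proof. by rewrite /chebT /chebU /=; case: (chebTU y q). Qed.

Lemma chebTSS (R : comPzRingType) (y : R) (q : nat) :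
  chebT y q.+2 = 2 * y * chebT y q.+1 - chebT y q.
Proof. rewrite !chebTS !chebUS; ring. Qed.

Lemma chebTN (R : comPzRingType) (y : R) (q : nat) :
  chebT (- y) q = (-1) ^+ q * chebT y q /\
  chebU (- y) q = - (-1) ^+ q * chebU y q.
Proof.
elim: q => [|q [ihT ihU]]; first by rewrite /chebT /chebU /=; split; ring.
by rewrite !(chebTS, chebUS) ihT ihU !exprS; split; ring.
Qed.

Lemma cheb_pell (R : comPzRingType) (y : R) (q : nat) :
  chebT y q ^+ 2 - (y ^+ 2 - 1) * chebU y q ^+ 2 = 1.
Proof.
elim: q => [|q ih]; first by rewrite /chebT /chebU /=; ring.
by rewrite !(chebTS, chebUS) -[RHS]ih; ring.
Qed.

Lemma chebT_le1 (R : realDomainType) (y : R) (q : nat) :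
  `|y| <= 1 -> `|chebT y q| <= 1.
Proof.
move=> y1; rewrite -(@ler_pXn2r _ 2)// ?nnegrE// expr1n real_normK ?num_real//.
rewrite -(cheb_pell y q) lerBrDr -[leRHS]addr0 lerD2l.
by rewrite mulr_le0_ge0 ?sqr_ge0// subr_le0 -real_normK ?num_real// expr_le1.
Qed.

(** The line is the tangent of [T_q] at 1, where the derivative is [q^2]. The bound on [chebU] is
    carried along because it feeds the increment of [chebT]. *)
Lemma chebTU_lb (R : realDomainType) (y : R) (q : nat) : 1 <= y ->
  1 + q%:R ^+ 2 * (y - 1) <= chebT y q /\ q%:R <= chebU y q.
Proof.
move=> y1; elim: q => [|q [ihT ihU]].
  by rewrite /chebT /chebU /= expr0n/= mul0r addr0.
rewrite chebTS chebUS -natr1; set x := q%:R in ihT ihU *.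
have x0 : 0 <= x by rewrite ler0n.
have T1 : 1 <= chebT y q.
  by apply: le_trans ihT; rewrite lerDl mulr_ge0 ?sqr_ge0 ?subr_ge0.
move: (chebT y q) (chebU y q) ihT ihU T1 => t u ihT ihU T1.
have h1 : 0 <= (y - 1) * (t - 1) by rewrite mulr_ge0 ?subr_ge0.
have h2 : 0 <= (y - 1) * (y - 1) * u.
  by rewrite mulr_ge0 ?mulr_ge0 ?subr_ge0//; apply: le_trans ihU.
have h3 : 0 <= (y - 1) * (u - x) by rewrite mulr_ge0 ?subr_ge0.
split; last by nra.
have -> : y * t + (y ^+ 2 - 1) * u =
  t + (y - 1) * (t - 1) + (y - 1) + (y - 1) * (y - 1) * u +
    2 * ((y - 1) * (u - x)) + 2 * x * (y - 1) by ring.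
have -> : 1 + (x + 1) ^+ 2 * (y - 1) =
  (1 + x ^+ 2 * (y - 1)) + 2 * x * (y - 1) + (y - 1) by ring.
lra.
Qed.

(** The recursion is multiplication by [y + s] when [s^2 = y^2 - 1]; replacing [s] by [- s] gives
    the conjugate. *)
Lemma chebTU_expr (R : comPzRingType) (y s : R) (q : nat) :
  s ^+ 2 = y ^+ 2 - 1 -> chebT y q + s * chebU y q = (y + s) ^+ q.
Proof.
move=> s2; elim: q => [|q ih]; first by rewrite /chebT /chebU /=; ring.
rewrite chebTS chebUS [RHS]exprS -ih -s2; ring.
Qed.

(** [T_q] is the mean of [(y + s)^q] and [(y - s)^q], and the latter is nonnegative. *)
Lemma chebT_ge_half_expr (R : realFieldType) (y s : R) (q : nat) :
  1 <= y -> 0 <= s -> s ^+ 2 = y ^+ 2 - 1 -> 2^-1 * (y + s) ^+ q <= chebT y q.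
Proof.
move=> y1 s0 s2; rewrite -(chebTU_expr _ s2).
have : 0 <= (y - s) ^+ q.
  rewrite exprn_ge0// subr_ge0 -(@ler_pXn2r _ 2)// ?nnegrE//; last lra.
  rewrite s2; lra.
rewrite -(@chebTU_expr _ _ (- s)) ?sqrrN//; lra.
Qed.

Lemma chebT_le_expr (R : realDomainType) (y s : R) (q : nat) :
  1 <= y -> 0 <= s -> s ^+ 2 = y ^+ 2 - 1 -> chebT y q <= (y + s) ^+ q.
Proof.
move=> y1 s0 s2; rewrite -(chebTU_expr _ s2) lerDl mulr_ge0//.
by have [_] := chebTU_lb q y1; apply: le_trans.
Qed.

Definition chebP (R : realType) (q : nat) (x : R) : R :=
  \sum_(j < q.+1) cheb_coef R j q * x ^+ j.

(** Unlike the factorial quotient, the binomial form vanishes by itself above the degree and obeys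
    Pascal's rule. *)
Lemma cheb_coefE (R : realType) (j q : nat) : (j <= q)%N -> (0 < q)%N ->
  cheb_coef R j q =
  (-4) ^+ j * ('C(q + j, 2 * j) + 'C((q + j).-1, 2 * j))%:R / 2.
Proof.
move=> jq q0; rewrite /cheb_coef -!mulrA; congr (_ * _); rewrite mulrA.
have bn : (('C(q + j, 2 * j) + 'C((q + j).-1, 2 * j)) * ((q - j)`! * (2 * j)`!) =
  2 * (q * (q + j - 1)`!))%N.
  have -> : (q + j - 1 = (q + j).-1)%N by lia.
  have e1 : ('C(q + j, 2 * j) * ((q - j)`! * (2 * j)`!) = (q + j) * ((q + j).-1)`!)%N.
    have := @bin_fact (q + j) (2 * j) ltac:(lia).
    have -> : (q + j - 2 * j = q - j)%N by lia.
    move=> h; rewrite (mulnC (q - j)`!) h.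
    by case: (q + j)%N (ltac:(lia) : (0 < q + j)%N) => // p _; rewrite factS.
  have e2 : ('C((q + j).-1, 2 * j) * ((q - j)`! * (2 * j)`!) = (q - j) * ((q + j).-1)`!)%N.
    have [->|jq'] := eqVneq j q.
      by rewrite subnn mul0n bin_small// ; lia.
    have := @bin_fact (q + j).-1 (2 * j) ltac:(lia).
    have -> : ((q + j).-1 - 2 * j = (q - j).-1)%N by lia.
    move=> <-; case: (q - j)%N (ltac:(lia) : (0 < q - j)%N) => // p _.
    by rewrite factS /=; lia.
  by rewrite mulnDl e1 e2; nia.
have f0 : ((q - j)`!%:R * (2 * j)`!%:R : R) != 0.
  by rewrite mulf_neq0// pnatr_eq0 -lt0n fact_gt0.
apply/eqP; rewrite eqr_div//; apply/eqP; rewrite -!natrM bn; congr _%:R; lia.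
Qed.

Lemma chebPE (R : realType) (q : nat) (x : R) :
  (0 < q)%N -> chebP q x = chebT (1 - 2 * x) q.
Proof.
(* Coefficients are padded with zeros up to a degree [N] independent of [q]. *)
pose b (q j : nat) : R := (-4) ^+ j * ('C(q + j, 2 * j) + 'C((q + j).-1, 2 * j))%:R / 2.
pose S (N q : nat) := \sum_(j < N.+1) b q j * x ^+ j.
have bE p j : (p <= j)%N -> (0 < p)%N -> b p j.+1 = 0.
  by move=> pj p0; rewrite /b !bin_small ?mulr0 ?mul0r//; lia.
(* This is [T_(p+2) = 2 (1 - 2x) T_(p+1) - T_p] read on coefficients; each of the two binomials
   satisfies it by three uses of Pascal's rule. *)
have bS p j : b p.+2 j.+1 = 2 * b p.+1 j.+1 - b p j.+1 - 4 * b p.+1 j.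
  rewrite /b exprS.
  have e1 : ('C(p.+2 + j.+1, 2 * j.+1) + 'C(p + j.+1, 2 * j.+1) =
     2 * 'C(p.+1 + j.+1, 2 * j.+1) + 'C(p.+1 + j, 2 * j))%N.
    have -> : (2 * j.+1 = (2 * j).+2)%N by lia.
    have -> : (p.+2 + j.+1 = (p + j).+3)%N by lia.
    have -> : (p + j.+1 = (p + j).+1)%N by lia.
    have -> : (p.+1 + j.+1 = (p + j).+2)%N by lia.
    have -> : (p.+1 + j = (p + j).+1)%N by lia.
    by rewrite (binS (p + j).+2) (binS (p + j).+1 (2 * j).+1) (binS (p + j).+1 (2 * j)); lia.
  have e2 : ('C((p.+2 + j.+1).-1, 2 * j.+1) + 'C((p + j.+1).-1, 2 * j.+1) =
     2 * 'C((p.+1 + j.+1).-1, 2 * j.+1) + 'C((p.+1 + j).-1, 2 * j))%N.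
    have -> : (2 * j.+1 = (2 * j).+2)%N by lia.
    have -> : ((p.+2 + j.+1).-1 = (p + j).+2)%N by lia.
    have -> : ((p + j.+1).-1 = (p + j))%N by lia.
    have -> : ((p.+1 + j.+1).-1 = (p + j).+1)%N by lia.
    have -> : ((p.+1 + j).-1 = (p + j))%N by lia.
    by rewrite (binS (p + j).+1) (binS (p + j) (2 * j).+1) (binS (p + j) (2 * j)); lia.
  have := congr2 addn e1 e2; rewrite addnACA [in RHS]addnACA -mulnDr.
  move: ('C(p.+2 + _, _) + _)%N ('C(p + _, _) + _)%N => A B.
  move: ('C(p.+1 + j.+1, _) + _)%N ('C(p.+1 + j, _) + _)%N => C D.
  rewrite mul2n -addnn => /(congr1 (fun m => m%:R : R)); rewrite !natrD => /eqP.
  rewrite -(inj_eq (addIr (- B%:R))) addrK => /eqP ->.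
  by field.
have b0 p : b p 0%N = 1 by rewrite /b muln0 !bin0 expr0 mul1r divff// pnatr_eq0.
have SS N p : (p.+1 < N)%N -> (0 < p)%N -> S N p.+2 = 2 * (1 - 2 * x) * S N p.+1 - S N p.
  case: N => // N pN p0; rewrite /S.
  rewrite !(big_ord_recl N.+1) /= !b0 !expr0 !mul1r.
  have -> : \sum_(i < N.+1) b p.+2 (bump 0 i) * x ^+ bump 0 i =
    2 * (\sum_(i < N.+1) b p.+1 (bump 0 i) * x ^+ bump 0 i) -
    (\sum_(i < N.+1) b p (bump 0 i) * x ^+ bump 0 i) -
    4 * x * (\sum_(i < N.+1) b p.+1 i * x ^+ i).
    rewrite !mulr_sumr -!sumrB; apply: eq_bigr => i _.
    by rewrite /bump/= add1n bS exprS; ring.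
  have -> : \sum_(i < N.+1) b p.+1 i * x ^+ i =
    1 + \sum_(i < N.+1) b p.+1 (bump 0 i) * x ^+ bump 0 i.
    rewrite big_ord_recl b0 expr0 mulr1 [in RHS]big_ord_recr/=; congr (_ + _).
    by rewrite /bump/= add1n bE ?mul0r ?addr0.
  ring.
have SE N p : (p.+1 < N)%N -> S N p.+1 = chebT (1 - 2 * x) p.+1 /\
    ((0 < p)%N -> S N p = chebT (1 - 2 * x) p).
  (* Degrees 1 and 2 are computed by hand, since [SS] starts from a positive degree. *)
  elim: p => [|p ih] pN.
    split => //; case: N pN => // -[//|N] _; rewrite /S 2!big_ord_recl.
    rewrite big1 => [|i _]; last first.
      by rewrite !lift0 bE ?mul0r.
    rewrite /= !b0 /b /chebT /bump /= muln1 binn bin_small// !expr1 expr0 mulr1 addn0; by field.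
  have [] := ih (ltnW pN); case: p {ih} pN => [|p] pN e1 e2.
    split => //; case: N pN {e1 e2} => [//|[//|[//|N]]] _.
    rewrite /S 3!big_ord_recl big1 => [|i _]; last by rewrite !lift0 bE ?mul0r.
    rewrite /= !b0 /b /chebT /bump /= ?expr0 ?expr1 !addn0 !addn1 muln1.
    by rewrite (_ : 'C(3, 2) = 3)%N//; field.
  by split => //; rewrite chebTSS -e1 -e2// SS//; lia.
move=> q0; rewrite /chebP.
have -> : \sum_(j < q.+1) cheb_coef R j q * x ^+ j = \sum_(j < q.+1) b q j * x ^+ j.
  by apply: eq_bigr => j _; rewrite cheb_coefE// -ltnS.
have -> : \sum_(j < q.+1) b q j * x ^+ j = S q.+2 q.
  rewrite /S !(big_ord_recr q.+2) !(big_ord_recr q.+1)/= !bE ?mul0r ?addr0//; lia.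
by case: q q0 => // q _; have [] := SE q.+3 q ltac:(lia).
Qed.

Lemma chebP_le1 (R : realType) (q : nat) (x : R) :
  (0 < q)%N -> 0 <= x <= 1 -> `|chebP q x| <= 1.
Proof.
by move=> q0 /andP[x0 x1]; rewrite chebPE// chebT_le1// ler_norml; apply/andP; split; lra.
Qed.

(** Parity turns the argument into [2x - 1], which exceeds 1 past [x = 1]: there the polynomial
    grows to +oo. *)
Lemma chebP_even (R : realType) (q : nat) (x : R) :
  (0 < q)%N -> ~~ odd q -> chebP q x = chebT (2 * x - 1) q.
Proof.
move=> q0 qe; rewrite chebPE// -opprB (chebTN _ q).1.
by rewrite -signr_odd (negbTE qe) expr0 mul1r.
Qed.

Lemma chebP_ge (R : realType) (q : nat) (s : R) : (0 < q)%N -> ~~ odd q ->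
  0 <= s -> 1 + 2 * q%:R ^+ 2 * s <= chebP q (1 + s).
Proof.
move=> q0 qe s0; rewrite chebP_even//.
have [+ _] := @chebTU_lb _ (2 * (1 + s) - 1) q ltac:(lra).
by apply: le_trans; rewrite le_eqVlt; apply/orP; left; apply/eqP; ring.
Qed.

Lemma chebP_geN1 (R : realType) (q : nat) (x : R) : (0 < q)%N -> ~~ odd q ->
  0 <= x -> -1 <= chebP q x.
Proof.
move=> q0 qe x0; have [x1|x1] := lerP x 1.
  by have := @chebP_le1 _ q x q0; rewrite x0 x1 ler_norml => /(_ isT)/andP[].
have := @chebP_ge _ q (x - 1) q0 qe ltac:(lra); rewrite (addrC 1 (x - 1)) subrK.
apply: le_trans; have : 0 <= 2 * q%:R ^+ 2 * (x - 1).
  by rewrite !mulr_ge0 ?sqr_ge0// subr_ge0 ltW.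
lra.
Qed.

(** With [y = 1 + 2s] one has [y^2 - 1 = 4s + 4s^2], whose root is at least [2 sqrt s]. This
    exponential growth replaces the linear bound when most of the sample may be contaminated. *)
Lemma chebP_ge_expr (R : realType) (q : nat) (s : R) : (0 < q)%N -> ~~ odd q ->
  0 <= s -> 2^-1 * (1 + 2 * Num.sqrt s) ^+ q <= chebP q (1 + s).
Proof.
move=> q0 qe s0; rewrite chebP_even//.
set y := 2 * (1 + s) - 1; have y1 : 1 <= y by rewrite /y; lra.
have y2 : 0 <= y ^+ 2 - 1 by rewrite /y; nra.
apply: le_trans (@chebT_ge_half_expr _ y (Num.sqrt (y ^+ 2 - 1)) q y1 _ _) => //; last first.
  by rewrite sqr_sqrtr.
rewrite ler_pM2l//.
apply: lerXn2r; rewrite ?nnegrE.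
- by rewrite addr_ge0// mulr_ge0// sqrtr_ge0.
- by rewrite addr_ge0 ?sqrtr_ge0//; lra.
apply: lerD => //.
rewrite -(@ler_pXn2r _ 2)// ?nnegrE ?mulr_ge0 ?sqrtr_ge0// sqr_sqrtr// exprMn sqr_sqrtr//.
by rewrite /y; nra.
Qed.

Lemma cheb_coef0 (R : realType) (q : nat) : (0 < q)%N -> cheb_coef R 0 q = 1.
Proof.
by move=> q0; rewrite cheb_coefE// muln0 !bin0 expr0 mul1r divff// pnatr_eq0.
Qed.

(* The coefficients alternate in sign, so the sum is the value at [x = -1]. *)
Lemma sum_norm_cheb_coef (R : realType) (q : nat) : (0 < q)%N ->
  \sum_(j < q.+1) `|cheb_coef R j q| <= (3 + 2 * Num.sqrt 2) ^+ q.
Proof.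
move=> q0; have s2 : (2 * Num.sqrt 2) ^+ 2 = 3 ^+ 2 - 1 :> R.
  by rewrite exprMn sqr_sqrtr//; lra.
apply: le_trans (@chebT_le_expr _ 3 (2 * Num.sqrt 2) q _ _ s2); last 2 first.
- lra.
- by rewrite mulr_ge0// sqrtr_ge0.
have -> : 3 = 1 - 2 * (-1) :> R by lra.
rewrite -chebPE// ler_sum// => j _.
rewrite cheb_coefE//; last by rewrite -ltnS.
rewrite !normrM normfV normr_nat normrX normrN !normr_nat.
move: (_ + _)%:R => c; have -> : (-4) ^+ j = (-1) ^+ j * 4 ^+ j :> R by rewrite -exprMn mulN1r.
have : (-1) ^+ j * (-1) ^+ j = 1 :> R by rewrite -exprMn mulrNN mulr1 expr1n.
move: ((-1) ^+ j) => e ee.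
have -> : e * 4 ^+ j * c / 2 * e = (e * e) * (4 ^+ j * c / 2) by ring.
by rewrite ee mul1r.
Qed.

(** * Gaussian moments and independence *)

(** The change of variables is available for the Radon-Nikodym derivative, which equals the density
    almost everywhere because both have the same integral over measurable sets. *)
Lemma ge0_integral_normal_prob (R : realType) (f : R -> \bar R) :
  measurable_fun [set: R] f -> (forall x, 0 <= f x)%E ->
  (\int[normal_prob (0 : R) 1]_x f x =
   \int[lebesgue_measure]_x (f x * (normal_pdf 0 1 x)%:E))%E.
Proof.
move=> mf f0.
have dom := @normal_prob_dominates R 0 1.
rewrite -(@Radon_Nikodym_SigmaFinite.change_of_variables _ _ _ (normal_prob (0 : R) 1) lebesgue_measure dom f setT f0 measurableT mf).
apply: ae_eq_integral => //.
- apply: emeasurable_funM => //.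
  by apply: (measurable_int lebesgue_measure); exact: Radon_Nikodym_SigmaFinite.f_integrable.
- by apply: emeasurable_funM => //; apply/measurable_EFinP; exact: measurable_normal_pdf.
- apply: ae_eqe_mul2l; apply: integral_ae_eq => //.
  + exact: Radon_Nikodym_SigmaFinite.f_integrable.
  + by apply/measurable_EFinP; exact: measurable_normal_pdf.
  + by move=> E _ mE; rewrite -Radon_Nikodym_SigmaFinite.f_integral.
Qed.

Lemma normal_pdf01E (R : realType) (m x : R) :
  normal_pdf m 1 x = normal_peak 1 * expR (- (x - m) ^+ 2 / 2).
Proof. by rewrite normal_pdfE ?oner_eq0// /normal_fun expr1n. Qed.

Lemma integral_expR_normal_pdf (R : realType) (s : R) :
  (\int[lebesgue_measure]_x (expR (s * x) * normal_pdf 0 1 x)%:E =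
   (expR (s ^+ 2 / 2))%:E)%E.
Proof.
have eq x : expR (s * x) * normal_pdf 0 1 x = expR (s ^+ 2 / 2) * normal_pdf s 1 x.
  rewrite !normal_pdf01E !(mulrCA _ (normal_peak 1)) -!expRD; congr (_ * expR _).
  by field.
under eq_integral do rewrite eq EFinM.
rewrite ge0_integralZl//.
- by rewrite integral_normal_pdf mule1.
- by apply/measurable_EFinP; exact: measurable_normal_pdf.
- by move=> x _; rewrite lee_fin normal_pdf_ge0.
Qed.

Section standard_normal.
Context (R : realType) (d : measure_display) (T : measurableType d).
Variables (P : probability T R) (X : {RV P >-> R}).
Hypothesis lawX :
  forall B : set R, measurable B -> distribution P X B = normal_prob 0 1 B.

(* The law of [X] lives on the type [R] while [normal_prob] is a measure on
   [measurableTypeR R]; the two differ only by their display. *)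
Let X' : T -> measurableTypeR R := X.

Let mX' : measurable_fun [set: T] X'.
Proof. exact: (measurable_funPT X). Qed.

HB.instance Definition _ := isMeasurableFun.Build _ _ T (measurableTypeR R) X' mX'.

Lemma ge0_integral_std_normal (f : R -> R) : measurable_fun [set: R] f ->
  (forall x, 0 <= f x) ->
  (\int[P]_w (f (X w))%:E =
   \int[lebesgue_measure]_x (f x * normal_pdf 0 1 x)%:E)%E.
Proof.
move=> mf f0; have mf' : measurable_fun [set: R] (EFin \o f) by exact/measurable_EFinP.
rewrite -(@ge0_integral_distribution _ _ _ _ _ P X' (EFin \o f)) => [|//|x]; last by rewrite lee_fin.
have -> : (\int[distribution P X']_y (EFin \o f) y =
    \int[normal_prob (0 : R) 1]_y (EFin \o f) y)%E.
  by apply: eq_measure_integral => A mA _; exact: lawX.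
by rewrite ge0_integral_normal_prob// => x; rewrite lee_fin.
Qed.

Lemma std_normal_mgf (s : R) :
  (\int[P]_w (expR (s * X w))%:E = (expR (s ^+ 2 / 2))%:E)%E.
Proof.
rewrite (@ge0_integral_std_normal (fun x => expR (s * x))); last 2 first.
- by apply: measurableT_comp => //; exact: measurable_funM.
- by move=> x; exact: expR_ge0.
exact: integral_expR_normal_pdf.
Qed.

End standard_normal.

(** * Gaussian probabilities of half-lines *)

Lemma normal_prob_ge0_half (R : realType) :
  normal_prob (0 : R) 1 `[0, +oo[%classic = (2^-1)%:E.
Proof.
have := @ge0_symfun_integralT R (normal_pdf 0 1) (normal_pdf_ge0 0 1) (@continuous_normal_pdf R 0 1 (oner_neq0 _)).
rewrite integral_normal_pdf -set_itvcy => h.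
rewrite /normal_prob; move: h.
set I := (X in (_ * X)%E); set J := (X in _ -> X = _).
have -> : J = I by [].
have I0 : (0 <= I)%E by apply: integral_ge0 => x _; rewrite lee_fin normal_pdf_ge0.
have ev : normal_pdf (0 : R) 1 =1 normal_pdf 0 1 \o -%R.
  by move=> x /=; rewrite !normal_pdf01E !subr0 sqrrN.
move=> /(_ ev); case: I I0 => [r||]//.
  by rewrite -EFinM => _ [] r2; congr EFin; lra.
by move=> _; rewrite mulry gtr0_sg// mul1e.
Qed.

(** The standard normal density at 1, which is its minimum on [[0, 1]]. *)
Definition normal_density_lb (R : realType) : R := normal_peak 1 * expR (- 2^-1).

Lemma normal_density_lb_gt0 (R : realType) : 0 < normal_density_lb R.
Proof. by rewrite mulr_gt0 ?expR_gt0// normal_peak_gt0// oner_neq0. Qed.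

Lemma normal_prob_itv_lb (R : realType) (v : R) : 0 <= v <= 1 ->
  ((normal_density_lb R * v)%:E <= normal_prob (0 : R) 1 `[0%R, v]%classic)%E.
Proof.
move=> /andP[v0 v1]; rewrite /normal_prob.
have -> : (normal_density_lb R * v)%:E =
    (\int[lebesgue_measure]_(x in `[0%R, v]) (normal_density_lb R)%:E)%E.
  have /= := lebesgue_measure_itv `[0%R, v]; rewrite lte_fin => h.
  rewrite integral_cst//= h.
  case: ltP => v0'; first by rewrite -EFinB subr0 -EFinM.
  have -> : v = 0 by lra.
  by rewrite mule0 mulr0.
apply: ge0_le_integral => //.
- by move=> x _; rewrite lee_fin ltW// normal_density_lb_gt0.
- by apply/measurable_EFinP; apply: measurable_funTS; exact: measurable_normal_pdf.
- move=> x /=; rewrite in_itv/= => /andP[x0 xv].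
  rewrite lee_fin normal_pdf01E ler_pM2l ?normal_peak_gt0 ?oner_neq0// ler_expR.
  by rewrite subr0; nra.
Qed.

Lemma normal_prob_le_lb (R : realType) (v : R) : 0 <= v <= 1 ->
  ((2^-1 + normal_density_lb R * v)%:E <= normal_prob (0 : R) 1 `]-oo, v]%classic)%E.
Proof.
move=> v01; have /andP[v0 v1] := v01.
have m0v : measurable `[0, v]%classic by [].
have -> : `]-oo, v]%classic = `]-oo, 0[%classic `|` `[0, v]%classic :> set R.
  by rewrite (@itv_bndbnd_setU _ _ _ (BLeft 0))// bnd_simp.
rewrite measureU//; last first.
  apply/seteqP; split => x //=; rewrite !in_itv/= => -[x0 /andP[x0' _]]; lra.
rewrite EFinD leeD ?normal_prob_itv_lb//.
have := probability_setT (normal_prob (0 : R) 1).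
have -> : [set: R] = `]-oo, 0[%classic `|` `[0, +oo[%classic.
  by rewrite -(@itv_bndbnd_setU _ _ _ (BLeft 0))// set_itvNyy.
rewrite measureU//; last first.
  apply/seteqP; split => x //=; rewrite !in_itv/= => -[x0 /andP[x0' _]]; lra.
move=> h; have {h} : (normal_prob (0 : R) 1 `]-oo, 0%R[%classic + (2^-1)%:E = 1)%E.
  by rewrite -(normal_prob_ge0_half R); exact: h.
have : normal_prob (0 : R) 1 `]-oo, 0%R[%classic \is a fin_num by exact: fin_num_measure.
set J := (X in _ -> _ -> (_ <= X)%E); have -> : J = normal_prob (0 : R) 1 `]-oo, 0%R[%classic by [].
case: (normal_prob _ _ _) => // r _; rewrite -EFinD => -[] r2; rewrite lee_fin; lra.
Qed.

(** Chernoff's bound: past [x] the density is at most its product with [expR (x * y - x ^+ 2)],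
    whose total mass is [expR (- (x ^+ 2 / 2))]. *)
Lemma normal_prob_tail (R : realType) (x : R) : 0 <= x ->
  (normal_prob (0 : R) 1 `]x, +oo[%classic <= (expR (- (x ^+ 2 / 2)))%:E)%E.
Proof.
move=> x0.
have -> : (expR (- (x ^+ 2 / 2)))%:E =
    (\int[lebesgue_measure]_y ((expR (- x ^+ 2))%:E * (expR (x * y) * normal_pdf 0 1 y)%:E))%E.
  rewrite ge0_integralZl//.
  - by rewrite integral_expR_normal_pdf -EFinM -expRD; congr (expR _)%:E; field.
  - apply/measurable_EFinP; apply: measurable_funM; last exact: measurable_normal_pdf.
    by apply: measurableT_comp => //; exact: measurable_funM.
  - by move=> y _; rewrite lee_fin mulr_ge0 ?expR_ge0 ?normal_pdf_ge0.
have mp : measurable_fun [set: measurableTypeR R] (fun y => (expR (- x ^+ 2))%:E * (expR (x * y) * normal_pdf 0 1 y)%:E)%E.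
  apply/measurable_EFinP; apply: measurable_funM => //.
  apply: measurable_funM; last exact: measurable_normal_pdf.
  by apply: measurableT_comp => //; exact: measurable_funM.
apply: (@le_trans _ _ (\int[lebesgue_measure]_(y in `]x, +oo[) ((expR (- x ^+ 2))%:E * (expR (x * y) * normal_pdf 0 1 y)%:E))%E).
  apply: ge0_le_integral => //.
  - by move=> y _; rewrite lee_fin normal_pdf_ge0.
  - by apply/measurable_EFinP; apply: measurable_funTS; exact: measurable_normal_pdf.
  - by apply: measurable_funTS.
  - move=> y /=; rewrite in_itv/= andbT => xy.
    rewrite -EFinM lee_fin mulrA -expRD ler_peMl ?normal_pdf_ge0//.
    rewrite -[leLHS]expR0 ler_expR; nra.
apply: ge0_subset_integral => //.
by move=> y _; rewrite -EFinM lee_fin !mulr_ge0 ?expR_ge0 ?normal_pdf_ge0.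
Qed.

(* When no preimage exists, [Phibar_inv] is the junk value 0, which satisfies the
   same bound: existence is never needed. *)
Lemma Phibar_inv_bound (R : realType) (L : R) : 0 < L -> expR (- L) < 2^-1 ->
  0 <= Phibar_inv (expR (- L)) <= Num.sqrt (2 * L).
Proof.
move=> L0 L2; rewrite /Phibar_inv; case: xgetP => [x _ /= Phix|_]; last by rewrite sqrtr_ge0 lexx.
have fin : normal_prob (0 : R) 1 `]x, +oo[%classic \is a fin_num.
  by apply: fin_num_measure; exact: measurable_itv.
have Nx : normal_prob (0 : R) 1 `]x, +oo[%classic = (expR (- L))%:E.
  by rewrite -Phix fineK.
have x0 : 0 <= x.
  rewrite leNgt; apply/negP => x0.
  have : (normal_prob (0 : R) 1 `[0%R, +oo[%classic <= normal_prob (0 : R) 1 `]x, +oo[%classic)%E.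
    apply: le_measure; rewrite ?inE//; try exact: measurable_itv.
    by move=> y /=; rewrite !in_itv/= !andbT; apply: lt_le_trans.
  by rewrite normal_prob_ge0_half Nx lee_fin leNgt L2.
rewrite x0/=; have := normal_prob_tail x0; rewrite Nx lee_fin ler_expR lerN2 => h.
rewrite -[leLHS]ger0_norm// -sqrtr_sqr ler_wsqrtr//; lra.
Qed.

(** * Variance of weighted sums of independent terms *)

Section independent_pair.
Context (R : realType) (d : measure_display) (T : measurableType d).
Variables (P : probability T R) (X Y : {RV P >-> R}).
Hypothesis indXY : forall A B : set R, measurable A -> measurable B ->
  P ((X @^-1` A) `&` (Y @^-1` B)) = (P (X @^-1` A) * P (Y @^-1` B))%E.

Let XY (w : T) : R * R := (X w, Y w).

Let mXY : measurable_fun [set: T] XY.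
Proof. by apply: measurable_fun_pair; exact: measurable_funPT. Qed.

HB.instance Definition _ := isMeasurableFun.Build _ _ T (R * R)%type XY mXY.

(** The law of the pair agrees with the product measure on rectangles, hence everywhere, and
    Tonelli's theorem applies. *)
Lemma ge0_integral_indep (f g : R -> R) :
  measurable_fun [set: R] f -> measurable_fun [set: R] g ->
  (forall x, 0 <= f x) -> (forall x, 0 <= g x) ->
  (\int[P]_w (f (X w) * g (Y w))%:E =
   (\int[P]_w (f (X w))%:E) * (\int[P]_w (g (Y w))%:E))%E.
Proof.
move=> mf mg f0 g0.
have mf' : measurable_fun [set: R] (EFin \o f) by exact/measurable_EFinP.
have mg' : measurable_fun [set: R] (EFin \o g) by exact/measurable_EFinP.
have f0' x : (0 <= (EFin \o f) x)%E by rewrite lee_fin.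
have g0' x : (0 <= (EFin \o g) x)%E by rewrite lee_fin.
pose h (z : R * R) : \bar R := ((f z.1)%:E * (g z.2)%:E)%E.
have mh : measurable_fun [set: R * R] h.
  by apply: emeasurable_funM; apply/measurable_EFinP; apply: measurableT_comp.
have h0 z : (0 <= h z)%E by rewrite mule_ge0// lee_fin.
transitivity (\int[distribution P XY]_z h z)%E.
  by rewrite ge0_integral_distribution.
transitivity (\int[distribution P X \x distribution P Y]_z h z)%E.
  apply: eq_measure_integral => A mA _; apply/esym.
  by apply: product_measure_unique => // B C mB mC; exact: indXY.
rewrite fubini_tonelli1// /fubini_F /h /=.
transitivity (\int[distribution P X]_x
    ((f x)%:E * \int[distribution P Y]_y (g y)%:E))%E.
  apply: eq_integral => x _; rewrite ge0_integralZl//.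
  - by move=> y _; exact: g0'.
  - exact: f0'.
rewrite ge0_integralZr//; last 2 first.
- by move=> y _; exact: f0'.
- by apply: integral_ge0 => y _; exact: g0'.
by congr (_ * _)%E; rewrite ge0_integral_distribution.
Qed.

End independent_pair.

Section weak_law.
Context (R : realType) (n : nat) (d : measure_display) (T : measurableType d).
Variables (P : probability T R) (xi : 'I_n -> {RV P >-> R}).
Hypothesis indep : mutually_independent P xi.

Lemma mutually_independent_pair (i j : 'I_n) (A B : set R) : i != j ->
  measurable A -> measurable B ->
  P ((xi i @^-1` A) `&` (xi j @^-1` B)) =
  (P (xi i @^-1` A) * P (xi j @^-1` B))%E.
Proof.
move=> ij mA mB; pose C k := if k == i then A else B.
have := @indep [set i; j]%SET C; rewrite big_setU1 ?inE//= big_set1 /C eqxx.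
rewrite (eq_sym j) (negbTE ij) => <-; last by move=> k; case: ifP.
congr (P _); apply/seteqP; split => w.
  by move=> [wA wB] k /=; rewrite !inE => /orP[]/eqP->; rewrite ?eqxx// eq_sym (negbTE ij).
move=> h; split.
  by have := h i; rewrite /= !inE eqxx => /(_ isT).
by have := h j; rewrite /= !inE eqxx orbT eq_sym (negbTE ij) => /(_ isT).
Qed.

(** Since [f] is nonnegative, the sum and its square expand into integrals of nonnegative functions,
    and no integrability has to be established beforehand. *)
Lemma sqr_sum_deviation (f : R -> R) (m s : R) (a : 'I_n -> R) :
  measurable_fun [set: R] f -> (forall x, 0 <= f x) -> 
  (forall i, \int[P]_w (f (xi i w))%:E = m%:E)%E ->
  (forall i, \int[P]_w (f (xi i w) ^+ 2)%:E = s%:E)%E ->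
  (forall i, 0 <= a i) ->
  (\int[P]_w ((\sum_i a i * (f (xi i w) - m)) ^+ 2)%:E =
     ((s - m ^+ 2) * \sum_i a i ^+ 2)%:E)%E.
Proof.
move=> mf f0 fm fs a0; set A := \sum_i a i; set Q := \sum_i a i ^+ 2.
pose F i w := f (xi i w); pose S w := \sum_i a i * F i w.
have mF i : measurable_fun [set: T] (F i) by apply: measurableT_comp => //; exact: measurable_funPT.
have mS : measurable_fun [set: T] S by apply: measurable_sum => i; exact: measurable_funM.
have F0 i w : 0 <= F i w by exact: f0.
have S0 w : 0 <= S w by apply: sumr_ge0 => i _; rewrite mulr_ge0.
have A0 : 0 <= A by exact: sumr_ge0.
have m0 (i : 'I_n) : 0 <= m by rewrite -lee_fin -(fm i); apply: integral_ge0 => w _; rewrite lee_fin.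
have mA0 : 0 <= m * A.
  rewrite mulr_sumr; apply: sumr_ge0 => i _; rewrite mulr_ge0//; exact: (m0 i).
have ES : (\int[P]_w (S w)%:E = (m * A)%:E)%E.
  rewrite /S; under eq_integral do rewrite -sumEFin.
  rewrite ge0_integral_sum//; last 2 first.
  - by move=> i; apply/measurable_EFinP; exact: measurable_funM.
  - by move=> i w _; rewrite lee_fin mulr_ge0.
  rewrite mulr_sumr -sumEFin; apply: eq_bigr => i _.
  under eq_integral do rewrite EFinM.
  rewrite ge0_integralZl//.
  - by rewrite fm -EFinM mulrC.
  - exact/measurable_EFinP.
  - by move=> w _; rewrite lee_fin.
  - by rewrite lee_fin.
have ES2 : (\int[P]_w (S w ^+ 2)%:E = ((s - m ^+ 2) * Q + (m * A) ^+ 2)%:E)%E.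
  have SE w : S w ^+ 2 = \sum_i \sum_j a i * a j * (F i w * F j w).
    rewrite expr2 /S mulr_suml; apply: eq_bigr => i _; rewrite mulr_sumr.
    by apply: eq_bigr => j _; ring.
  under eq_integral do rewrite SE -sumEFin.
  rewrite ge0_integral_sum//; last 2 first.
  - move=> i; apply/measurable_EFinP; apply: measurable_sum => j.
    by apply: measurable_funM => //; exact: measurable_funM.
  - by move=> i w _; rewrite lee_fin; apply: sumr_ge0 => j _; rewrite !mulr_ge0.
  have Eij i j : (\int[P]_w (a i * a j * (F i w * F j w))%:E =
      (a i * a j * (if i == j then s else m ^+ 2))%:E)%E.
    under eq_integral do rewrite EFinM.
    rewrite ge0_integralZl//; last 3 first.
    - by apply/measurable_EFinP; exact: measurable_funM.
    - by move=> w _; rewrite lee_fin mulr_ge0.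
    - by rewrite lee_fin mulr_ge0.
    rewrite [RHS]EFinM; congr (_ * _)%E; case: eqVneq => [->|ij].
      by rewrite -(fs j).
    rewrite ge0_integral_indep//; last by move=> B C mB mC; exact: mutually_independent_pair.
    by rewrite (fm i) (fm j) -EFinM.
  transitivity (\sum_i \sum_j (a i * a j * (if i == j then s else m ^+ 2))%:E)%E.
    apply: eq_bigr => i _; under eq_integral do rewrite -sumEFin.
    rewrite ge0_integral_sum//; first by apply: eq_bigr => j _; exact: Eij.
    - by move=> j; apply/measurable_EFinP; apply: measurable_funM => //; exact: measurable_funM.
    - by move=> j w _; rewrite lee_fin !mulr_ge0.
  under eq_bigr do rewrite sumEFin; rewrite sumEFin; congr EFin.
  have -> : (m * A) ^+ 2 = \sum_i \sum_j a i * a j * m ^+ 2.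
    rewrite exprMn [A ^+ 2]expr2 {1}/A mulr_suml mulr_sumr; apply: eq_bigr => i _.
    by rewrite !mulr_sumr; apply: eq_bigr => j _; ring.
  rewrite /Q mulr_sumr -big_split/=; apply: eq_bigr => i _.
  rewrite (bigD1 i)//= eqxx [in RHS](bigD1 i)//=.
  have -> : \sum_(j < n | j != i) a i * a j * (if i == j then s else m ^+ 2) =
     \sum_(j < n | j != i) a i * a j * m ^+ 2.
    by apply: eq_bigr => j; rewrite eq_sym => /negbTE->.
  ring.
have EE w : \sum_i a i * (f (xi i w) - m) = S w - m * A.
  by rewrite /S /A mulr_sumr -sumrB; apply: eq_bigr => i _; rewrite /F; ring.
under eq_integral do rewrite EE.
(* The cross term [2 * (m * A) * S] stays on the left, where all summands are nonnegative; it is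
   cancelled once the finite right-hand side has shown that the integral is finite. *)
have key : (\int[P]_w ((S w - m * A) ^+ 2)%:E + (2 * (m * A) ^+ 2)%:E =
   ((s - m ^+ 2) * Q + (m * A) ^+ 2)%:E + ((m * A) ^+ 2)%:E)%E.
  transitivity (\int[P]_w (((S w - m * A) ^+ 2)%:E + (2 * (m * A) * S w)%:E))%E.
    rewrite ge0_integralD//; last 4 first.
    - by move=> w _; rewrite lee_fin sqr_ge0.
    - by apply/measurable_EFinP; apply: measurable_funX; exact: measurable_funB.
    - by move=> w _; rewrite lee_fin; apply: mulr_ge0 => //; exact: mulr_ge0.
    - by apply/measurable_EFinP; exact: measurable_funM.
    congr (_ + _)%E; under eq_integral do rewrite EFinM.
    rewrite ge0_integralZl//; last 3 first.
    - exact/measurable_EFinP.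
    - by move=> w _; rewrite lee_fin.
    - by rewrite lee_fin mulr_ge0.
    by rewrite ES -EFinM; congr EFin; ring.
  rewrite -ES2.
  have -> : ((m * A) ^+ 2)%:E = (\int[P]_w (cst ((m * A) ^+ 2)%:E w))%E.
    by rewrite integral_cst// [X in (_ * X)%E]probability_setT mule1.
  rewrite -ge0_integralD//; last 3 first.
  - by move=> w _; rewrite lee_fin sqr_ge0.
  - by apply/measurable_EFinP; exact: measurable_funX.
  - by move=> w _; rewrite /= lee_fin sqr_ge0.
  by apply: eq_integral => w _; rewrite -!EFinD /cst; congr EFin; ring.
move: key; set I := (X in (X + _)%E); set J := (X in _ -> X = _).
have -> : J = I by [].
case: I => [r||]//.
rewrite -!EFinD => -[] h; congr EFin.
by apply: (addIr (2 * (m * A) ^+ 2)); rewrite h; ring.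
Qed.

End weak_law.

(** * Deterministic analysis of the estimators *)

Lemma count_le_sorted (R : realType) (s : seq R) (t : R) (j : nat) :
  sorted <=%R s -> (j < size s)%N ->
  (nth 0 s j <= t) = (j < count (<= t) s)%N.
Proof.
move=> ss js; apply/idP/idP => [sjt|].
  rewrite -(cat_take_drop j.+1 s) count_cat (_ : count _ (take _ _) = j.+1) ?leq_addr//.
  have sz : size (take j.+1 s) = j.+1 by rewrite size_take_min; apply/minn_idPl.
  rewrite -[RHS]sz; apply/eqP; rewrite -all_count; apply/(all_nthP 0) => i; rewrite sz => ij /=.
  rewrite nth_take//; apply: le_trans sjt.
  apply: (sorted_leq_nth le_trans le_refl _ ss); rewrite ?inE//.
  exact: leq_trans ij js.
apply: contraTT; rewrite -ltNge -leqNgt => tsj.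
rewrite -(cat_take_drop j s) count_cat (_ : count _ (drop _ _) = 0%N).
  by rewrite addn0 (leq_trans (count_size _ _))// size_take_min geq_minl.
apply/eqP; rewrite -leqn0 leqNgt -has_count -all_predC; apply/(all_nthP 0) => i.
rewrite size_drop => ij /=; rewrite -ltNge nth_drop; apply: lt_le_trans tsj _.
by apply: (sorted_leq_nth le_trans le_refl _ ss); rewrite ?inE ?leq_addr// -ltn_subRL.
Qed.

Lemma order_stat_le (R : realType) (n : nat) (y : 'I_n -> R) (j : nat) (t : R) :
  (0 < j <= n)%N -> (order_stat y j <= t) = (j <= #|[pred i | (y i <= t)%R]|)%N.
Proof.
move=> /andP[j0 jn]; rewrite /order_stat count_le_sorted; last 2 first.
- exact: (sort_sorted (@le_total _ _)).
- by rewrite size_sort size_map size_enum_ord; lia.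
rewrite count_sort count_map prednK// cardE size_filter.
by rewrite enumT; congr (j <= _)%N; apply: eq_count.
Qed.

Lemma order_stat1_le (R : realType) (n : nat) (y : 'I_n -> R) (i : 'I_n) :
  order_stat y 1 <= y i.
Proof.
have n0 : (0 < n)%N by case: n y i => [|//] y [].
by rewrite order_stat_le//; apply/card_gt0P; exists i; rewrite inE.
Qed.

Lemma order_stat1_mem (R : realType) (n : nat) (y : 'I_n -> R) : (0 < n)%N ->
  exists i, order_stat y 1 = y i.
Proof.
move=> n0; have : order_stat y 1 <= order_stat y 1 by [].
rewrite {1}order_stat_le// => /card_gt0P[i]; rewrite inE => h.
by exists i; apply/eqP; rewrite eq_le order_stat1_le h.
Qed.

(** The deviation of [eta_hat] with the growth [expR (lam * (u - theta))] factored out: it does not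
    depend on [u], so one bound serves the whole search interval. *)
Definition eta_dev (R : realType) (n : nat) (mu x : 'I_n -> R) (lam : R) : R :=
  n%:R^-1 * \sum_i expR (- (lam * mu i)) * (expR (- lam * x i - lam ^+ 2 / 2) - 1).

Definition noise (R : realType) (n : nat) (mu x : 'I_n -> R) (q : nat) : R :=
  \sum_(j < q.+1) `|cheb_coef R j q| * `|eta_dev mu x (j%:R * lambda_ R q)|.

Section deterministic.
Context (R : realType) (n : nat) (theta : R) (mu x : 'I_n -> R).
Hypothesis n0 : (0 < n)%N.
Let y (i : 'I_n) : R := theta + mu i + x i.

Lemma eta_hat_dev (lam v : R) : eta_hat y lam (theta + v) =
  n%:R^-1 * \sum_i expR (lam * (v - mu i)) + expR (lam * v) * eta_dev mu x lam.
Proof.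
rewrite /eta_hat /eta_dev mulrCA -mulrDr; congr (_ * _).
rewrite mulr_sumr -big_split/=; apply: eq_bigr => i _.
have -> : expR (lam * (theta + v - y i) - lam ^+ 2 / 2) = expR (lam * v) *
    expR (- (lam * mu i)) * expR (- lam * x i - lam ^+ 2 / 2).
  by rewrite -!expRD; congr expR; rewrite /y; ring.
have -> : expR (lam * (v - mu i)) = expR (lam * v) * expR (- (lam * mu i)).
  by rewrite -expRD; congr expR; ring.
by ring.
Qed.

(** The [j]-th exponential is the [j]-th power of [expR (lam * (v - mu i))], so the coefficients
    reassemble into [chebP]. *)
Lemma psi_hat_dev (q : nat) (lam v : R) : psi_hat y q lam (theta + v) =
  n%:R^-1 * \sum_i chebP q (expR (lam * (v - mu i))) +
  \sum_(j < q.+1) cheb_coef R j q * (expR (j%:R * lam * v) * eta_dev mu x (j%:R * lam)).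
Proof.
rewrite /psi_hat; under eq_bigr do rewrite eta_hat_dev mulrDr.
rewrite big_split/=; congr (_ + _).
under eq_bigr do rewrite mulrCA mulr_sumr.
rewrite -mulr_sumr exchange_big/=; congr (_ * _); apply: eq_bigr => i _.
by apply: eq_bigr => j _; rewrite -expRM_natl mulrA.
Qed.

Lemma psi_hat_le (q : nat) (u : R) : (0 < q)%N -> u <= theta ->
  (forall i, 0 <= mu i) -> psi_hat y q (lambda_ R q) u <= 1 + noise mu x q.
Proof.
move=> q0 ut mu0; have -> : u = theta + (u - theta) by rewrite addrC subrK.
have l0 : 0 <= lambda_ R q by exact: sqrtr_ge0.
have nR : 0 < n%:R :> R by rewrite ltr0n.
rewrite psi_hat_dev; apply: lerD.
  rewrite ler_pdivrMl// mulr1; apply: (@le_trans _ _ (\sum_(i < n) 1)); last by rewrite sumr_const card_ord.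
  apply: ler_sum => i _; apply: le_trans (ler_norm _) _; apply: chebP_le1 => //.
  rewrite expR_ge0/= -expR0 ler_expR mulr_ge0_le0//.
  by have := mu0 i; lra.
apply: ler_sum => j _; apply: le_trans (ler_norm _) _; rewrite normrM (normrM (expR _)).
apply: ler_wpM2l => //; rewrite ler_piMl// ger0_norm ?expR_ge0// -expR0 ler_expR.
by rewrite mulr_ge0_le0 ?mulr_ge0//; lra.
Qed.

(** At least [n - k] observations are clean and contribute the value [c] of the polynomial; the
    others contribute at least -1. This gives [(1 - k/n) * c - k/n], and the noise is amplified by
    at most the largest exponential. *)
Lemma psi_hat_ge (q k : nat) (v : R) : (0 < q)%N -> ~~ odd q -> 0 <= v ->
  sparse_nonneg k mu ->
  (1 - k%:R / n%:R) * (chebP q (expR (lambda_ R q * v)) + 1) - 1 -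
     expR (q%:R * lambda_ R q * v) * noise mu x q <=
  psi_hat y q (lambda_ R q) (theta + v).
Proof.
move=> q0 qe v0 [mu0 muk].
have l0 : 0 <= lambda_ R q by exact: sqrtr_ge0.
have nR : 0 < n%:R :> R by rewrite ltr0n.
rewrite psi_hat_dev; set c := chebP q (expR (lambda_ R q * v)).
have c1 : -1 <= c by rewrite chebP_geN1// expR_ge0.
apply: lerD; last first.
  rewrite lerNl -sumrN /noise mulr_sumr; apply: ler_sum => j _.
  apply: le_trans (ler_norm _) _; rewrite normrN normrM (normrM (expR _)).
  rewrite [leRHS]mulrCA; apply: ler_wpM2l => //.
  rewrite ger0_norm ?expR_ge0// ler_wpM2r// ler_expR.
  by rewrite !ler_wpM2r// ler_nat -ltnS.
rewrite ler_pdivlMl//.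
have -> : n%:R * ((1 - k%:R / n%:R) * (c + 1) - 1) = n%:R * c - k%:R * (c + 1).
  by field; rewrite gt_eqF.
apply: (@le_trans _ _ (\sum_i (c - (c + 1) * (mu i != 0)%:R))).
  rewrite sumrB sumr_const card_ord mulr_natl lerD2l lerN2 -mulr_sumr mulrC.
  apply: ler_wpM2r; first lra.
  by rewrite -natr_sum ler_nat (leq_trans _ muk)// -sum1_card [leqRHS]big_mkcond/=; apply: leq_sum => i _; rewrite inE; case: ifP.
apply: ler_sum => i _; case: eqP => [->|_] /=; first by rewrite mulr0 !subr0.
by rewrite mulr1; have := @chebP_geN1 R q (expR (lambda_ R q * (v - mu i))) q0 qe (expR_ge0 _); lra.
Qed.

Lemma crossing_set_gt (q : nat) (u : R) : (0 < q)%N ->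
  (forall i, 0 <= mu i) ->
  noise mu x q <= expR (a_const R * q%:R) / Num.sqrt n%:R ->
  crossing_set y q u -> theta < u.
Proof.
move=> q0 mu0 nq [_ _ +]; rewrite ltNge => /negP h; rewrite ltNge; apply/negP => ut.
by apply: h; apply: le_trans (psi_hat_le q0 ut mu0) _; rewrite lerD2l.
Qed.

(** No point up to [theta] crosses, and [theta + v] crosses as soon as it lies in the search
    interval. If it lies beyond [theta_up], the infimum and the default value are below it
    anyway. *)
Lemma theta_hat_bounds (q k : nat) (v : R) (eps : R) :
  (0 < q)%N -> ~~ odd q -> q != (qmax R n + 2)%N ->
  sparse_nonneg k mu -> 0 <= v ->
  eps = expR (a_const R * q%:R) / Num.sqrt n%:R ->
  noise mu x q <= eps -> theta <= theta_up y -> (theta_low y q <= theta%:E)%E ->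
  2 + eps + expR (q%:R * lambda_ R q * v) * eps <
    (1 - k%:R / n%:R) * (chebP q (expR (lambda_ R q * v)) + 1) ->
  theta <= theta_hat y q <= theta + v.
Proof.
move=> q0 qe qm smu v0 epsE nq tup tlow pop; have [mu0 muk] := smu.
rewrite epsE in nq.
have gt u := @crossing_set_gt q u q0 mu0 nq.
rewrite /theta_hat gtn_eqF// (negbTE qm).
case: asboolP => [ne|empty].
  have hasinf : has_inf (crossing_set y q).
    by split => //; exists theta => u /gt /ltW.
  rewrite lb_le_inf//=; last by move=> u /gt /ltW.
  have [vup|vup] := lerP (theta + v) (theta_up y); last first.
    case: ne => u cu; apply: (@le_trans _ _ u); first by apply: ge_inf => //; case: hasinf.
    by case: cu => _ uup _; apply: le_trans uup (ltW vup).
  apply: ge_inf; first by case: hasinf.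
  split => //; first by apply: le_trans tlow _; rewrite lee_fin lerDl.
  rewrite -epsE; apply: lt_le_trans (psi_hat_ge q0 qe v0 smu).
  have : expR (q%:R * lambda_ R q * v) * noise mu x q <= expR (q%:R * lambda_ R q * v) * eps.
    by rewrite epsE ler_wpM2l ?expR_ge0.
  move: (expR _ * noise _ _ _) (expR _ * eps) pop => A B pop AB; lra.
rewrite tup/=; rewrite leNgt; apply/negP => vup; apply: empty; exists (theta + v).
split => //; [by apply: le_trans tlow _; rewrite lee_fin lerDl | exact: ltW |].
rewrite -epsE; apply: lt_le_trans (psi_hat_ge q0 qe v0 smu).
have : expR (q%:R * lambda_ R q * v) * noise mu x q <= expR (q%:R * lambda_ R q * v) * eps.
  by rewrite epsE ler_wpM2l ?expR_ge0.
move: (expR _ * noise _ _ _) (expR _ * eps) pop => A B pop AB; lra.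
Qed.

End deterministic.

(** * Lepski's selection of the index *)

Lemma mem_index_range (R : realType) (n q : nat) :
  (q \in index_range R n) = (q <= qmax R n + 2)%N && ~~ odd q.
Proof. by rewrite mem_filter mem_iota andbC add0n ltnS. Qed.

Lemma admissibleP (R : realType) (n : nat) (y : 'I_n -> R) (q : nat) :
  reflect (forall q', (q < q' <= qmax R n + 2)%N -> ~~ odd q' ->
    `|theta_hat y q - theta_hat y q'| <= delta R n q') (admissible y q).
Proof.
apply: (iffP allP) => [h q' /andP[qq' q'm] oq'|h q'].
  by have := h q'; rewrite mem_index_range q'm oq' qq' => /(_ isT).
rewrite mem_index_range => /andP[q'm oq']; apply/implyP => qq'.
by apply: h => //; rewrite qq'.
Qed.

Lemma q_hatP (R : realType) (n : nat) (y : 'I_n -> R) :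
  [\/ q_hat y = (qmax R n + 2)%N | admissible y (q_hat y) /\ (q_hat y < qmax R n + 2)%N] /\
  (forall q, (q <= qmax R n + 2)%N -> ~~ odd q -> admissible y q -> (q_hat y <= q)%N).
Proof.
rewrite /q_hat; split.
  elim/big_rec: _ => [|q m aq [->|[am ml]]]; first by left.
    rewrite minnE; case: (ltnP q (qmax R n + 2)) => h; last by left; lia.
    by right; rewrite (_ : (_ - _)%N = q)//; lia.
  have [qm|mq] := leqP q m; last by right.
  by right; split => //; apply: leq_ltn_trans ml.
move=> q qm oq aq; have : q \in index_range R n by rewrite mem_index_range qm.
elim: (index_range R n) => // a s ih; rewrite inE big_cons => /predU1P[<-|/ih h].
  by rewrite aq geq_minl.
by case: ifP => _ //; apply: leq_trans h; rewrite geq_minr.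
Qed.

(* Lepski's argument: the selected index is at most [q] as soon as [q] is
   admissible, and then it is compared with [q] itself. *)
Lemma theta_ad_lepski (R : realType) (n : nat) (y : 'I_n -> R) (q : nat) :
  0 <= delta R n q -> (q <= qmax R n + 2)%N -> ~~ odd q -> admissible y q ->
  `|theta_ad y - theta_hat y q| <= delta R n q.
Proof.
move=> d0 qm oq aq; have [h /(_ q qm oq aq)] := q_hatP y.
rewrite leq_eqVlt => /predU1P[qq|qq]; first by rewrite /theta_ad qq subrr normr0.
case: h => [qh|[/admissibleP + _]].
  by move: qq; rewrite qh ltnNge qm.
by apply => //; rewrite qq.
Qed.

Lemma admissible_top (R : realType) (n : nat) (y : 'I_n -> R) :
  admissible y (qmax R n + 2).
Proof. by apply/admissibleP => q' /andP[]; rewrite ltnNge => /negP. Qed.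

(** * The thresholds for large samples *)

Lemma floor_evenE (R : realType) (x : R) :
  floor_even x = (Num.truncn x - odd (Num.truncn x))%N.
Proof.
rewrite /floor_even; set t := Num.truncn x; apply/eqP; rewrite eqn_leq; apply/andP; split.
  apply/bigmax_leqP => m om; have := ltn_ord m; rewrite ltnS => mt.
  have [ot|_] := boolP (odd t); last by rewrite subn0.
  rewrite -ltnS subn1 prednK ?ltn_neqAle ?mt ?andbT; last by case: (t) ot.
  by apply: contraNneq om => ->.
have lt : (t - odd t < t.+1)%N by rewrite ltnS leq_subr.
apply: (@leq_bigmax_cond _ (fun m : 'I_t.+1 => ~~ odd m) (fun m => m : nat) (Ordinal lt)).
by rewrite /= oddB ?leq_b1 ?oddb ?addbb//; case: (t) => // ?; case: odd.
Qed.

Lemma floor_even_spec (R : realType) (x : R) : 0 <= x ->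
  ~~ odd (floor_even x) /\ (floor_even x)%:R <= x < (floor_even x)%:R + 2.
Proof.
move=> x0; rewrite floor_evenE; set t := Num.truncn x.
have /andP[tx xt] : t%:R <= x < t.+1%:R by apply/(truncn_itv x0).
have ot : (odd t <= t)%N by case: (t) => // ?; case: odd.
rewrite oddB// oddb addbb natrB//; split => //.
move: xt; rewrite -natr1 => xt; case: (odd t) => /=; apply/andP; split; lra.
Qed.

Lemma powR32 (R : realType) (x : R) : 0 <= x -> x `^ (3 / 2) = x * Num.sqrt x.
Proof.
rewrite le_eqVlt => /predU1P[<-|x0].
  by rewrite powR0 ?mul0r// gt_eqF//; lra.
have -> : 3 / 2 = 1 + 2^-1 :> R by field.
by rewrite powRD ?gt_eqF ?implybT// powRr1 ?ltW// powR12_sqrt// ltW.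
Qed.

Lemma expR_half_le (R : realType) (x : R) : 0 <= x <= 1 -> expR (x / 2) <= 1 + x.
Proof.
move=> /andP[x0 x1]; have h := expR_ge1Dx (- (x / 2)).
have p : 0 < 1 - x / 2 by lra.
have -> : expR (x / 2) = (expR (- (x / 2)))^-1 by rewrite expRN invrK.
apply: (@le_trans _ _ (1 - x / 2)^-1).
  by rewrite lef_pV2 ?posrE ?expR_gt0// addrC.
by rewrite -div1r ler_pdivrMr//; nra.
Qed.

Lemma ln1D_ge_half (R : realType) (x : R) : 0 <= x <= 1 -> x / 2 <= ln (1 + x).
Proof.
move=> /[dup] x01 /andP[x0 x1].
by rewrite -[leLHS]expRK ler_ln ?posrE ?expR_gt0 ?expR_half_le//; lra.
Qed.

Lemma a_const_expR (R : realType) :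
  expR (a_const R / 3 - 1) = 3 + 2 * Num.sqrt 2.
Proof.
have -> : a_const R / 3 - 1 = ln (3 + 2 * Num.sqrt 2) by rewrite /a_const; field.
by rewrite lnK// posrE ltr_wpDr// mulr_ge0// sqrtr_ge0.
Qed.

Lemma a_const_ge3 (R : realType) : 3 <= a_const R.
Proof.
rewrite /a_const ler_peMr// lerDl ln_ge0//.
by have := sqrtr_ge0 (2 : R); lra.
Qed.

Lemma sqrt2_bounds (R : realType) : 14 / 10 <= Num.sqrt (2 : R) <= 15 / 10.
Proof.
have h := @sqr_sqrtr R 2 ltac:(lra); have h0 := sqrtr_ge0 (2 : R).
apply/andP; split; nra.
Qed.

Lemma lambdaM_sqrt (R : realType) (q : nat) : (0 < q)%N ->
  lambda_ R q * Num.sqrt q%:R = Num.sqrt 2.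
Proof.
move=> q0; rewrite /lambda_ -sqrtrM ?divr_ge0// divfK// pnatr_eq0 -lt0n//.
Qed.

Lemma lambda_ge0 (R : realType) (q : nat) : 0 <= lambda_ R q.
Proof. exact: sqrtr_ge0. Qed.

Lemma lambdaM (R : realType) (q : nat) : (0 < q)%N ->
  q%:R * lambda_ R q = Num.sqrt 2 * Num.sqrt q%:R.
Proof.
move=> q0; have {1}-> : q%:R = Num.sqrt q%:R ^+ 2 :> R by rewrite sqr_sqrtr.
by rewrite expr2 -mulrA (mulrC _ (lambda_ R q)) lambdaM_sqrt// mulrC.
Qed.

(** The thresholds carry a factor [e^(2a)]; this margin absorbs the noise, amplified by at most [e],
    and the loss due to contamination. *)
Lemma expR1_le (R : realType) (a : R) : 3 <= a -> 16 * expR 1 <= expR (2 * a) /\ 16 <= expR (2 * a).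
Proof.
move=> a3; have e3 : 4 <= expR 3 :> R by apply: le_trans (expR_ge1Dx _); lra.
have -> : 2 * a = 1 + (2 * a - 1) by ring.
have h : expR 3 * 4 <= expR (2 * a - 1).
  have -> : 2 * a - 1 = 3 + (2 * a - 4) by ring.
  rewrite (expRD 3) ler_wpM2l ?expR_ge0//.
  have h2 : expR 2 <= expR (2 * a - 4) by rewrite ler_expR; lra.
  have : expR 2 = expR 1 * expR 1 :> R by rewrite -expRD; congr expR; ring.
  have := expR_ge1Dx (1 : R); nra.
have e1 := expR_ge1Dx (1 : R).
rewrite (expRD 1); split; nra.
Qed.

(* The crossing condition of [theta_hat_bounds], through the linear lower bound
   on the Chebyshev polynomial. *)
Lemma crossing_linear (R : realType) (q : nat) (v kappa eps : R) :
  (0 < q)%N -> ~~ odd q -> 0 <= v -> 0 <= eps -> kappa <= 1 ->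
  Num.sqrt 2 * Num.sqrt q%:R * v <= 1 ->
  2 + eps + expR 1 * eps <
    (1 - kappa) * (2 + 2 * Num.sqrt 2 * (q%:R * Num.sqrt q%:R * v)) ->
  2 + eps + expR (q%:R * lambda_ R q * v) * eps <
    (1 - kappa) * (chebP q (expR (lambda_ R q * v)) + 1).
Proof.
move=> q0 qe v0 e0 k1 qv h; apply: le_lt_trans (lt_le_trans h _).
  by rewrite lerD2l ler_wpM2r// ler_expR lambdaM.
apply: ler_wpM2l; first by rewrite subr_ge0.
have l0 := lambda_ge0 R q; have lv0 : 0 <= lambda_ R q * v by exact: mulr_ge0.
have e1 := expR_ge1Dx (lambda_ R q * v).
have := @chebP_ge R q (expR (lambda_ R q * v) - 1) q0 qe ltac:(lra).
rewrite (addrC 1 (_ - 1)) subrK -(lerD2r 1); apply: le_trans.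
have -> : 2 + 2 * Num.sqrt 2 * (q%:R * Num.sqrt q%:R * v) =
    1 + 2 * q%:R ^+ 2 * (lambda_ R q * v) + 1.
  have := @lambdaM R q q0; set lam := lambda_ R q => lq.
  by transitivity (2 + 2 * q%:R * (q%:R * lam) * v); [rewrite lq|]; ring.
by rewrite lerD2r lerD2l ler_wpM2l ?mulr_ge0 ?sqr_ge0//; lra.
Qed.

(** The crossing margin [e^(aq) / sqrt n] as one exponential, so that comparisons become linear
    inequalities between exponents. *)
Definition eps_level (R : realType) (n q : nat) : R :=
  expR (a_const R * q%:R - ln n%:R / 2).

Section large_sample.
Context (R : realType) (n : nat).
Let a := a_const R.
Let L := ln (n%:R : R).
Let Q := qmax R n.
(** [346 = 2 * (169 + 4)]: this forces [169 <= qmax], and [169 = 13^2] is what [crossing_far]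
    requires. *)
Hypothesis Lbig : 346 * a <= L.

Let a3 : 3 <= a := a_const_ge3 R.

Lemma Lbig_ge : 1038 <= L. Proof. by move: a3 Lbig; nra. Qed.

Lemma n_gt0_of_Lbig : (0 < n)%N.
Proof.
rewrite lt0n; apply/eqP => n0; have := Lbig_ge; rewrite /L n0 ln0//; lra.
Qed.

Lemma natr_expR : n%:R = expR L.
Proof. by rewrite lnK// posrE ltr0n n_gt0_of_Lbig. Qed.

Lemma sqrtn_expR : Num.sqrt n%:R = expR (L / 2).
Proof.
have -> : n%:R = expR (L / 2) ^+ 2 by rewrite natr_expR -expRM_natl; congr expR; field.
by rewrite sqrtr_sqr ger0_norm// expR_ge0.
Qed.

(** In other words [e^(a (Q + 2)) <= sqrt n < e^(a (Q + 4))], so the crossing margin at [qmax] lies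
    between [e^(-4a)] and [e^(-2a)]. *)
Lemma qmax_spec : ~~ odd Q /\ a * (Q%:R + 2) <= L / 2 < a * (Q%:R + 4).
Proof.
have a0 : 0 < a by move: a3; lra.
have a20 : 0 < 2 * a by lra.
have x4 : 4 <= 1 / (2 * a) * L.
  by rewrite mul1r (ler_pdivlMl _ _ a20); move: Lbig; lra.
have [] := @floor_even_spec R (1 / (2 * a) * L) ltac:(lra).
rewrite /Q /qmax -/a -/L; set f := floor_even _ => of_ /andP[f1 f2].
have f2' : (2 <= f)%N.
  by rewrite -(ler_nat R); lra.
split; first by rewrite oddB// addbF.
rewrite natrB//.
move: f1 f2; rewrite mul1r (ler_pdivlMl _ _ a20) (ltr_pdivrMl _ _ a20).
by move=> f1 f2; apply/andP; split; nra.
Qed.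

Lemma qmax_ge : 169 <= Q%:R :> R.
Proof.
have [_ /andP[_ h]] := qmax_spec; rewrite leNgt; apply/negP => Q1.
by move: a3 Lbig; nra.
Qed.

Lemma qmax_lb : L <= 4 * a * Q%:R.
Proof. by have [_ /andP[_ h]] := qmax_spec; move: qmax_ge a3; nra. Qed.

Lemma qmax_ub : Q%:R <= L / 6.
Proof. by have [_ /andP[h _]] := qmax_spec; move: qmax_ge a3; nra. Qed.

Local Notation eps := (eps_level R n).

Lemma epsE (q : nat) : expR (a * q%:R) / Num.sqrt n%:R = eps q.
Proof. by rewrite /eps_level sqrtn_expR expRD expRN. Qed.

Lemma eps_le (q : nat) (c : R) : q%:R <= Q%:R - c -> eps q <= expR (- (a * (c + 2))).
Proof.
move=> qQ; have [_ /andP[h _]] := qmax_spec.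
rewrite ler_expR -/a -/L; have : a * q%:R <= a * (Q%:R - c) by rewrite ler_wpM2l//; move: a3; lra.
move: h; nra.
Qed.

Lemma delta_ltQ (q : nat) : (q < Q)%N ->
  delta R n q = 10 * expR (2 * a) * eps q / (q%:R * Num.sqrt q%:R).
Proof.
move=> qQ; rewrite /delta -/Q qQ powR32// -epsE invfM -/a.
have -> : a * (q%:R + 2) = 2 * a + a * q%:R by ring.
rewrite expRD -!mulrA; congr (_ * (_ * (_ * _))).
Qed.

Lemma delta_Q : delta R n Q = 25 / (Q%:R * Num.sqrt Q%:R).
Proof. by rewrite /delta -/Q ltnn eqxx powR32. Qed.

Lemma delta_top : delta R n (Q + 2) = 4 * Num.sqrt (2 * L).
Proof.
rewrite /delta -/Q -/L; case: ltnP => [|_]; first by lia.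
by case: eqP => // /eqP; rewrite -{2}[Q]addn0 eqn_add2l.
Qed.

Lemma delta_ge0 (q : nat) : 0 <= delta R n q.
Proof.
rewrite /delta; case: ifP => _; first by rewrite mulr_ge0// divr_ge0 ?expR_ge0// mulr_ge0 ?sqrtr_ge0 ?powR_ge0.
by case: ifP => _; rewrite ?divr_ge0 ?powR_ge0 ?mulr_ge0 ?sqrtr_ge0.
Qed.

(** At [v = delta q] the linear gain is at least [20 * e^(2a) * eps q] before the factor
    [1 - eps q], against a loss of [2 * eps q] by contamination and [(1 + e) * eps q] by noise. As
    [q + 2 <= Q], one has [e^(2a) * eps q <= 1/16], which keeps the amplification exponent at most
    1. *)
Lemma crossing_below_qmax (q : nat) (kappa : R) :
  (1 < q)%N -> (q + 2 <= Q)%N -> ~~ odd q -> kappa <= eps q ->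
  2 + eps q + expR (q%:R * lambda_ R q * delta R n q) * eps q <
    (1 - kappa) * (chebP q (expR (lambda_ R q * delta R n q)) + 1).
Proof.
move=> q1 qQ qe ke; have q0 : (0 < q)%N by lia.
have e4 : eps q <= expR (- (2 * a)) * expR (- (2 * a)).
  apply: le_trans (@eps_le q 2 _) _.
    by move: qQ; rewrite -(ler_nat R) natrD; lra.
  by rewrite -expRD ler_expR; lra.
have [E1 E2] := expR1_le a3.
have Ei : expR (- (2 * a)) * expR (2 * a) = 1 by rewrite -expRD addNr expR0.
have qs : 0 < q%:R * Num.sqrt q%:R :> R by rewrite mulr_gt0 ?sqrtr_gt0 ?ltr0n.
have s0 : 0 < Num.sqrt q%:R :> R by rewrite sqrtr_gt0 ltr0n.
have eps0 : 0 < eps q by exact: expR_gt0.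
have q2 : 2 <= q%:R :> R by rewrite ler_nat.
have /andP[s21 s22] := sqrt2_bounds R.
have dE : q%:R * Num.sqrt q%:R * delta R n q = 10 * expR (2 * a) * eps q.
  have qQ' : (q < Q)%N by apply: leq_trans qQ; rewrite addn2 leqW.
  by rewrite (delta_ltQ qQ') mulrC (divfK (lt0r_neq0 qs)).
have ee : expR (2 * a) * eps q <= expR (- (2 * a)).
  move: e4 Ei E2 (expR_ge0 (2 * a)).
  move: (expR (2 * a)) (expR (- (2 * a))) => E E' e4 Ei _ E0.
  have := ler_wpM2l E0 e4; have -> : E * (E' * E') = E' * E * E' by ring.
  by rewrite Ei mul1r.
have em : expR (- (2 * a)) <= 1 / 16.
  by have := expR_gt0 (- (2 * a)); move: E2 Ei; nra.
have e1 := expR_ge1Dx (1 : R).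
apply: crossing_linear => //; [exact: delta_ge0 | exact: ltW | | |].
- by apply: le_trans ke _; move: E2 ee eps0 em; nra.
- have -> : Num.sqrt 2 * Num.sqrt q%:R * delta R n q =
      Num.sqrt 2 * (10 * expR (2 * a) * eps q) / q%:R.
    by rewrite -dE; field; rewrite gt_eqF// ltr0n.
  rewrite ler_pdivrMr; last by lra.
  have : 0 <= expR (2 * a) * eps q by rewrite mulr_ge0 ?expR_ge0.
  have -> : 10 * expR (2 * a) * eps q = 10 * (expR (2 * a) * eps q) by ring.
  move: (expR (2 * a) * eps q) ee => X ee X0.
  have X1 : X <= 1 / 16 by lra.
  apply: (@le_trans _ _ (15 / 10 * (10 * X))); last lra.
  by rewrite ler_wpM2r//; lra.
rewrite dE; have k12 : eps q <= 1 / 2 by move: E2 ee eps0 em; nra.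
move: (expR (2 * a)) E1 E2 => E E1 E2.
apply: (@lt_le_trans _ _ ((1 - eps q) * (2 + 2 * Num.sqrt 2 * (10 * E * eps q)))).
  have h : 20 * (E * eps q) <= 2 * Num.sqrt 2 * (10 * E * eps q).
    by have : 0 <= E * eps q by [rewrite mulr_ge0//; lra]; nra.
  have h2 : (1 - eps q) * (2 + 20 * (E * eps q)) <=
     (1 - eps q) * (2 + 2 * Num.sqrt 2 * (10 * E * eps q)).
    by rewrite ler_wpM2l//; lra.
  apply: lt_le_trans h2.
  have h3 : 16 * (expR 1 * eps q) <= E * eps q by rewrite mulrA ler_wpM2r// ltW.
  have h4 : 16 * eps q <= E * eps q by rewrite ler_wpM2r// ltW.
  have h5 : 1 / 2 * (E * eps q) <= (1 - eps q) * (E * eps q) by rewrite ler_wpM2r//; lra.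
  nra.
apply: ler_wpM2r; last lra.
have p1 : 0 <= 10 * E * eps q by apply: mulr_ge0; [lra | exact: ltW].
have p2 : 0 <= Num.sqrt 2 * (10 * E * eps q) by apply: mulr_ge0; [lra | exact: p1].
by rewrite -mulrA; lra.
Qed.

Lemma sqrtQ_ge : 13 <= Num.sqrt Q%:R :> R.
Proof.
have -> : 13 = Num.sqrt (13 ^+ 2) :> R by rewrite sqrtr_sqr ger0_norm.
by apply: ler_wsqrtr; have := qmax_ge; lra.
Qed.

(** With the constant 25 of [delta] the gain [(1 - kappa) * (2 + 50 sqrt 2)] is at least 36 even for
    [kappa = 1/2]. *)
Lemma crossing_at_qmax (kappa : R) : ~~ odd Q -> kappa <= 1 / 2 ->
  2 + eps Q + expR (Q%:R * lambda_ R Q * delta R n Q) * eps Q <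
    (1 - kappa) * (chebP Q (expR (lambda_ R Q * delta R n Q)) + 1).
Proof.
move=> oQ k2; have Q1 := qmax_ge; have Q0 : (0 < Q)%N by rewrite -(ltr_nat R); lra.
have s13 := sqrtQ_ge.
have eQ : eps Q <= expR (- (2 * a)).
  by apply: le_trans (@eps_le Q 0 _) _; [lra | rewrite ler_expR; lra].
have [E1 E2] := expR1_le a3.
have Ei : expR (- (2 * a)) * expR (2 * a) = 1 by rewrite -expRD addNr expR0.
have /andP[s21 s22] := sqrt2_bounds R.
have dE : Q%:R * Num.sqrt Q%:R * delta R n Q = 25.
  by rewrite delta_Q mulrC divfK// gt_eqF// mulr_gt0//; lra.
have e1 := expR_ge1Dx (1 : R); have ei0 := expR_gt0 (- (2 * a)).
have eps0 : 0 < eps Q by exact: expR_gt0.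
have h3 : 16 * (expR 1 * eps Q) <= 1.
  have : 16 * expR 1 * eps Q <= expR (2 * a) * eps Q by rewrite ler_wpM2r// ltW.
  have : expR (2 * a) * eps Q <= expR (2 * a) * expR (- (2 * a)).
    by rewrite ler_wpM2l// expR_ge0.
  rewrite [_ * expR (- _)]mulrC Ei; lra.
have h4 : eps Q <= 1 by nra.
apply: crossing_linear => //; [exact: delta_ge0 | exact: ltW | lra | |].
- have -> : Num.sqrt 2 * Num.sqrt Q%:R * delta R n Q = Num.sqrt 2 * 25 / Q%:R.
    by rewrite -dE; field; rewrite gt_eqF// ltr0n.
  by rewrite ler_pdivrMr; lra.
rewrite dE; nra.
Qed.

End large_sample.

Section large_sample_bounds.
Context (R : realType) (n : nat).
Local Notation a := (a_const R).
Local Notation L := (ln (n%:R : R)).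
Local Notation Q := (qmax R n).
Local Notation eps := (eps_level R n).
Hypothesis Lbig : 346 * a <= L.

(** Writing [q' = q + 2t] with [q >= 2] gives [q' <= q * e^t]: the denominator grows by at most
    [e^(2t)], the numerator by [e^(2at)]. *)
Lemma expM_div_powR32_mono (q q' : nat) : (1 < q)%N -> (q <= q')%N ->
  eps q / (q%:R * Num.sqrt q%:R) <= eps q' / (q'%:R * Num.sqrt q'%:R).
Proof.
move=> q1 qq'; have a3 := a_const_ge3 R.
have q0 : 0 < q%:R :> R by rewrite ltr0n ltnW.
have q'0 : 0 < q'%:R :> R by rewrite ltr0n (leq_trans _ qq')// ltnW.
have s0 : 0 < Num.sqrt q%:R :> R by rewrite sqrtr_gt0.
have s'0 : 0 < Num.sqrt q'%:R :> R by rewrite sqrtr_gt0.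
rewrite ler_pdivrMr ?mulr_gt0// mulrAC ler_pdivlMr ?mulr_gt0//.
set t := (q'%:R - q%:R) / 2 : R.
have t0 : 0 <= t by rewrite /t divr_ge0// subr_ge0 ler_nat.
have h1 : q'%:R <= q%:R * expR t.
  apply: (@le_trans _ _ (q%:R * (1 + t))); last by rewrite ler_wpM2l ?expR_ge1Dx// ltW.
  have : 2 <= q%:R :> R by rewrite ler_nat.
  have -> : q'%:R = q%:R + 2 * t by rewrite /t; field.
  by move: (t) t0 => t' t0' h; rewrite mulrDr mulr1 lerD2l ler_wpM2r.
have h2 : Num.sqrt q'%:R <= Num.sqrt q%:R * expR t.
  rewrite -[X in _ <= _ * X]ger0_norm ?expR_ge0// -sqrtr_sqr -sqrtrM ?(ltW q0)//.
  apply: ler_wsqrtr; apply: le_trans h1 _; rewrite ler_wpM2l ?(ltW q0)// expr2 ler_peMl ?expR_ge0//.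
  by rewrite -[leLHS]expR0 ler_expR.
have h3 : eps q * (expR t * expR t) <= eps q'.
  rewrite -!expRD ler_expR.
  have -> : q'%:R = q%:R + 2 * t by rewrite /t; field.
  by move: (t) (a) t0 a3 => t' a' t0' a3'; nra.
have h4 : q'%:R * Num.sqrt q'%:R <= (q%:R * expR t) * (Num.sqrt q%:R * expR t).
  by apply: ler_pM => //; exact: ltW.
apply: (@le_trans _ _ (eps q * ((q%:R * expR t) * (Num.sqrt q%:R * expR t)))).
  by rewrite ler_wpM2l// expR_ge0.
have -> : eps q * ((q%:R * expR t) * (Num.sqrt q%:R * expR t)) =
  (eps q * (expR t * expR t)) * (q%:R * Num.sqrt q%:R) by ring.
by apply: ler_wpM2r => //; rewrite mulr_ge0// ltW.
Qed.

Lemma eps_qmax : 16 * (expR 1 * eps Q) <= 1 /\ expR (2 * a) * eps Q <= 1.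
Proof.
have eQ : eps Q <= expR (- (2 * a)).
  by apply: le_trans (@eps_le R n Lbig Q 0 _) _; [lra | rewrite ler_expR; lra].
have [E1 E2] := expR1_le (a_const_ge3 R).
have Ei : expR (- (2 * a)) * expR (2 * a) = 1 by rewrite -expRD addNr expR0.
have eps0 : 0 < eps Q by exact: expR_gt0.
move: (expR (2 * a)) (expR (- (2 * a))) E1 E2 Ei eQ => E E' E1 E2 Ei eQ.
have h1 : 16 * expR 1 * eps Q <= E * eps Q by rewrite ler_wpM2r// ltW.
have h2 : E * eps Q <= E * E' by rewrite ler_wpM2l//; lra.
rewrite (mulrC E E') Ei in h2; split; lra.
Qed.

Lemma delta_mono (q q' : nat) : (1 < q)%N -> (q <= q')%N -> (q' <= Q)%N ->
  delta R n q <= delta R n q'.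
Proof.
move=> q1 qq' q'Q; have [->|qq] := eqVneq q q' => //.
have qltq' : (q < q')%N by rewrite ltn_neqAle qq.
have h := expM_div_powR32_mono q1 qq'.
have E0 : 0 <= 10 * expR (2 * a) by rewrite mulr_ge0// expR_ge0.
rewrite (delta_ltQ Lbig (leq_trans qltq' q'Q)).
have h' := ler_wpM2l E0 h; rewrite mulrA in h'; apply: le_trans h' _.
move: q'Q; rewrite leq_eqVlt => /predU1P[->|q'Q]; last first.
  by rewrite (delta_ltQ Lbig q'Q) mulrA.
(* The formula of [delta] changes at [qmax], where [10 * e^(2a) * eps Q <= 10 <= 25]. *)
rewrite delta_Q mulrA ler_wpM2r//.
by have [_] := eps_qmax; lra.
Qed.

Lemma delta_qmax_le1 : delta R n Q <= 1.
Proof.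
have Q1 := qmax_ge Lbig; have s1 := sqrtQ_ge Lbig.
by rewrite delta_Q ler_pdivrMr ?mulr_gt0//; nra.
Qed.

Lemma sqrt2L_ge : 2 <= Num.sqrt (2 * L).
Proof.
have {1}-> : 2 = Num.sqrt (2 ^+ 2) :> R by rewrite sqrtr_sqr ger0_norm.
by apply: ler_wsqrtr; have := Lbig_ge Lbig; lra.
Qed.

(* [radius_far l] is the error level of [theta_hat qmax] when a fraction
   [exp (- l)] of the sample is uncontaminated. *)
Definition radius_far (l : R) : R :=
  (2 * l + 13) ^+ 2 / (Num.sqrt 2 * (Q%:R * Num.sqrt Q%:R)).

Lemma radius_far_le (l : R) : 0 <= l -> 4 * l + 52 <= Q%:R ->
  radius_far l <= Num.sqrt (2 * L).
Proof.
move=> l0 lQ; have Q1 := qmax_ge Lbig; have s1 := sqrtQ_ge Lbig.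
have /andP[s21 s22] := sqrt2_bounds R.
have sE : Num.sqrt Q%:R ^+ 2 = Q%:R :> R by rewrite sqr_sqrtr//; lra.
apply: (@le_trans _ _ (Num.sqrt Q%:R)); last first.
  by apply: ler_wsqrtr; have := qmax_ub Lbig; have := Lbig_ge Lbig; lra.
rewrite /radius_far ler_pdivrMr; last by rewrite !mulr_gt0//; lra.
have -> : Num.sqrt Q%:R * (Num.sqrt 2 * (Q%:R * Num.sqrt Q%:R)) = Num.sqrt 2 * Q%:R ^+ 2 :> R.
  transitivity (Num.sqrt 2 * Q%:R * Num.sqrt Q%:R ^+ 2 : R); first by ring.
  by rewrite sE; ring.
have : (2 * l + 13) ^+ 2 <= Q%:R ^+ 2 by apply: lerXn2r; rewrite ?nnegrE; lra.
by have := sqr_ge0 (Q%:R : R); nra.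
Qed.

(** The radius is such that [lambda * radius = z^2] with [z = (2l + 13) / Q], and [chebP_ge_expr]
    then yields [(1 + 2z)^Q / 2 >= e^(2l + 13) / 2]. Of the factor [e^(2l)], one [e^l] pays for the
    dilution [e^(-l)] and the other for the amplified noise. *)
Lemma crossing_far (l : R) : ~~ odd Q -> 0 <= l -> 4 * l + 52 <= Q%:R ->
  2 + eps Q + expR (Q%:R * lambda_ R Q * radius_far l) * eps Q <
    expR (- l) * (chebP Q (expR (lambda_ R Q * radius_far l)) + 1).
Proof.
move=> oQ l0 lQ; have Q1 := qmax_ge Lbig; have s1 := sqrtQ_ge Lbig.
have /andP[s21 s22] := sqrt2_bounds R.
have Q0 : (0 < Q)%N by rewrite -(ltr_nat R); lra.
have [h1 _] := eps_qmax; have eps0 : 0 < eps Q by exact: expR_gt0.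
have e1 := expR_ge1Dx (1 : R).
set z := (2 * l + 13) / Q%:R.
have z0 : 0 <= z by rewrite /z divr_ge0//; lra.
have z1 : 2 * z <= 1 by rewrite /z mulrA ler_pdivrMr; lra.
have lr : lambda_ R Q * radius_far l = z ^+ 2.
  rewrite /radius_far /z; have := lambdaM_sqrt R Q0; set lam := lambda_ R Q.
  have : Num.sqrt Q%:R ^+ 2 = Q%:R :> R by rewrite sqr_sqrtr//; lra.
  move: (Num.sqrt 2) (Num.sqrt Q%:R) s21 s1 => s2 sQ s21 s1 sE lamE.
  have sn : sQ != 0 by rewrite gt_eqF//; lra.
  have ln : lam != 0 by apply: contraPneq lamE => ->; rewrite mul0r => h; move: s21; rewrite -h; lra.
  by rewrite -sE -lamE; field; rewrite sn ln.
(* [(2l + 13)^2 = l * (4l + 52) + 169]: the hypothesis on [l] covers the first term, [169 <= Q] the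
   second. *)
have expo : Q%:R * lambda_ R Q * radius_far l <= l + 1.
  rewrite -mulrA lr /z expr_div_n mulrCA -[X in _ / X]/(_ * _) .
  have -> : (2 * l + 13) ^+ 2 * (Q%:R / (Q%:R * Q%:R)) = (2 * l + 13) ^+ 2 / Q%:R :> R.
    by field; rewrite gt_eqF//; lra.
  by rewrite ler_pdivrMr; [nra | lra].
have noise1 : expR (Q%:R * lambda_ R Q * radius_far l) * eps Q <= expR l.
  apply: (@le_trans _ _ (expR (l + 1) * eps Q)).
    by rewrite ler_wpM2r ?(ltW eps0)// ler_expR.
  by rewrite expRD -mulrA ler_piMr ?expR_ge0//; lra.
have el : 1 <= expR l by rewrite -[leLHS]expR0 ler_expR.
have P1 : 2^-1 * expR (2 * l + 13) <= chebP Q (expR (lambda_ R Q * radius_far l)).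
  rewrite lr; have ez := expR_ge1Dx (z ^+ 2).
  have := @chebP_ge_expr R Q (expR (z ^+ 2) - 1) Q0 oQ ltac:(nra).
  rewrite (addrC 1 (_ - 1)) subrK; apply: le_trans; rewrite ler_wpM2l//.
  have -> : expR (2 * l + 13) = expR z ^+ Q.
    rewrite -expRM_natl; congr expR; rewrite /z [RHS]mulrC divfK// gt_eqF//; lra.
  apply: lerXn2r; rewrite ?nnegrE ?expR_ge0 ?addr_ge0 ?mulr_ge0 ?sqrtr_ge0//.
  have := @expR_half_le R (2 * z) ltac:(apply/andP; split; lra).
  rewrite (_ : 2 * z / 2 = z); last by field.
  move=> h; apply: le_trans h _; rewrite lerD2l ler_wpM2l//.
  rewrite -[leLHS]ger0_norm// -sqrtr_sqr ler_wsqrtr//; lra.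
have E13 : 14 <= expR 13 :> R by apply: le_trans (expR_ge1Dx _); lra.
apply: (@lt_le_trans _ _ (expR (- l) * (2^-1 * expR (2 * l + 13)))); last first.
  by rewrite ler_wpM2l ?expR_ge0//; lra.
have -> : expR (- l) * (2^-1 * expR (2 * l + 13)) = 2^-1 * (expR l * expR 13).
  by rewrite mulrCA -!expRD; congr (_ * expR _); ring.
have : expR l * 14 <= expR l * expR 13 by rewrite ler_wpM2l// expR_ge0.
nra.
Qed.

End large_sample_bounds.

(** * Comparison with the rate *)

Section rate_bounds.
Context (R : realType) (n k : nat).
Local Notation a := (a_const R).
Local Notation L := (ln (n%:R : R)).
Local Notation Q := (qmax R n).
Local Notation eps := (eps_level R n).
Hypothesis Lbig : 346 * a <= L.
Hypothesis k1n : (1 <= k <= n - 1)%N.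

Definition log_dilution : R := ln (n%:R / (n%:R - k%:R)).
Local Notation l := log_dilution.
Local Notation N := (ln (1 + Num.sqrt (k%:R / (n%:R - k%:R : R)))).
Local Notation D := (ln (1 + (k%:R / Num.sqrt (n%:R : R)) `^ (2 / 3)) `^ (3 / 2)).

Lemma sample_bounds : [/\ 0 < n%:R :> R, 1 <= k%:R :> R, k%:R <= n%:R - 1 :> R,
  0 < n%:R - k%:R :> R & 0 < Num.sqrt n%:R :> R].
Proof.
have n0 : (0 < n)%N := n_gt0_of_Lbig Lbig.
have kn : k%:R <= n%:R - 1 :> R.
  by rewrite lerBrDr natr1 ler_nat; case/andP: k1n; lia.
split=> //; first by rewrite ltr0n.
- by rewrite ler1n; case/andP: k1n.
- by lra.
- by rewrite sqrtr_gt0 ltr0n.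
Qed.

Lemma sqr_sqrt_sample : Num.sqrt n%:R ^+ 2 = n%:R :> R.
Proof. by rewrite sqr_sqrtr. Qed.

Local Ltac sample_facts := have [n0' k0' kn' nk0' sn'] := sample_bounds.

Lemma expR_log_dilution : expR (- l) = 1 - k%:R / n%:R.
Proof.
sample_facts.
rewrite /l expRN lnK ?posrE ?divr_gt0//.
by rewrite invf_div mulrBl divff// gt_eqF.
Qed.

Lemma log_dilution_ge0 : 0 <= l.
Proof. by sample_facts; rewrite /l ln_ge0// ler_pdivlMr; lra. Qed.

(** [n / (n - k) = 1 + r^2 <= (1 + r)^2] for [r = sqrt (k / (n - k))]. *)
Lemma log_dilution_le : l <= 2 * N.
Proof.
sample_facts.
have s0 := sqrtr_ge0 (k%:R / (n%:R - k%:R) : R).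
have -> : 2 * N = ln ((1 + Num.sqrt (k%:R / (n%:R - k%:R : R))) ^+ 2).
  by rewrite lnXn ?mulr_natl//; lra.
have p1 : 0 < 1 + Num.sqrt (k%:R / (n%:R - k%:R)) :> R by lra.
rewrite ler_ln ?posrE ?divr_gt0 ?exprn_gt0//.
have -> : n%:R / (n%:R - k%:R) = 1 + k%:R / (n%:R - k%:R) :> R.
  by field; rewrite gt_eqF.
have : Num.sqrt (k%:R / (n%:R - k%:R)) ^+ 2 = k%:R / (n%:R - k%:R) :> R.
  by rewrite sqr_sqrtr// divr_ge0//; lra.
by nra.
Qed.

Lemma rate_num_ge0 : 0 <= N.
Proof. by sample_facts; rewrite ln_ge0// lerDl sqrtr_ge0. Qed.

Lemma rate_num_ge : k%:R / (4 * n%:R) <= N ^+ 2.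
Proof.
sample_facts.
set s := Num.sqrt (k%:R / n%:R) : R.
have s2 : s ^+ 2 = k%:R / n%:R by rewrite sqr_sqrtr// divr_ge0// ltW.
have s0 : 0 <= s by exact: sqrtr_ge0.
have s1 : s <= 1.
  have -> : 1 = Num.sqrt 1 :> R by rewrite sqrtr1.
  by rewrite ler_wsqrtr// ler_pdivrMr//; lra.
have h := @ln1D_ge_half R s ltac:(by rewrite s0).
have h2 : s / 2 <= N.
  have p1 : 0 < 1 + s by lra.
  have p2 : 0 < 1 + Num.sqrt (k%:R / (n%:R - k%:R)) :> R.
    by have := sqrtr_ge0 (k%:R / (n%:R - k%:R) : R); lra.
  apply: le_trans h _; rewrite ler_ln ?posrE//.
    rewrite lerD2l ler_wsqrtr// ler_pdivlMr; last lra.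
    rewrite mulrAC ler_pdivrMr//; have := k0'; nra.
have -> : k%:R / (4 * n%:R) = (s / 2) ^+ 2.
  by rewrite expr_div_n s2; field; rewrite gt_eqF.
by apply: lerXn2r; rewrite ?nnegrE ?divr_ge0// rate_num_ge0.
Qed.

Local Notation x := ((k%:R / Num.sqrt n%:R : R) `^ (2 / 3)).

Lemma sparsity_ratio_gt0 : 0 < x.
Proof. by sample_facts; rewrite powR_gt0// divr_gt0//; lra. Qed.

Lemma rate_den_gt0 : 0 < D.
Proof. by sample_facts; rewrite powR_gt0// ln_gt0// -/x; have := sparsity_ratio_gt0; lra. Qed.

Lemma rate_den_le_of_ln (y : R) : 0 <= y -> ln (1 + x) <= y -> D <= y * Num.sqrt y.
Proof.
sample_facts.
move=> y0 xy; rewrite -powR32//; apply: ge0_ler_powR => //.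
by rewrite nnegrE ln_ge0//; have := sparsity_ratio_gt0; lra.
Qed.

Lemma rate_den_le : D <= k%:R / Num.sqrt n%:R.
Proof.
sample_facts.
have kx : x `^ (3 / 2) = k%:R / Num.sqrt n%:R.
  rewrite /x -powRrM (_ : 2 / 3 * (3 / 2) = 1); last by field.
  by rewrite powRr1// divr_ge0// ltW.
rewrite -[leRHS]kx [leRHS]powR32 ?(ltW sparsity_ratio_gt0)//; apply: rate_den_le_of_ln; first exact: (ltW sparsity_ratio_gt0).
by apply: le_ln1Dx; have := sparsity_ratio_gt0; lra.
Qed.

Lemma rate_den_le_log (y : R) : 3 <= y -> k%:R <= Num.sqrt n%:R * expR y ->
  D <= y * Num.sqrt y.
Proof.
sample_facts.
move=> y1 ky; apply: rate_den_le_of_ln; first lra.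
have kx : x <= expR (2 / 3 * y).
  rewrite (mulrC (2 / 3)) expRM; apply: ge0_ler_powR; rewrite ?nnegrE ?expR_ge0//.
  by rewrite ler_pdivrMr// mulrC.
have p1 : 0 < 1 + x by have := sparsity_ratio_gt0; lra.
rewrite -[leRHS]expRK ler_ln ?posrE ?expR_gt0//.
apply: (@le_trans _ _ (1 + expR (2 / 3 * y))); first by rewrite lerD2l.
(* The claim becomes [1 + t^2 <= t^3], true for [t >= 2]; this is why [3 <= y] is assumed. *)
set t := expR (1 / 3 * y).
have t1 : 2 <= t by apply: le_trans (expR_ge1Dx _); lra.
have -> : expR (2 / 3 * y) = t ^+ 2 by rewrite -expRM_natl; congr expR; field.
have -> : expR y = t ^+ 3 by rewrite -expRM_natl; congr expR; field.
by have := sqr_ge0 t; nra.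
Qed.

(** The parametric floor, [k / (4n)] divided by [k / sqrt n]. Every remainder of order [1 / sqrt n]
    is absorbed through it. *)
Lemma rate_ge_inv_sqrt : 1 / (4 * Num.sqrt n%:R) <= rate R n k.
Proof.
sample_facts.
rewrite /rate ler_pdivlMr ?rate_den_gt0//; apply: le_trans rate_num_ge.
apply: (@le_trans _ _ (1 / (4 * Num.sqrt n%:R) * (k%:R / Num.sqrt n%:R))).
  by rewrite ler_wpM2l ?rate_den_le// divr_ge0// mulr_ge0// ltW.
by rewrite -{3}sqr_sqrt_sample; rewrite le_eqVlt; apply/orP; left; apply/eqP; field; rewrite gt_eqF.
Qed.

Lemma rate_gt0 : 0 < rate R n k.
Proof. by sample_facts; apply: lt_le_trans rate_ge_inv_sqrt; rewrite divr_gt0// mulr_gt0. Qed.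

Lemma rate_ge_num (y : R) : 3 <= y -> k%:R <= Num.sqrt n%:R * expR y ->
  N ^+ 2 / (y * Num.sqrt y) <= rate R n k.
Proof.
sample_facts.
move=> y3 ky; rewrite /rate ler_wpM2l ?sqr_ge0//.
rewrite lef_pV2 ?rate_den_le_log// posrE ?rate_den_gt0// mulr_gt0//; first lra.
by rewrite sqrtr_gt0; lra.
Qed.

Lemma rate_ge_num_log : N ^+ 2 / (L * Num.sqrt L) <= rate R n k.
Proof.
sample_facts.
have L1 := Lbig_ge Lbig.
apply: le_trans (@rate_ge_num (L / 2) _ _); [|lra|]; last first.
  by rewrite (sqrtn_expR Lbig) -expRD -splitr -(natr_expR Lbig); lra.
rewrite ler_wpM2l ?sqr_ge0// lef_pV2 ?posrE ?mulr_gt0 ?sqrtr_gt0//; [|lra..].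
apply: ler_pM; [lra|exact: sqrtr_ge0|lra|]; apply: ler_wsqrtr; lra.
Qed.

(** The factors are 2 and [10 * e^(2a)] from [2 * delta q], [e^(2a)] for the step from [q - 2] to
    [q], 4 from [rate_num_ge], and [a^(3/2)] from the denominator of the rate. *)
Definition rate_cst_near : R := 80 * expR (4 * a) * (a * Num.sqrt a).

(** By minimality of [q], either [k] exceeds [sqrt n * e^(a (q - 2))], so that
    [e^(aq) / sqrt n <= e^(2a) * k / n], or [q = 2] and the threshold is of order [1 / sqrt n]. *)
Lemma delta_le_rate (q : nat) : (1 < q)%N -> (q < Q)%N ->
  k%:R <= Num.sqrt n%:R * expR (a * q%:R) ->
  q = 2%N \/ Num.sqrt n%:R * expR (a * (q%:R - 2)) < k%:R ->
  2 * delta R n q <= rate_cst_near * rate R n k.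
Proof.
sample_facts.
move=> q1 qQ kq qmin; have a3 := a_const_ge3 R.
rewrite (delta_ltQ Lbig qQ) -(epsE Lbig).
have sa : 1 <= Num.sqrt a by rewrite -[leLHS]sqrtr1 ler_wsqrtr//; lra.
have aa : 1 <= a * Num.sqrt a by nra.
have q2 : 2 <= q%:R :> R by rewrite ler_nat.
have sq : 0 < Num.sqrt q%:R :> R by rewrite sqrtr_gt0; lra.
have E4 : 0 < expR (4 * a) by exact: expR_gt0.
have E42 : expR (4 * a) = expR (2 * a) * expR (2 * a) by rewrite -expRD; congr expR; ring.
case: qmin => [q2E|qmin].
  apply: (@le_trans _ _ (80 * expR (4 * a) * (1 / (4 * Num.sqrt n%:R)))); last first.
    have r0 := rate_gt0.
    apply: (@le_trans _ _ (80 * expR (4 * a) * rate R n k)).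
      by rewrite ler_wpM2l ?rate_ge_inv_sqrt// mulr_ge0// ltW.
    by rewrite /rate_cst_near ler_wpM2r ?(ltW r0)// ler_peMr.
  have s1 : 1 <= Num.sqrt q%:R :> R.
    by rewrite -[leLHS]sqrtr1 ler_wsqrtr//; lra.
  have -> : 80 * expR (4 * a) * (1 / (4 * Num.sqrt n%:R)) = 20 * expR (4 * a) / Num.sqrt n%:R.
    by field; rewrite gt_eqF.
  have -> : 2 * (10 * expR (2 * a) * (expR (a * q%:R) / Num.sqrt n%:R) / (q%:R * Num.sqrt q%:R)) =
     20 * expR (4 * a) / Num.sqrt n%:R / (q%:R * Num.sqrt q%:R).
    by rewrite E42 q2E (mulrC a); field; rewrite !gt_eqF// -?q2E.
  rewrite ler_pdivrMr ?mulr_gt0//; last by lra.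
  by rewrite ler_peMr; [| rewrite divr_ge0 ?mulr_ge0// ltW|nra].
have r := @rate_ge_num (a * q%:R) ltac:(nra) kq.
have e2 : expR (a * q%:R) = expR (2 * a) * expR (a * (q%:R - 2)).
  by rewrite -expRD; congr expR; ring.
have h1 : expR (a * q%:R) / Num.sqrt n%:R <= expR (2 * a) * (k%:R / n%:R).
  rewrite e2 -mulrA ler_wpM2l ?expR_ge0// -{2}sqr_sqrt_sample ler_pdivrMr//.
  apply: (@le_trans _ _ (k%:R / Num.sqrt n%:R)).
    by rewrite ler_pdivlMr// mulrC ltW.
  by rewrite le_eqVlt; apply/orP; left; apply/eqP; field; rewrite gt_eqF.
have r2 : k%:R / (4 * n%:R) / (a * Num.sqrt a * (q%:R * Num.sqrt q%:R)) <= rate R n k.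
  have sM : Num.sqrt (a * q%:R) = Num.sqrt a * Num.sqrt q%:R by apply: sqrtrM; lra.
  apply: le_trans r; rewrite sM.
  rewrite (mulrACA a) ler_wpM2r ?rate_num_ge// invr_ge0.
  by apply: mulr_ge0; apply: mulr_ge0; rewrite ?sqrtr_ge0//; lra.
have aa0 : 0 < a * Num.sqrt a by lra.
have qq0 : 0 < q%:R * Num.sqrt q%:R :> R by rewrite mulr_gt0//; lra.
apply: (@le_trans _ _ (rate_cst_near * (k%:R / (4 * n%:R) / (a * Num.sqrt a * (q%:R * Num.sqrt q%:R))))); last first.
  by rewrite ler_wpM2l// /rate_cst_near mulr_ge0 ?(ltW aa0)// mulr_ge0// ltW.
have -> : rate_cst_near * (k%:R / (4 * n%:R) / (a * Num.sqrt a * (q%:R * Num.sqrt q%:R))) =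
   20 * expR (2 * a) / (q%:R * Num.sqrt q%:R) * (expR (2 * a) * (k%:R / n%:R)).
  rewrite /rate_cst_near E42; field; rewrite !gt_eqF//; lra.
have -> : 2 * (10 * expR (2 * a) * (expR (a * q%:R) / Num.sqrt n%:R) / (q%:R * Num.sqrt q%:R)) =
   20 * expR (2 * a) / (q%:R * Num.sqrt q%:R) * (expR (a * q%:R) / Num.sqrt n%:R).
  by field; rewrite !gt_eqF//; lra.
by rewrite ler_wpM2l// divr_ge0 ?mulr_ge0 ?expR_ge0// ltW.
Qed.

(** [2 * expR (3 * a)] is the [g] with [1 <= g * N] in [far_le_rate]; the last factor converts
    [Q^(3/2)] into [(ln n)^(3/2)]. *)
Definition rate_cst_far : R :=
  (25 * (2 * expR (3 * a)) ^+ 2 + (4 + 13 * (2 * expR (3 * a))) ^+ 2) *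
  (4 * a * Num.sqrt (4 * a)).

Lemma powR32_qmax_ge : L * Num.sqrt L <= 4 * a * Num.sqrt (4 * a) * (Q%:R * Num.sqrt Q%:R).
Proof.
sample_facts.
have a3 := a_const_ge3 R; have QL := qmax_lb Lbig.
have L1 := Lbig_ge Lbig; have Q1 := qmax_ge Lbig.
have a4 : 0 <= 4 * a by lra.
have sM : Num.sqrt (4 * a * Q%:R) = Num.sqrt (4 * a) * Num.sqrt Q%:R by exact: sqrtrM.
rewrite mulrACA -sM; apply: ler_pM => //; [lra | exact: ler_wsqrtr].
Qed.

(** As [k / n] is bounded below, so is [N], and the constants 25 and 13 are absorbed into multiples
    of [N]. *)
Lemma far_le_rate : expR (- (6 * a)) <= k%:R / n%:R ->
  delta R n Q + radius_far n l <= rate_cst_far * rate R n k.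
Proof.
sample_facts.
move=> kfar; have Q1 := qmax_ge Lbig; have s1 := sqrtQ_ge Lbig.
have a3 := a_const_ge3 R; have L1 := Lbig_ge Lbig.
set g := 2 * expR (3 * a).
have g0 : 0 < g by rewrite mulr_gt0// expR_gt0.
have N0 := rate_num_ge0; have l0 := log_dilution_ge0; have lN := log_dilution_le.
have gN : 1 <= g * N.
  rewrite -(@ler_pXn2r _ 2)// ?nnegrE ?mulr_ge0 ?(ltW g0)// expr1n exprMn.
  have : expR (- (6 * a)) / 4 <= N ^+ 2.
    apply: le_trans rate_num_ge.
    have -> : k%:R / (4 * n%:R) = k%:R / n%:R / 4 :> R by field; rewrite gt_eqF.
    by rewrite ler_wpM2r.
  have : g ^+ 2 * (expR (- (6 * a)) / 4) = 1.
    have e3 : expR (3 * a) ^+ 2 = expR (6 * a).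
      by rewrite -expRM_natl; congr expR; ring.
    have : expR (6 * a) * expR (- (6 * a)) = 1 by rewrite -expRD addrN expR0.
    rewrite /g exprMn e3; move: (expR (6 * a)) (expR (- (6 * a))) => E E' e.
    by transitivity (E * E'); [field | exact: e].
  by move=> e h; have := ler_wpM2l (sqr_ge0 g) h; rewrite e.
have C0 : 0 <= 25 * g ^+ 2 + (4 + 13 * g) ^+ 2.
  by apply: addr_ge0; [apply: mulr_ge0 => //; exact: sqr_ge0 | exact: sqr_ge0].
have QQ : 0 < Q%:R * Num.sqrt Q%:R :> R by rewrite mulr_gt0//; lra.
have /andP[s21 s22] := sqrt2_bounds R.
apply: (@le_trans _ _ ((25 * g ^+ 2 + (4 + 13 * g) ^+ 2) * N ^+ 2 / (Q%:R * Num.sqrt Q%:R))).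
  rewrite delta_Q /radius_far (invfM (Num.sqrt 2)) mulrA -mulrDl.
  rewrite ler_wpM2r ?invr_ge0 ?(ltW QQ)// [leRHS]mulrDl; apply: lerD.
    have : 1 <= (g * N) ^+ 2 by rewrite -[leLHS](expr1n _ 2) lerXn2r ?nnegrE//; lra.
    by rewrite exprMn; lra.
  have h : (2 * l + 13) ^+ 2 <= ((4 + 13 * g) * N) ^+ 2.
    apply: lerXn2r; rewrite ?nnegrE; [lra| |nra].
    by rewrite mulr_ge0// addr_ge0// mulr_ge0// ltW.
  rewrite -exprMn; apply: le_trans h; rewrite ler_pdivrMr; last by move: s21; lra.
  by rewrite ler_peMr ?sqr_ge0//; lra.
apply: (@le_trans _ _ (rate_cst_far * (N ^+ 2 / (L * Num.sqrt L)))); last first.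
  rewrite ler_wpM2l ?rate_ge_num_log// /rate_cst_far -/g; apply: mulr_ge0 => //.
  by apply: mulr_ge0; [lra | exact: sqrtr_ge0].
have LL : 0 < L * Num.sqrt L by rewrite mulr_gt0 ?sqrtr_gt0//; lra.
have h := powR32_qmax_ge; have M0 := sqr_ge0 N.
rewrite /rate_cst_far -/g; move: (25 * _ + _) C0 => C C0.
move: (N ^+ 2) (4 * a * _) (Q%:R * _) (L * _) M0 h QQ LL => M A qq ll M0 h qq0 ll0.
rewrite -!mulrA; apply: ler_wpM2l => //; rewrite ler_pdivrMr//.
have -> : A * (M / ll) * qq = M * (A * qq / ll) by ring.
by rewrite ler_peMr// ler_pdivlMr// mul1r.
Qed.

Definition rate_cst_top : R := 10 * (64 * a) ^+ 2.

(** If [l] is at least of the order of [Q], so is [N]; hence [L <= 64 * a * N], and [N^2 / L^(3/2)]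
    is at least of order [sqrt L]. *)
Lemma top_le_rate : Q%:R < 4 * l + 52 ->
  6 * Num.sqrt (2 * L) <= rate_cst_top * rate R n k.
Proof.
sample_facts.
move=> lQ; have Q1 := qmax_ge Lbig; have a3 := a_const_ge3 R; have L1 := Lbig_ge Lbig.
have N0 := rate_num_ge0; have lN := log_dilution_le; have QL := qmax_lb Lbig.
have h1 : L <= 64 * a * N.
  apply: le_trans QL _; have : Q%:R <= 16 * N by lra.
  by have : 0 <= a by [lra]; nra.
have sL : 0 < Num.sqrt L by rewrite sqrtr_gt0; lra.
have sE : Num.sqrt L ^+ 2 = L by rewrite sqr_sqrtr//; lra.
apply: (@le_trans _ _ (rate_cst_top * (N ^+ 2 / (L * Num.sqrt L)))); last first.
  by rewrite ler_wpM2l ?rate_ge_num_log// /rate_cst_top mulr_ge0// sqr_ge0.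
rewrite mulrA ler_pdivlMr; last by rewrite mulr_gt0//; lra.
have -> : rate_cst_top * N ^+ 2 = 10 * (64 * a * N) ^+ 2 by rewrite /rate_cst_top; ring.
have /andP[s21 s22] := sqrt2_bounds R.
have -> : Num.sqrt (2 * L) = Num.sqrt 2 * Num.sqrt L by rewrite sqrtrM.
have -> : 6 * (Num.sqrt 2 * Num.sqrt L) * (L * Num.sqrt L) = 6 * Num.sqrt 2 * L ^+ 2.
  by transitivity (6 * Num.sqrt 2 * L * Num.sqrt L ^+ 2); [ring | rewrite sE; ring].
have : L ^+ 2 <= (64 * a * N) ^+ 2 by apply: lerXn2r; rewrite ?nnegrE; lra.
by have := sqr_ge0 L; nra.
Qed.

(** The [2 * sqrt n] inside the maximum keeps the logarithmic factor at least [ln 2]. *)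
Lemma tail_bound_ge (y : R) :
  Num.max k%:R (Num.sqrt n%:R) <= Num.sqrt n%:R * expR y ->
  ln 2 ^+ 3 * expR (- (4 / 3 * y)) <= tail_bound R n k.
Proof.
sample_facts.
move=> my; rewrite /tail_bound mulrC.
have m0 : 0 < Num.max k%:R (Num.sqrt n%:R) :> R by rewrite lt_max sn' orbT.
have l2 : 0 <= ln 2 :> R by rewrite ln_ge0//; lra.
have m2 : 0 < Num.max k%:R (2 * Num.sqrt n%:R) :> R by rewrite lt_max mulr_gt0 ?orbT.
apply: ler_pM; [exact: expR_ge0 | by rewrite exprn_ge0 | |].
  have -> : - (4 / 3 * y) = - y * (4 / 3) by ring.
  rewrite expRM; apply: ge0_ler_powR; rewrite ?nnegrE ?expR_ge0//.
  rewrite ler_pdivlMr// mulrC expRN ler_pdivrMr ?expR_gt0//.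
have ln2 : ln 2 <= ln (Num.max k%:R (2 * Num.sqrt n%:R) / Num.sqrt n%:R) :> R.
  rewrite ler_ln ?posrE ?divr_gt0//.
  by rewrite ler_pdivlMr// le_max lexx orbT.
by apply: lerXn2r; rewrite ?nnegrE//; apply: le_trans ln2.
Qed.

End rate_bounds.

(** * Measurability of the adaptive estimator *)

Lemma measurable_fun_lt_cst (R : realType) (d : measure_display)
    (T : measurableType d) (f : T -> R) :
  (forall t : R, measurable [set w | f w < t]) -> measurable_fun [set: T] f.
Proof.
move=> h; apply: (measurability _ (RGenInftyO.measurableE R)).
move=> _ [_ [t ->] <-]; rewrite setTI.
by rewrite (_ : _ @^-1` _ = [set w | f w < t]) ?h//; apply/seteqP; split => w /=; rewrite in_itv.
Qed.

Lemma measurable_set_bool (d : measure_display) (T : measurableType d) (b : T -> bool) :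
  measurable_fun [set: T] b -> measurable [set w | b w].
Proof. by move=> mb; rewrite -[X in measurable X]setTI; exact: mb. Qed.

Section measurable_estimator.
Context (R : realType) (n : nat) (d : measure_display) (T : measurableType d).
Variable Y : T -> 'I_n -> R.
Hypothesis n0 : (0 < n)%N.
Hypothesis mY : forall i, measurable_fun [set: T] (fun w => Y w i).

Lemma measurable_order_stat (j : nat) : (0 < j <= n)%N ->
  measurable_fun [set: T] (fun w => order_stat (Y w) j).
Proof.
move=> j0n; apply: measurable_fun_lt_cst => t.
have mle (s : R) : measurable [set w | order_stat (Y w) j <= s].
  have -> : [set w | order_stat (Y w) j <= s] =
      [set w | j%:R <= \sum_(i < n) ((Y w i <= s)%R : nat)%:R :> R].
    apply/seteqP; split => w /=; rewrite order_stat_le// -natr_sum ler_nat -sum1_card.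
      by rewrite big_mkcond/= => /leq_trans; apply; apply: leq_sum => i _; rewrite inE; case: ifP.
    move=> /leq_trans; apply; rewrite [leqRHS]big_mkcond/=.
    by apply: leq_sum => i _; rewrite inE; case: ifP.
  apply: measurable_set_bool; apply: measurable_fun_ler => //.
  apply: measurable_sum => i.
  rewrite (_ : (fun w => _) = (fun w => if Y w i <= s then 1 else 0)); last first.
    by apply/funext => w; case: ifP.
  by apply: measurable_fun_ifT => //; exact: measurable_fun_ler.
have -> : [set w | order_stat (Y w) j < t] =
    \bigcup_(m in [set: nat]) [set w | order_stat (Y w) j <= t - m.+1%:R^-1].
  apply/seteqP; split => [w /= wt|w [m _] /=].
    have [m] := ltr_add_invr wt.
    by move=> h; exists m => //=; rewrite lerBrDr ltW.
  by move/le_lt_trans; apply; rewrite ltrBlDr ltrDl invr_gt0.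
by apply: bigcup_measurable => m _.
Qed.

Lemma measurable_psi_hat (q : nat) (lam : R) (u : T -> R) :
  measurable_fun [set: T] u ->
  measurable_fun [set: T] (fun w => psi_hat (Y w) q lam (u w)).
Proof.
move=> mu; apply: measurable_sum => j; apply: measurable_funM => //.
apply: measurable_funM => //; apply: measurable_sum => i.
apply: measurableT_comp => //; apply: measurable_funB => //.
by apply: measurable_funM => //; exact: measurable_funB.
Qed.

End measurable_estimator.

Lemma continuous_psi_hat (R : realType) (n : nat) (y : 'I_n -> R) (q : nat) (lam : R) :
  continuous (psi_hat y q lam).
Proof.
move=> u; apply: cvg_big => [|j _]; first exact: add_continuous.
apply: cvgM; first exact: cvg_cst.
apply: cvgM; first exact: cvg_cst.
apply: cvg_big => [|i _]; first exact: add_continuous.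
apply: (@continuous_comp _ _ _ (fun v => _) expR); last exact: continuous_expR.
apply: cvgB; last exact: cvg_cst.
apply: cvgM; first exact: cvg_cst.
by apply: cvgB; [exact: cvg_id | exact: cvg_cst].
Qed.

Lemma crossing_set_lbound (R : realType) (n : nat) (y : 'I_n -> R) (q : nat) :
  (0 < n)%N -> (0 < q)%N -> has_lbound (crossing_set y q).
Proof.
move=> n0 q0; set thr := expR (a_const R * q%:R) / Num.sqrt n%:R.
have nR : 0 < n%:R :> R by rewrite ltr0n.
have thr0 : 0 < thr by rewrite divr_gt0 ?expR_gt0// sqrtr_gt0.
have l0 : 0 < lambda_ R q by rewrite sqrtr_gt0 divr_gt0// ltr0n.
set lam := lambda_ R q in l0 *.
pose K := \sum_(j < q) `|cheb_coef R j.+1 q| * eta_hat y (j.+1%:R * lam) 0.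
have eta0 (l : R) : 0 <= eta_hat y l 0.
  by rewrite mulr_ge0 ?invr_ge0 ?(ltW nR)//; apply: sumr_ge0 => i _; exact: expR_ge0.
have K0 : 0 <= K by apply: sumr_ge0 => j _; rewrite mulr_ge0.
have etaE (l u : R) : eta_hat y l u = expR (l * u) * eta_hat y l 0.
  rewrite /eta_hat mulrCA; congr (_ * _); rewrite mulr_sumr; apply: eq_bigr => i _.
  by rewrite -expRD; congr expR; ring.
(* Left of this point the non-constant part of [psi_hat] is at most [e^(lam * u) * K <= K / (1 + K /
   thr) <= thr], by [1 + t <= e^t]. *)
exists (- (K / thr) / lam) => u [_ _]; rewrite -/thr -/lam ltNge => h.
rewrite leNgt; apply/negP => uK; move: h => /negP; apply.
have lu : lam * u <= - (K / thr) by move: uK; rewrite ltr_pdivlMr// mulrC => /ltW.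
have Kt : 0 <= K / thr by rewrite divr_ge0// ltW.
rewrite /psi_hat big_ord_recl/= cheb_coef0// mul1r; apply: lerD.
  rewrite mul0r /eta_hat; under eq_bigr do rewrite mul0r expr0n/= mul0r subrr expR0.
  by rewrite sumr_const card_ord mulVf// gt_eqF.
apply: (@le_trans _ _ (expR (lam * u) * K)).
  rewrite /K mulr_sumr; apply: ler_sum => j _; rewrite etaE.
  apply: le_trans (ler_norm _) _; rewrite normrM (ger0_norm (mulr_ge0 (expR_ge0 _) (eta0 _))).
  rewrite /bump/= add1n mulrCA; apply: ler_wpM2r; first exact: mulr_ge0.
  rewrite ler_expR -mulrA ler_neMl ?ler1n//.
  by apply: le_trans lu _; rewrite oppr_le0.
have e1 : expR (lam * u) <= (1 + K / thr)^-1.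
  apply: (@le_trans _ _ (expR (- (K / thr)))); first by rewrite ler_expR.
  by rewrite expRN lef_pV2 ?posrE ?expR_gt0 ?expR_ge1Dx// ltr_wpDr.
apply: (@le_trans _ _ ((1 + K / thr)^-1 * K)); first by rewrite ler_wpM2r.
by rewrite ler_pdivrMl ?ltr_wpDr// mulrDl mul1r divfK ?gt_eqF// lerDr ltW.
Qed.

Section measurable_selection.
Context (R : realType) (n : nat) (d : measure_display) (T : measurableType d).
Variable Y : T -> 'I_n -> R.
Hypothesis n0 : (0 < n)%N.
Hypothesis mY : forall i, measurable_fun [set: T] (fun w => Y w i).

Lemma measurable_theta_med : measurable_fun [set: T] (fun w => theta_med (Y w)).
Proof. by apply: measurable_order_stat => //; case: n n0 => // m _; rewrite uphalfE /=; lia. Qed.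

Lemma measurable_theta_up : measurable_fun [set: T] (fun w => theta_up (Y w)).
Proof. by apply: measurable_funD => //; apply: measurable_order_stat. Qed.

Lemma measurable_theta_low (q : nat) :
  measurable_fun [set: T] (fun w => theta_low (Y w) q).
Proof.
rewrite /theta_low; case: (q%:R <= 3 / (10 * a_const R) * ln n%:R) => //.
by apply/measurable_EFinP; apply: measurable_funB => //; exact: measurable_theta_med.
Qed.

Lemma measurable_crossing_at (q : nat) (u : T -> R) : measurable_fun [set: T] u ->
  measurable [set w | crossing_set (Y w) q (u w)].
Proof.
move=> mu.
have -> : [set w | crossing_set (Y w) q (u w)] =
    [set w | (theta_low (Y w) q <= (u w)%:E)%E] `&`
    ([set w | u w <= theta_up (Y w)] `&`
     [set w | 1 + expR (a_const R * q%:R) / Num.sqrt n%:R <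
              psi_hat (Y w) q (lambda_ R q) (u w)]).
  by apply/seteqP; split => w /= => [[h1 h2 h3]|[h1 [h2 h3]]].
apply: measurableI; last apply: measurableI.
- apply: (@measurable_set_bool _ _ (fun w => (theta_low (Y w) q <= (u w)%:E)%E)).
  apply: measurable_fun_lee; first exact: measurable_theta_low.
  exact/measurable_EFinP.
- apply: (@measurable_set_bool _ _ (fun w => u w <= theta_up (Y w))).
  by apply: measurable_fun_ler => //; exact: measurable_theta_up.
- apply: measurable_set_bool; apply: measurable_fun_ltr => //.
  exact: measurable_psi_hat.
Qed.

(* The threshold exceedance is open in [u], so it is enough to look at rational
   points and at the left endpoint of the search interval. *)
Lemma measurable_crossing_below (q : nat) (t : R) :
  measurable [set w | exists2 u, crossing_set (Y w) q u & u < t].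
Proof.
pose low w := fine (theta_low (Y w) q).
have mlow : measurable_fun [set: T] low.
  by apply: measurableT_comp => //; exact: measurable_theta_low.
have -> : [set w | exists2 u, crossing_set (Y w) q u & u < t] =
    ([set w | crossing_set (Y w) q (low w)] `&` [set w | low w < t]) `|`
    \bigcup_(r in [set r : rat | ratr r < t]) [set w | crossing_set (Y w) q (ratr r)].
  apply/seteqP; split => w /=; last first.
    by move=> [[h1 h2]|[r /= h1 h2]]; [exists (low w)|exists (ratr r)].
  move=> [u cu ut]; have [lowE|lowu] := eqVneq ((low w)%:E) u%:E.
    by left; case: lowE => ->.
  have lu : (theta_low (Y w) q < u%:E)%E.
    case: cu => h _ _; rewrite lt_neqAle h andbT; apply: contraNneq lowu => e.
    by rewrite /low e.
  right; case: cu => _ uup psiu.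
  have [e /= e0 he] : \forall v \near u, 1 + expR (a_const R * q%:R) / Num.sqrt n%:R <
      psi_hat (Y w) q (lambda_ R q) v.
    exact: (cvgr_gt _ (@continuous_psi_hat _ _ (Y w) q (lambda_ R q) u)).
  (* A rational point is sought between [u] and the larger of [u - e] and the left endpoint. *)
  have [b [be ub lb]] : exists b, [/\ u - e <= b, b < u & (theta_low (Y w) q <= b%:E)%E].
    move: lu; case: (theta_low _ _) => [l|/=|_]; last 2 first.
    - by rewrite ltNge leey.
    - by exists (u - e); rewrite lexx ltrBlDr ltrDl e0 leNye.
    rewrite lte_fin => lu.
    exists (Num.max l (u - e)); rewrite le_max lexx orbT gt_max lu ltrBlDr ltrDl e0.
    by rewrite lee_fin le_max lexx.
  have [r] := rat_in_itvoo ub; rewrite in_itv/= => /andP[br ru].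
  exists r => /=; first exact: lt_trans ut.
  split; [by apply: le_trans lb _; rewrite lee_fin ltW | by apply: le_trans uup; exact: ltW |].
  by apply: he; rewrite /ball/= ger0_norm ?subr_ge0 ?(ltW ru)// ltrBlDr -ltrBlDl; exact: le_lt_trans br.
apply: measurableU.
  apply: measurableI; first exact: measurable_crossing_at.
  by apply: measurable_set_bool; exact: measurable_fun_ltr.
rewrite bigcup_mkcond; apply: bigcupT_measurable_rat => r; case: ifP => // _.
exact: (@measurable_crossing_at q (cst (ratr r))).
Qed.

Lemma measurable_theta_hat (q : nat) :
  measurable_fun [set: T] (fun w => theta_hat (Y w) q).
Proof.
rewrite /theta_hat; have [_|q0] := posnP q; first exact: measurable_theta_med.
case: (q == qmax R n + 2)%N.
  by apply: measurable_funD => //; exact: measurable_order_stat.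
apply: measurable_fun_lt_cst => t.
(* Emptiness of the crossing set is expressed by countably many measurable conditions: no crossing
   below any natural number. *)
have -> : [set w | (if `[< crossing_set (Y w) q !=set0 >] then inf (crossing_set (Y w) q)
     else theta_up (Y w)) < t] =
   [set w | exists2 u, crossing_set (Y w) q u & u < t] `|`
   ((\bigcap_(m in [set: nat]) ~` [set w | exists2 u, crossing_set (Y w) q u & u < m%:R]) `&`
    [set w | theta_up (Y w) < t]).
  apply/seteqP; split => w /=.
    case: asboolP => [ne|empty] h.
      by left; have [u cu ut] := inf_lt ne h; exists u.
    right; split => // m _ [u cu _]; apply: empty; by exists u.
  case: asboolP => [ne|empty] [[u cu ut]|[h1 h2]] //.
  - by apply: le_lt_trans ut; apply: ge_inf => //; exact: crossing_set_lbound.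
  - exfalso; have [u cu] := ne.
    apply: (h1 (Num.truncn u).+1) => //; exists u => //.
    exact: truncnS_gt.
  - by exfalso; apply: empty; exists u.
apply: measurableU; first exact: measurable_crossing_below.
apply: measurableI; last first.
  by apply: measurable_set_bool; apply: measurable_fun_ltr => //; exact: measurable_theta_up.
by apply: bigcap_measurableType => m _; apply: measurableC; exact: measurable_crossing_below.
Qed.

Lemma measurable_admissible (q : nat) : measurable_fun [set: T] (fun w => admissible (Y w) q).
Proof.
rewrite /admissible; elim: (index_range R n) => [|a s ih] //=.
apply: measurable_and => //; case: (q < a)%N => //=.
apply: measurable_fun_ler => //; apply: measurableT_comp => //.
by apply: measurable_funB; exact: measurable_theta_hat.
Qed.

Lemma measurable_theta_ad : measurable_fun [set: T] (fun w => theta_ad (Y w)).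
Proof.
have le_qhat (m : nat) : measurable [set w | (q_hat (Y w) <= m)%N].
  rewrite /q_hat; apply: measurable_set_bool.
  elim: (index_range R n) => [|a s ih].
    rewrite [X in measurable_fun _ X](_ : _ = cst (qmax R n + 2 <= m)%N)//.
    by apply/funext => w; rewrite big_nil.
  rewrite [X in measurable_fun _ X](_ : _ = (fun w => (admissible (Y w) a && (a <= m)%N) ||
     (\big[minn/(qmax R n + 2)%N]_(q <- s | admissible (Y w) q) q <= m)%N)); last first.
    by apply/funext => w; rewrite big_cons; case: ifP => //=; rewrite geq_min.
  apply: measurable_or => //; apply: measurable_and => //; exact: measurable_admissible.
have eq_qhat (m : nat) : measurable [set w | q_hat (Y w) = m].
  have -> : [set w | q_hat (Y w) = m] = [set w | (q_hat (Y w) <= m)%N] `\`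
      (if m is p.+1 then [set w | (q_hat (Y w) <= p)%N] else set0).
    case: m => [|m]; apply/seteqP; split => w /=.
    - by move=> ->; split => //.
    - by move=> [+ _]; rewrite leqn0 => /eqP.
    - by move=> ->; rewrite ltnn.
    - by move=> [h1 /negP]; rewrite -ltnNge => h2; apply/eqP; rewrite eqn_leq h1.
  by apply: measurableD => //; case: m.
move=> _ B mB; rewrite setTI.
have -> : (fun w => theta_ad (Y w)) @^-1` B =
    \bigcup_(m in [set: nat]) ([set w | q_hat (Y w) = m] `&`
      (fun w => theta_hat (Y w) m) @^-1` B).
  apply/seteqP; split => w /=; first by move=> h; exists (q_hat (Y w)).
  by move=> [m _ [/= <-]].
apply: bigcup_measurable => m _; apply: measurableI => //.
by rewrite -[X in measurable X]setTI; exact: measurable_theta_hat.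
Qed.

End measurable_selection.

(** * Deviation variables *)

(** Weighted Cauchy-Schwarz, from the nonnegativity of the sum of [alpha j * (A * z j - m) ^+ 2];
    when [A = 0] all weights vanish. *)
Lemma sqr_sum_le_weighted (R : realFieldType) (I : finType) (alpha z : I -> R) :
  (forall j, 0 <= alpha j) ->
  (\sum_j alpha j * z j) ^+ 2 <= (\sum_j alpha j) * (\sum_j alpha j * z j ^+ 2).
Proof.
move=> a0; set A := \sum_j alpha j; set m := \sum_j alpha j * z j.
set S := \sum_j _; have A0 : 0 <= A by exact: sumr_ge0.
have : 0 <= \sum_j alpha j * (A * z j - m) ^+ 2.
  by apply: sumr_ge0 => j _; rewrite mulr_ge0 ?sqr_ge0.
have -> : \sum_j alpha j * (A * z j - m) ^+ 2 = A * (A * S - m ^+ 2).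
  transitivity (A ^+ 2 * S - 2 * A * m * m + m ^+ 2 * A); last by ring.
  have -> : A ^+ 2 * S = \sum_j A ^+ 2 * (alpha j * z j ^+ 2) by rewrite -mulr_sumr.
  have -> : 2 * A * m * m = \sum_j 2 * A * m * (alpha j * z j) by rewrite -mulr_sumr.
  have -> : m ^+ 2 * A = \sum_j m ^+ 2 * alpha j by rewrite -mulr_sumr.
  by rewrite -sumrB -big_split/=; apply: eq_bigr => j _; ring.
move: A0; rewrite le_eqVlt => /predU1P[A0|A0]; last first.
  by rewrite pmulr_rge0// subr_ge0.
move=> _; rewrite -A0 mul0r /m big1 ?expr0n// => j _.
have : alpha j <= 0 by rewrite A0 /A (bigD1 j)//= lerDl sumr_ge0.
by move=> aj; have -> : alpha j = 0; [apply/eqP; rewrite eq_le aj a0 | rewrite mul0r].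
Qed.

(* By Cauchy-Schwarz [zeta] dominates [noise ^ 2 * n * e^(-2aq)], and unlike the
   noise it is a quadratic form whose mean is explicit. *)
Definition zeta (R : realType) (n : nat) (mu x : 'I_n -> R) (q : nat) : R :=
  (\sum_(j < q.+1) `|cheb_coef R j q|) *
  (\sum_(j < q.+1) `|cheb_coef R j q| * eta_dev mu x (j%:R * lambda_ R q) ^+ 2) *
  (n%:R * expR (- (2 * (a_const R * q%:R)))).

Lemma zeta_ge0 (R : realType) (n : nat) (mu x : 'I_n -> R) (q : nat) :
  0 <= zeta mu x q.
Proof.
apply: mulr_ge0; last by apply: mulr_ge0 => //; exact: expR_ge0.
by apply: mulr_ge0; apply: sumr_ge0 => j _ //; apply: mulr_ge0 => //; exact: sqr_ge0.
Qed.

Lemma noise_le (R : realType) (n : nat) (mu x : 'I_n -> R) (q : nat) :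
  (0 < n)%N -> zeta mu x q < 1 ->
  noise mu x q <= expR (a_const R * q%:R) / Num.sqrt n%:R.
Proof.
move=> n0 z1; have nR : 0 < n%:R :> R by rewrite ltr0n.
have sn : 0 < Num.sqrt n%:R :> R by rewrite sqrtr_gt0.
rewrite -(@ler_pXn2r _ 2)// ?nnegrE; last 2 first.
- by apply: sumr_ge0 => j _; rewrite mulr_ge0.
- by rewrite divr_ge0 ?expR_ge0// ltW.
rewrite expr_div_n sqr_sqrtr ?(ltW nR)//.
apply: le_trans (sqr_sum_le_weighted _ _) _ => [j//|].
under [in X in _ * X]eq_bigr do rewrite real_normK ?num_real//.
move: z1; rewrite /zeta; move: (_ * (\sum_(i < _) _)) => B.
rewrite -expRM_natl expRN (mulrA B) ltr_pdivrMr ?expR_gt0// mul1r => h.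
by rewrite ler_pdivlMr// ltW.
Qed.

(* The index [i0] is an uncontaminated observation: it bounds the minimum from
   above, and a union bound over all observations bounds it from below. *)
Definition zeta_ext (R : realType) (n : nat) (x : 'I_n -> R) (i0 : 'I_n) : R :=
  expR (Num.sqrt (2 * ln n%:R) * x i0 - 2 * ln n%:R) +
  \sum_i expR (- (2 * Num.sqrt (ln n%:R)) * x i - 4 * ln n%:R).

Lemma zeta_ext_ge0 (R : realType) (n : nat) (x : 'I_n -> R) (i0 : 'I_n) :
  0 <= zeta_ext x i0.
Proof. by rewrite addr_ge0 ?expR_ge0//; apply: sumr_ge0 => i _; exact: expR_ge0. Qed.

(** Both parts follow from [1 + t <= e^t]. The first holds on every sample and is linear in
    [zeta_ext], which keeps the error integrable on the exceptional event [1 <= zeta_ext]. *)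
Lemma zeta_ext_bound (R : realType) (n : nat) (x : 'I_n -> R) (i0 : 'I_n) :
  1 <= ln (n%:R : R) ->
  (x i0 <= Num.sqrt (2 * ln n%:R) + zeta_ext x i0 /\
   forall i, - (2 * Num.sqrt (ln n%:R) + zeta_ext x i0) <= x i) /\
  (zeta_ext x i0 < 1 -> x i0 <= Num.sqrt (2 * ln n%:R) /\
   forall i, - (2 * Num.sqrt (ln n%:R)) <= x i).
Proof.
move=> L1; have z0 := zeta_ext_ge0 x i0.
have s1 : 1 <= Num.sqrt (2 * ln n%:R) :> R by rewrite -[leLHS]sqrtr1 ler_wsqrtr//; lra.
have s2 : 1 <= Num.sqrt (ln n%:R) :> R by rewrite -[leLHS]sqrtr1 ler_wsqrtr.
have sE1 : Num.sqrt (2 * ln n%:R) ^+ 2 = 2 * ln n%:R :> R by rewrite sqr_sqrtr//; lra.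
have sE2 : Num.sqrt (ln n%:R) ^+ 2 = ln n%:R :> R by rewrite sqr_sqrtr//; lra.
have t1 : expR (Num.sqrt (2 * ln n%:R) * x i0 - 2 * ln n%:R) <= zeta_ext x i0.
  by rewrite lerDl; apply: sumr_ge0 => i _; exact: expR_ge0.
have t2 i : expR (- (2 * Num.sqrt (ln n%:R)) * x i - 4 * ln n%:R) <= zeta_ext x i0.
  rewrite /zeta_ext (bigD1 i)//= addrCA lerDl addr_ge0 ?expR_ge0//.
  by apply: sumr_ge0 => j _; exact: expR_ge0.
move: t1 t2 sE1 sE2; set s := Num.sqrt (2 * _) in s1 *; set r := Num.sqrt (ln _) in s2 *.
move=> t1 t2 sE1 sE2.
have e1 := expR_ge1Dx (s * x i0 - 2 * ln n%:R).
have e2 i := expR_ge1Dx (- (2 * r) * x i - 4 * ln n%:R).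
split; [split => [|i] | move=> z1; split => [|i]].
- rewrite leNgt; apply/negP => h.
  have : s * (zeta_ext x i0) < s * (x i0 - s) by rewrite ltr_pM2l; lra.
  have : zeta_ext x i0 <= s * zeta_ext x i0 by rewrite ler_peMl.
  have : s * (x i0 - s) = s * x i0 - 2 * ln n%:R by rewrite -sE1; ring.
  lra.
- rewrite leNgt; apply/negP => h.
  have : (2 * r) * (zeta_ext x i0) < (2 * r) * (- x i - 2 * r) by rewrite ltr_pM2l; lra.
  have : zeta_ext x i0 <= (2 * r) * zeta_ext x i0 by rewrite ler_peMl//; lra.
  have : (2 * r) * (- x i - 2 * r) = - (2 * r) * x i - 4 * ln n%:R by rewrite -sE2; ring.
  have := e2 i; have := t2 i; lra.
- rewrite leNgt; apply/negP => h.
  have : s * 0 < s * (x i0 - s) by rewrite ltr_pM2l; lra.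
  have : s * (x i0 - s) = s * x i0 - 2 * ln n%:R by rewrite -sE1; ring.
  lra.
- rewrite leNgt; apply/negP => h.
  have : (2 * r) * 0 < (2 * r) * (- x i - 2 * r) by rewrite ltr_pM2l; lra.
  have : (2 * r) * (- x i - 2 * r) = - (2 * r) * x i - 4 * ln n%:R by rewrite -sE2; ring.
  have := e2 i; have := t2 i; lra.
Qed.

(** Chebyshev's inequality as a variable: the deviation of the number of clean noise terms up to
    [v], in units of [n * c * v / 2] with [c] the density bound, squared. *)
Definition zeta_med (R : realType) (n : nat) (mu x : 'I_n -> R) (v : R) : R :=
  (\sum_i (mu i == 0)%:R *
     ((x i <= v)%R%:R - fine (normal_prob (0 : R) 1 `]-oo, v]%classic))) ^+ 2 *
  (4 / (n%:R * normal_density_lb R * v) ^+ 2).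

Lemma zeta_med_ge0 (R : realType) (n : nat) (mu x : 'I_n -> R) (v : R) :
  0 <= zeta_med mu x v.
Proof. by rewrite mulr_ge0 ?sqr_ge0// divr_ge0 ?sqr_ge0. Qed.

Lemma normal_prob_le_fin (R : realType) (v : R) :
  normal_prob (0 : R) 1 `]-oo, v]%classic =
  (fine (normal_prob (0 : R) 1 `]-oo, v]%classic))%:E.
Proof. by rewrite fineK//; apply: fin_num_measure; exact: measurable_itv. Qed.

(** It suffices that more than half of the sample consists of clean observations with noise at most
    [v]. Their expected number is at least [n / 2 + n c v - k], which leaves a margin of [n c v / 2]
    when [2k <= n c v]. *)
Lemma theta_med_le (R : realType) (n k : nat) (theta v : R) (mu x : 'I_n -> R) :
  (0 < n)%N -> sparse_nonneg k mu -> 0 < v <= 1 ->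
  2 * k%:R <= n%:R * normal_density_lb R * v -> zeta_med mu x v < 1 ->
  theta_med (fun i => theta + mu i + x i) <= theta + v.
Proof.
move=> n0 [mu0 muk] /andP[v0 v1] kn; rewrite leNgt => z1; apply/negP.
rewrite ltNge => /negP; apply; move: z1.
have c0 := normal_density_lb_gt0 R; have nR : 0 < n%:R :> R by rewrite ltr0n.
set p := fine (normal_prob (0 : R) 1 `]-oo, v]%classic).
have pl : 2^-1 + normal_density_lb R * v <= p.
  by rewrite -lee_fin -normal_prob_le_fin normal_prob_le_lb// (ltW v0).
have p1 : p <= 1.
  by rewrite -lee_fin -normal_prob_le_fin; exact: probability_le1.
have cv0 : 0 < n%:R * normal_density_lb R * v by rewrite mulr_gt0// mulr_gt0//.
rewrite /zeta_med -/p mulrA ltr_pdivrMr ?exprn_gt0// mul1r => z1.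
rewrite order_stat_le; last by rewrite uphalfE; lia.
rewrite leqNgt; apply/negP => few; move: z1; rewrite ltNge => /negP; apply.
set S := \sum_i _; set m := #|_| in few.
have Sle : S <= m%:R - (n%:R - k%:R) * p.
  have a1 : n%:R - k%:R <= \sum_i (mu i == 0)%:R :> R.
    rewrite lerBlDr -natr_sum -natrD ler_nat.
    rewrite -[leqLHS]card_ord -(cardC [pred i | mu i == 0]) leq_add//.
    by rewrite -sum1_card big_mkcond; apply: leq_sum => i _; rewrite inE; case: ifP.
  have a2 : \sum_i (mu i == 0)%:R * (x i <= v)%R%:R <= m%:R :> R.
    rewrite /m -sum1_card natr_sum [leRHS]big_mkcond/=; apply: ler_sum => i _.
    rewrite inE; case: eqP => [->|_]; last by rewrite mul0r; case: ifP.
    by rewrite mul1r addr0 lerD2l; case: (x i <= v).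
  rewrite /S; under eq_bigr do rewrite mulrBr.
  rewrite sumrB -mulr_suml; apply: lerB => //; rewrite ler_wpM2r//.
  by rewrite (le_trans _ pl)// addr_ge0// mulr_ge0// ltW.
(* [uphalf] rounds up, so a count below [uphalf n] is at most [(n - 1) / 2]. *)
have mle : m%:R <= n%:R / 2 - 2^-1 :> R.
  have : (2 * m + 1 <= n)%N by move: few; rewrite uphalfE; lia.
  by rewrite -(ler_nat R) natrD natrM; lra.
have k0 : 0 <= k%:R :> R by exact: ler0n.
have npk : n%:R * (2^-1 + normal_density_lb R * v) - k%:R <= (n%:R - k%:R) * p.
  have : n%:R * (2^-1 + normal_density_lb R * v) <= n%:R * p by rewrite ler_wpM2l// ltW.
  have : k%:R * p <= k%:R * 1 by rewrite ler_wpM2l.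
  lra.
have : n%:R * normal_density_lb R * v <= - (2 * S).
  move: npk; rewrite mulrDr mulrA; lra.
move=> h; have -> : S ^+ 2 * 4 = (- (2 * S)) ^+ 2 by ring.
by apply: lerXn2r; rewrite ?nnegrE ?(ltW cv0)//; apply: le_trans h; exact: ltW.
Qed.

Section expectations.
Context (R : realType) (n : nat) (d : measure_display) (T : measurableType d).
Variables (P : probability T R) (xi : 'I_n -> {RV P >-> R}).
Hypothesis iid : iid_std_normal xi.
Hypothesis n0 : (0 < n)%N.
Let x (w : T) (i : 'I_n) : R := xi i w.

Let mx (i : 'I_n) : measurable_fun [set: T] (fun w => x w i).
Proof. exact: measurable_funPT. Qed.

Let nR : 0 < n%:R :> R.
Proof. by rewrite ltr0n. Qed.

Lemma xi_mgf (i : 'I_n) (s : R) :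
  (\int[P]_w (expR (s * x w i))%:E = (expR (s ^+ 2 / 2))%:E)%E.
Proof. by apply: std_normal_mgf => B mB; exact: iid.2. Qed.

(** Each [expR (- lam * z - lam ^+ 2 / 2)] has mean 1 and second moment [expR (lam ^+ 2)], and the
    weights are at most 1. *)
Lemma expectation_eta_dev (mu : 'I_n -> R) (lam : R) :
  0 <= lam -> (forall i, 0 <= mu i) ->
  (\int[P]_w (eta_dev mu (x w) lam ^+ 2)%:E <= (expR (lam ^+ 2) / n%:R)%:E)%E.
Proof.
move=> l0 mu0; pose f (z : R) := expR (- lam * z - lam ^+ 2 / 2).
have mf : measurable_fun [set: R] f.
  by apply: measurableT_comp => //; apply: measurable_funB => //.
have fm i : (\int[P]_w (f (xi i w))%:E = 1%:E)%E.
  under eq_integral do rewrite /f expRD mulrC EFinM.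
  rewrite ge0_integralZl//.
  - rewrite (xi_mgf i) sqrrN -EFinM -expRD; congr (_%:E).
    by rewrite addrC subrr expR0.
  - by apply/measurable_EFinP; apply: measurableT_comp => //; exact: measurable_funM.
have fs i : (\int[P]_w (f (xi i w) ^+ 2)%:E = (expR (lam ^+ 2))%:E)%E.
  have fE w : f (xi i w) ^+ 2 = expR (- lam ^+ 2) * expR (- (2 * lam) * x w i).
    by rewrite /f -expRM_natl -expRD; congr expR; rewrite /x; field.
  under eq_integral do rewrite fE EFinM.
  rewrite ge0_integralZl//.
  - by rewrite (xi_mgf i) -EFinM -expRD; congr (expR _)%:E; field.
  - by apply/measurable_EFinP; apply: measurableT_comp => //; exact: measurable_funM.
have dev := @sqr_sum_deviation R n d T P xi iid.1 f 1 (expR (lam ^+ 2))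
  (fun i => expR (- (lam * mu i))) mf (fun z => expR_ge0 _) fm fs (fun i => expR_ge0 _).
have etaE w : eta_dev mu (x w) lam ^+ 2 = n%:R^-1 ^+ 2 *
    (\sum_i expR (- (lam * mu i)) * (f (xi i w) - 1)) ^+ 2 by rewrite /eta_dev exprMn.
under eq_integral do rewrite etaE EFinM.
rewrite ge0_integralZl//; last 2 first.
- apply/measurable_EFinP; apply: measurable_funX; apply: measurable_sum => i.
  apply: measurable_funM => //; apply: measurable_funB => //.
  exact: (measurableT_comp mf).
- by move=> w _; rewrite lee_fin sqr_ge0.
rewrite dev -EFinM lee_fin expr1n.
have e1 : 1 <= expR (lam ^+ 2) by rewrite -[leLHS]expR0 ler_expR sqr_ge0.
have sn : \sum_(i < n) expR (- (lam * mu i)) ^+ 2 <= n%:R.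
  rewrite -[leRHS]mulr1 mulr_natl -[X in _ <= _ *+ X]card_ord -sumr_const.
  apply: ler_sum => i _; rewrite expr_le1 ?expR_ge0// -[leRHS]expR0 ler_expR.
  by rewrite oppr_le0 mulr_ge0.
apply: (@le_trans _ _ (n%:R^-1 ^+ 2 * (expR (lam ^+ 2) * n%:R))).
  apply: ler_wpM2l; first exact: sqr_ge0.
  apply: ler_pM => //; [by rewrite subr_ge0 | | by rewrite gerBl].
  by apply: sumr_ge0 => i _; exact: sqr_ge0.
by rewrite le_eqVlt; apply/orP; left; apply/eqP; field; rewrite gt_eqF.
Qed.

Lemma measurable_eta_dev (mu : 'I_n -> R) (lam : R) :
  measurable_fun [set: T] (fun w => eta_dev mu (x w) lam).
Proof.
apply: measurable_funM => //; apply: measurable_sum => i.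
apply: measurable_funM => //; apply: measurable_funB => //.
apply: measurableT_comp => //; apply: measurable_funB => //.
by apply: measurable_funM.
Qed.

Lemma measurable_zeta (mu : 'I_n -> R) (q : nat) :
  measurable_fun [set: T] (fun w => zeta mu (x w) q).
Proof.
apply: measurable_funM => //; apply: measurable_funM => //.
apply: measurable_sum => j; apply: measurable_funM => //.
by apply: measurable_funX; exact: measurable_eta_dev.
Qed.

Lemma expectation_zeta (mu : 'I_n -> R) (q : nat) :
  (forall i, 0 <= mu i) -> (0 < q)%N ->
  (\int[P]_w (zeta mu (x w) q)%:E <= (expR (- (4 / 3 * (a_const R * q%:R))))%:E)%E.
Proof.
move=> mu0 q0; rewrite /zeta; set A := \sum_(j < q.+1) `|cheb_coef R j q|.
set c := n%:R * _; have A0 : 0 <= A by exact: sumr_ge0.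
have c0 : 0 <= c by rewrite mulr_ge0// expR_ge0.
under eq_integral do rewrite mulrAC EFinM.
rewrite ge0_integralZl//; last 3 first.
- apply/measurable_EFinP; apply: measurable_sum => j; apply: measurable_funM => //.
  by apply: measurable_funX; exact: measurable_eta_dev.
- by move=> w _; rewrite lee_fin; apply: sumr_ge0 => j _; rewrite mulr_ge0 ?sqr_ge0.
- by rewrite lee_fin mulr_ge0.
have e2q (j : 'I_q.+1) : (j%:R * lambda_ R q) ^+ 2 <= 2 * q%:R.
  have jq : j%:R <= q%:R :> R by rewrite ler_nat -ltnS.
  have -> : 2 * q%:R = (q%:R * lambda_ R q) ^+ 2 :> R.
    rewrite exprMn /lambda_ sqr_sqrtr ?divr_ge0//; field; rewrite gt_eqF// ltr0n//.
  by apply: lerXn2r; rewrite ?nnegrE ?mulr_ge0 ?lambda_ge0// ler_wpM2r ?lambda_ge0.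
have sumle : (\int[P]_w (\sum_(j < q.+1) `|cheb_coef R j q| *
     eta_dev mu (x w) (j%:R * lambda_ R q) ^+ 2)%:E <= (A * (expR (2 * q%:R) / n%:R))%:E)%E.
  under eq_integral do rewrite -sumEFin.
  rewrite ge0_integral_sum//; last 2 first.
  - move=> j; apply/measurable_EFinP; apply: measurable_funM => //.
    by apply: measurable_funX; exact: measurable_eta_dev.
  - by move=> j w _; rewrite lee_fin mulr_ge0 ?sqr_ge0.
  rewrite /A mulr_suml -sumEFin; apply: lee_sum => j _.
  under eq_integral do rewrite EFinM.
  rewrite ge0_integralZl//; last 2 first.
  - by apply/measurable_EFinP; apply: measurable_funX; exact: measurable_eta_dev.
  - by move=> w _; rewrite lee_fin sqr_ge0.
  rewrite EFinM lee_wpmul2l ?lee_fin//.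
  apply: le_trans (expectation_eta_dev _ _) _ => //.
    by rewrite mulr_ge0 ?lambda_ge0.
  by rewrite lee_fin ler_wpM2r ?invr_ge0 ?(ltW nR)// ler_expR.
apply: (@le_trans _ _ ((A * c)%:E * (A * (expR (2 * q%:R) / n%:R))%:E)%E).
  by rewrite lee_wpmul2l ?lee_fin ?mulr_ge0.
rewrite -EFinM lee_fin.
have Ale : A <= expR ((a_const R / 3 - 1) * q%:R).
  by rewrite expRM_natr a_const_expR sum_norm_cheb_coef.
have -> : A * c * (A * (expR (2 * q%:R) / n%:R)) =
    A ^+ 2 * (expR (- (2 * (a_const R * q%:R))) * expR (2 * q%:R)).
  by rewrite /c; field; rewrite gt_eqF.
apply: (@le_trans _ _ (expR ((a_const R / 3 - 1) * q%:R) ^+ 2 *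
    (expR (- (2 * (a_const R * q%:R))) * expR (2 * q%:R)))).
  by rewrite ler_wpM2r ?mulr_ge0 ?expR_ge0// lerXn2r ?nnegrE ?expR_ge0.
(* Per unit of [q] the exponents add up to [2 * (a/3 - 1) - 2a + 2 = -4a/3]. *)
rewrite -expRM_natl -!expRD ler_expR; lra.
Qed.

Lemma measurable_zeta_ext (i0 : 'I_n) :
  measurable_fun [set: T] (fun w => zeta_ext (x w) i0).
Proof.
apply: measurable_funD.
  by apply: measurableT_comp => //; apply: measurable_funB => //; exact: measurable_funM.
apply: measurable_sum => i; apply: measurableT_comp => //.
by apply: measurable_funB => //; exact: measurable_funM.
Qed.

(** With [L = ln n], the first exponential has mean [e^(L - 2L) = 1/n], and each of the [n] others
    [e^(2L - 4L) = 1/n^2]. *)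
Lemma expectation_zeta_ext (i0 : 'I_n) :
  (\int[P]_w (zeta_ext (x w) i0)%:E = (2 / n%:R)%:E)%E.
Proof.
have L0 : 0 <= ln n%:R :> R by rewrite ln_ge0// ler1n.
have nE : n%:R^-1 = expR (- ln n%:R) :> R by rewrite expRN lnK// posrE.
have term i (s c : R) : (\int[P]_w (expR (s * x w i - c))%:E = (expR (s ^+ 2 / 2 - c))%:E)%E.
  under eq_integral do rewrite expRD mulrC EFinM.
  rewrite ge0_integralZl//.
  - by rewrite xi_mgf -EFinM -expRD addrC.
  - by apply/measurable_EFinP; apply: measurableT_comp => //; exact: measurable_funM.
have mterm i (s c : R) : measurable_fun [set: T] (fun w => (expR (s * x w i - c))%:E).
  apply/measurable_EFinP; apply: measurableT_comp => //; apply: measurable_funB => //.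
  exact: measurable_funM.
rewrite /zeta_ext; under eq_integral do rewrite EFinD -sumEFin.
rewrite ge0_integralD//; last 2 first.
- by move=> w _; apply: sume_ge0 => i _; rewrite lee_fin expR_ge0.
- by apply: emeasurable_sum => i; exact: mterm.
rewrite ge0_integral_sum// term.
under eq_bigr do rewrite term.
rewrite sumEFin sumr_const card_ord -EFinD; congr EFin.
rewrite sqr_sqrtr ?mulr_ge0// sqrrN exprMn sqr_sqrtr//.
have -> : 2 * ln n%:R / 2 - 2 * ln n%:R = - ln n%:R :> R by field.
have -> : 2 ^+ 2 * ln n%:R / 2 - 4 * ln n%:R = - ln n%:R - ln n%:R :> R by field.
rewrite expRD -nE -mulr_natl; field; rewrite gt_eqF//.
Qed.

Lemma measurable_zeta_med (mu : 'I_n -> R) (v : R) :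
  measurable_fun [set: T] (fun w => zeta_med mu (x w) v).
Proof.
apply: measurable_funM => //; apply: measurable_funX; apply: measurable_sum => i.
apply: measurable_funM => //; apply: measurable_funB => //.
rewrite (_ : (fun w => _) = (fun w => if x w i <= v then 1 else 0)); last first.
  by apply/funext => w; case: ifP.
by apply: measurable_fun_ifT => //; exact: measurable_fun_ler.
Qed.

Lemma expectation_zeta_med (mu : 'I_n -> R) (v : R) : 0 < v ->
  (\int[P]_w (zeta_med mu (x w) v)%:E <=
   (4 / (n%:R * (normal_density_lb R * v) ^+ 2))%:E)%E.
Proof.
move=> v0; set p := fine (normal_prob (0 : R) 1 `]-oo, v]%classic).
pose f (z : R) : R := (z <= v)%R%:R.
have mf : measurable_fun [set: R] f.
  rewrite (_ : f = (fun z => if z <= v then 1 else 0)); last by apply/funext => z; rewrite /f; case: ifP.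
  by apply: measurable_fun_ifT => //; exact: measurable_fun_ler.
have fm i : (\int[P]_w (f (xi i w))%:E = p%:E)%E.
  have mB : measurable (`]-oo, v]%classic : set R) by exact: measurable_itv.
  have fE w : f (xi i w) = \1_(xi i @^-1` `]-oo, v]%classic) w :> R.
    rewrite /f indicE; congr (_ : bool)%:R; apply/idP/idP => h.
      by rewrite inE /= in_itv.
    by move: h; rewrite inE /= in_itv.
  under eq_integral do rewrite fE.
  rewrite integral_indic// ?setIT; last by rewrite -[X in measurable X]setTI; exact: (measurable_funPT (xi i)).
  by rewrite /p -normal_prob_le_fin; exact: iid.2.
have fs i : (\int[P]_w (f (xi i w) ^+ 2)%:E = p%:E)%E.
  rewrite -(fm i); apply: eq_integral => w _; rewrite /f.
  by case: (xi i w <= v); rewrite ?expr1n ?expr0n.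
have dev := @sqr_sum_deviation R n d T P xi iid.1 f p p (fun i => (mu i == 0)%:R)
  mf (fun z => ler0n _ _) fm fs (fun i => ler0n _ _).
set c := normal_density_lb R; have c0 : 0 < c by exact: normal_density_lb_gt0.
rewrite /zeta_med -/p -/c; under eq_integral do rewrite mulrC EFinM.
rewrite ge0_integralZl//; last 3 first.
- apply/measurable_EFinP; apply: measurable_funX; apply: measurable_sum => i.
  apply: measurable_funM => //; apply: measurable_funB => //.
  exact: (measurableT_comp mf (mx i)).
- by move=> w _; rewrite lee_fin sqr_ge0.
- by rewrite lee_fin divr_ge0 ?sqr_ge0.
rewrite [X in (_ * X)%E]dev -EFinM lee_fin.
have sn : (p - p ^+ 2) * \sum_(i < n) (mu i == 0)%:R ^+ 2 <= n%:R.
  have s1 : \sum_(i < n) (mu i == 0)%:R ^+ 2 <= n%:R :> R.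
    rewrite -[leRHS]mulr1 mulr_natl -[X in _ <= _ *+ X]card_ord -sumr_const.
    by apply: ler_sum => i _; case: eqP; rewrite ?expr1n ?expr0n.
  have s0 : 0 <= \sum_(i < n) (mu i == 0)%:R ^+ 2 :> R by apply: sumr_ge0 => i _; exact: sqr_ge0.
  have : p - p ^+ 2 <= 1 by have := sqr_ge0 (p - 1); have := sqr_ge0 p; nra.
  nra.
apply: (@le_trans _ _ (4 / (n%:R * c * v) ^+ 2 * n%:R)).
  by rewrite ler_wpM2l// divr_ge0 ?sqr_ge0.
by rewrite le_eqVlt; apply/orP; left; apply/eqP; field; rewrite !gt_eqF.
Qed.

End expectations.

(** * Pointwise bounds *)

(* The largest [q] with [1 <= z q] pays for the whole error. *)
Lemma layer_sum (R : realDomainType) (Q qs : nat) (z b : nat -> R) (B0 D : R) :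
  (forall q, 0 <= z q) -> (forall q, 0 <= b q) -> 0 <= B0 ->
  ((forall q, ~~ odd q -> (qs <= q <= Q)%N -> z q < 1) -> D <= B0) ->
  (forall q, ~~ odd q -> (qs <= q <= Q)%N ->
     (forall q', ~~ odd q' -> (q < q' <= Q)%N -> z q' < 1) -> D <= b q) ->
  D <= B0 + \sum_(qs <= q < Q.+1 | ~~ odd q) b q * z q.
Proof.
move=> z0 b0 B00 hall hsome.
have s0 (P : pred nat) : 0 <= \sum_(qs <= q < Q.+1 | P q) b q * z q.
  by apply: sumr_ge0 => q _; rewrite mulr_ge0.
pose bad (q : nat) := [&& ~~ odd q, (qs <= q <= Q)%N & 1 <= z q].
have [/existsP[q0 badq0]|nobad] := boolP [exists q : 'I_Q.+1, bad q]; last first.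
  rewrite -[leLHS]addr0 lerD// hall// => q oq qQ; rewrite ltNge; apply: contraNN nobad => zq.
  have qlt : (q < Q.+1)%N by case/andP: qQ.
  by apply/existsP; exists (Ordinal qlt); rewrite /bad /= oq qQ.
case: (@arg_maxnP _ q0 (fun q : 'I_Q.+1 => bad q) (fun q => q : nat) badq0) => q badq qmax.
have /and3P[oq qQ zq] := badq.
have Db : D <= b q.
  apply: hsome => // q' oq' /andP[qq' q'Q]; rewrite ltNge; apply/negP => zq'.
  have badq' : bad (Ordinal (q'Q : (q' < Q.+1)%N)).
    by rewrite /bad oq' zq' q'Q (leq_trans _ (ltnW qq'))//; case/andP: qQ.
  by have := qmax _ badq'; rewrite /= leqNgt qq'.
apply: (le_trans Db); apply: (@le_trans _ _ (b q * z q)); first by rewrite ler_peMr.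
have qin : (q : nat) \in index_iota qs Q.+1 by rewrite mem_index_iota ltnS.
rewrite big_mkcond (bigD1_seq (q : nat) qin) ?iota_uniq//= oq addrCA lerDl addr_ge0//.
by apply: sumr_ge0 => q' _; case: (odd q') => //=; rewrite mulr_ge0.
Qed.

(* [theta_med] is consistent only for moderate sparsity; for larger [k] the lower
   end of the search interval is used only when it is [-oo]. *)
Definition zeta_rough (R : realType) (n k : nat) (mu x : 'I_n -> R) (i0 : 'I_n) : R :=
  zeta_ext x i0 +
  (if k%:R <= expR (4 / 5 * ln n%:R) :> R then zeta_med mu x (vbar R n) else 0).

Lemma even_top (q Q : nat) : ~~ odd q -> ~~ odd Q -> (q <= Q)%N -> (Q < q + 2)%N ->
  q = Q.
Proof. by move=> oq oQ qQ Qq; lia. Qed.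

Lemma even_ge4 (q : nat) : ~~ odd q -> (2 < q)%N -> (1 < q - 2)%N.
Proof. by move=> oq q2; lia. Qed.

Lemma radius_far_ge0 (R : realType) (n : nat) (l : R) : 0 <= radius_far n l.
Proof. by rewrite divr_ge0 ?sqr_ge0// mulr_ge0 ?sqrtr_ge0// mulr_ge0. Qed.

Section pointwise.
Context (R : realType) (n k : nat) (theta : R) (mu : 'I_n -> R) (i0 : 'I_n).
Local Notation a := (a_const R).
Local Notation L := (ln (n%:R : R)).
Local Notation Q := (qmax R n).
Local Notation l := (log_dilution R n k).
Local Notation s := (Num.sqrt (2 * L)).
Local Notation y x := (fun i => theta + mu i + x i).
Local Notation zr x := (zeta_rough k mu x i0).
Hypothesis Lbig : 346 * a <= L.
Hypothesis k1n : (1 <= k <= n - 1)%N.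
Hypothesis smu : sparse_nonneg k mu.
Hypothesis mui0 : mu i0 = 0.
Hypothesis vbar01 : 0 < vbar R n <= 1.
Hypothesis med_sparse : k%:R <= expR (4 / 5 * L) ->
  2 * k%:R <= n%:R * normal_density_lb R * vbar R n.

Lemma zeta_rough_ge0 x : 0 <= zr x.
Proof.
rewrite addr_ge0 ?zeta_ext_ge0//; case: (_ <= expR _) => //.
exact: zeta_med_ge0.
Qed.

Lemma zeta_ext_le_rough x : zeta_ext x i0 <= zr x.
Proof. by rewrite lerDl; case: (_ <= expR _) => //; exact: zeta_med_ge0. Qed.

(** When [zr x < 1], the clean index puts the minimum below [theta + s], and all noise terms are at
    least [- 2 sqrt L], which is exactly the shift in [theta_up]. *)
Lemma theta_hat_top_bounds x :
  [/\ `|theta_hat (y x) (Q + 2) - theta| <= 2 * s + zr x,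
   zr x < 1 -> `|theta_hat (y x) (Q + 2) - theta| <= 2 * s &
   zr x < 1 -> theta <= theta_up (y x)].
Proof.
have L1 : 1 <= L by have := Lbig_ge Lbig; lra.
have n0 := n_gt0_of_Lbig Lbig; have zle := zeta_ext_le_rough x.
have [[h1 h2] h3] := @zeta_ext_bound R n x i0 L1.
have hi0 := order_stat1_le (y x) i0; rewrite mui0 addr0 in hi0.
have [i hi] := @order_stat1_mem R n (y x) n0; have mi := smu.1 i.
have hs2 : 2 * Num.sqrt L <= 2 * s by rewrite ler_wpM2l// ler_wsqrtr//; lra.
have /andP[P0 P1] : 0 <= Phibar_inv (n%:R^-1 : R) <= s.
  have -> : n%:R^-1 = expR (- L) :> R by rewrite expRN -natr_expR.
  apply: Phibar_inv_bound; first lra.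
  rewrite expRN ltf_pV2 ?posrE ?expR_gt0//; have := expR_ge1Dx L; have := Lbig_ge Lbig; lra.
have -> : theta_hat (y x) (Q + 2) = order_stat (y x) 1 + Phibar_inv n%:R^-1.
  by rewrite /theta_hat addn2 eqxx.
move: (Phibar_inv _) P0 P1 => p P0 P1.
have h2i := h2 i; split.
- by rewrite ler_norml; apply/andP; split; lra.
- by move=> z1; have [h4 /(_ i) h5] := h3 (le_lt_trans zle z1); rewrite ler_norml; apply/andP; split; lra.
- by move=> z1; have [h4 /(_ i) h5] := h3 (le_lt_trans zle z1); rewrite /theta_up hi; lra.
Qed.

(** The top index is always admissible, so the selected estimator is within [4 * s] of it on every
    sample, including those where nothing else is controlled. *)
Lemma theta_ad_le_top x : `|theta_ad (y x) - theta| <= 6 * s + zr x /\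
  (zr x < 1 -> `|theta_ad (y x) - theta| <= 6 * s).
Proof.
have [oQ _] := qmax_spec Lbig; have [h1 h2 _] := theta_hat_top_bounds x.
have : `|theta_ad (y x) - theta_hat (y x) (Q + 2)| <= 4 * s.
  rewrite -(delta_top Lbig); apply: theta_ad_lepski => //; first exact: delta_ge0.
    by rewrite addn2 /= negbK.
  exact: admissible_top.
have := ler_distD (theta_hat (y x) (Q + 2)) (theta_ad (y x)) theta.
by move=> h3 h4; split=> [|/h2]; lra.
Qed.

(** Estimators lying to the right of [theta] differ by at most the larger radius, so each radius,
    and not their sum, is compared with [delta q']. For the top index two errors of [2 * s] fit into
    [4 * s]. *)
Lemma theta_ad_good x (q : nat) (v : nat -> R) :
  (q <= Q)%N -> ~~ odd q -> zr x < 1 ->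
  (forall q', ~~ odd q' -> (q <= q' <= Q)%N ->
     theta <= theta_hat (y x) q' <= theta + v q') ->
  (forall q', ~~ odd q' -> (q < q' <= Q)%N ->
     v q <= delta R n q' /\ v q' <= delta R n q') ->
  v q <= 2 * s -> `|theta_ad (y x) - theta| <= delta R n q + v q.
Proof.
move=> qQ oq z1 hv hd vs; have [_ /(_ z1) htop _] := theta_hat_top_bounds x.
have [oQ _] := qmax_spec Lbig.
have /andP[hq1 hq2] := hv q oq ltac:(by rewrite leqnn).
have adm : admissible (y x) q.
  apply/admissibleP => q' /andP[qq' q'Q] oq'.
  have [q'leQ|Qq'] := leqP q' Q.
    have /andP[h1 h2] := hv q' oq' ltac:(by rewrite (ltnW qq')).
    have [h3 h4] := hd q' oq' ltac:(by rewrite qq').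
    by rewrite ler_norml; apply/andP; split; lra.
  have -> : q' = (Q + 2)%N.
    apply/eqP; rewrite eqn_leq q'Q addn2 ltn_neqAle Qq' andbT.
    by apply: contraNneq oq' => <- /=; rewrite oQ.
  rewrite (delta_top Lbig); move: htop; rewrite !ler_norml => /andP[h1 h2].
  by apply/andP; split; lra.
have := theta_ad_lepski (delta_ge0 _ _ _) (leq_trans qQ (leq_addr _ _)) oq adm.
by rewrite !ler_norml => /andP[h1 h2]; apply/andP; split; lra.
Qed.

Lemma theta_low_le x (q : nat) : zr x < 1 ->
  (q%:R <= 3 / (10 * a) * L -> k%:R <= expR (4 / 5 * L)) ->
  (theta_low (y x) q <= theta%:E)%E.
Proof.
move=> z1 kq; rewrite /theta_low; case: (boolP (q%:R <= _)) => [/kq ks|_]; last exact: leNye.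
have zm : zeta_med mu x (vbar R n) < 1.
  apply: le_lt_trans z1; rewrite /zeta_rough ks lerDr; exact: zeta_ext_ge0.
rewrite lee_fin lerBlDr.
exact: (theta_med_le _ (n_gt0_of_Lbig Lbig) smu vbar01 (med_sparse ks) zm).
Qed.

Lemma theta_hat_near x (q0 q : nat) : (1 < q0)%N -> (q0 + 2 <= Q)%N ->
  (q0 <= q <= Q)%N -> ~~ odd q -> k%:R <= Num.sqrt n%:R * expR (a * q0%:R) ->
  zr x < 1 -> zeta mu x q < 1 ->
  theta <= theta_hat (y x) q <= theta + delta R n q.
Proof.
move=> q01 q0Q /andP[q0q qQ] oq kq0 z1 zq; have n0 := n_gt0_of_Lbig Lbig.
have [oQ _] := qmax_spec Lbig; have [_ _ /(_ z1) hup] := theta_hat_top_bounds x.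
have a3 := a_const_ge3 R; have nR : 0 < n%:R :> R by rewrite ltr0n.
have sn : 0 < Num.sqrt n%:R :> R by rewrite sqrtr_gt0.
have kn : k%:R / n%:R <= eps_level R n q0.
  rewrite -(epsE Lbig) ler_pdivrMr// mulrAC ler_pdivlMr//.
  rewrite -[X in _ <= _ * X](@sqr_sqrtr _ n%:R) ?(ltW nR)// expr2 mulrA ler_wpM2r ?(ltW sn)//.
  by rewrite mulrC.
have enq : eps_level R n q = expR (a * q%:R) / Num.sqrt n%:R by rewrite (epsE Lbig).
have low : (theta_low (y x) q <= theta%:E)%E.
  (* Where the median is used, [a * q0 <= 3/10 * L], so [k] is at most [n^(1/2 + 3/10)]: this is the
     exponent 4/5. *)
  apply: theta_low_le => // q310; apply: (le_trans kq0).
  rewrite (sqrtn_expR Lbig) -expRD ler_expR.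
  have q0qR : q0%:R <= q%:R :> R by rewrite ler_nat.
  have : a * q0%:R <= a * (3 / (10 * a) * L) by rewrite ler_wpM2l//; lra.
  have -> : a * (3 / (10 * a) * L) = 3 / 10 * L by field; rewrite gt_eqF//; lra.
  lra.
have nq := noise_le n0 zq.
apply: (theta_hat_bounds n0 _ oq _ smu (delta_ge0 _ _ _) enq) => //.
- exact: leq_trans (ltnW q01) q0q.
- by rewrite neq_ltn (leq_ltn_trans qQ)// addn2.
- by rewrite enq.
have [qQ2|qQ2] := leqP (q + 2) Q.
  apply: (crossing_below_qmax Lbig) => //; first exact: leq_trans q0q.
  apply: (le_trans kn); rewrite ler_expR lerD2r ler_wpM2l ?ler_nat//; lra.
have qE : q = Q by exact: even_top.
rewrite qE; apply: (crossing_at_qmax Lbig) => //; apply: (le_trans kn).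
apply: le_trans (@eps_le _ _ Lbig q0 2 _) _.
  by rewrite lerBrDr -(natrD R q0 2) ler_nat.
rewrite expRN div1r lef_pV2 ?posrE ?expR_gt0//.
by have := expR_ge1Dx (a * (2 + 2)); lra.
Qed.

Lemma theta_ad_near x (q0 q : nat) : (1 < q0)%N -> (q0 + 2 <= Q)%N ->
  (q0 <= q <= Q)%N -> ~~ odd q -> k%:R <= Num.sqrt n%:R * expR (a * q0%:R) ->
  zr x < 1 -> (forall q', ~~ odd q' -> (q <= q' <= Q)%N -> zeta mu x q' < 1) ->
  `|theta_ad (y x) - theta| <= 2 * delta R n q.
Proof.
move=> q01 q0Q /andP[q0q qQ] oq kq0 z1 zq; rewrite mulr_natl mulr2n.
have q1 : (1 < q)%N := leq_trans q01 q0q.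
apply: (theta_ad_good qQ oq z1).
- move=> q' oq' /andP[qq' q'Q]; apply: (theta_hat_near q01 q0Q _ oq' kq0 z1).
    by rewrite (leq_trans q0q qq') q'Q.
  by apply: zq => //; rewrite qq' q'Q.
- move=> q' oq' /andP[qq' q'Q]; split => //.
  exact: (delta_mono Lbig q1 (ltnW qq') q'Q).
have := delta_mono Lbig q1 qQ (leqnn Q); have := delta_qmax_le1 Lbig.
have := sqrt2L_ge Lbig; lra.
Qed.

Lemma theta_ad_far x : 4 * l + 52 <= Q%:R -> zr x < 1 -> zeta mu x Q < 1 ->
  `|theta_ad (y x) - theta| <= delta R n Q + radius_far n l.
Proof.
move=> lQ z1 zQ; have [oQ /andP[_ aQ]] := qmax_spec Lbig; have n0 := n_gt0_of_Lbig Lbig.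
have a3 := a_const_ge3 R; have l0 := log_dilution_ge0 Lbig k1n.
have r0 := radius_far_ge0 n l.
have Q0 : (0 < Q)%N by rewrite -(ltr_nat R); have := qmax_ge Lbig; lra.
have rs := radius_far_le Lbig l0 lQ; have s2 := sqrt2L_ge Lbig.
apply: (@theta_ad_good x Q (fun=> radius_far n l)) => //; last lra; last first.
  by move=> q' _ /andP[Qq' q'Q]; have := leq_trans Qq' q'Q; rewrite ltnn.
move=> q' _; rewrite -eqn_leq => /eqP <-.
have enq : eps_level R n Q = expR (a * Q%:R) / Num.sqrt n%:R by rewrite (epsE Lbig).
have [_ _ /(_ z1) hup] := theta_hat_top_bounds x.
have low : (theta_low (y x) Q <= theta%:E)%E.
  (* Here [k] may be close to [n], but [a * Q > L / 2 - 4 * a] exceeds [3/10 * L], so the lower end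
     of the search interval is [-oo]. *)
  apply: theta_low_le => // Q310; exfalso.
  have : a * Q%:R <= a * (3 / (10 * a) * L) by rewrite ler_wpM2l//; lra.
  have -> : a * (3 / (10 * a) * L) = 3 / 10 * L by field; rewrite gt_eqF//; lra.
  by move: Lbig aQ; lra.
have nq := noise_le n0 zQ.
apply: (theta_hat_bounds n0 Q0 oQ _ smu r0 enq) => //.
- by rewrite neq_ltn addn2 ltnW.
- by rewrite enq.
by rewrite -(expR_log_dilution Lbig k1n); exact: (crossing_far Lbig).
Qed.

Local Notation D x := (`|theta_ad (y x) - theta|).

Definition layer_weight (q : nat) : R :=
  if (q + 2 <= Q)%N then 2 * delta R n (q + 2) else 6 * s.

Lemma layer_weight_ge0 q : 0 <= layer_weight q.
Proof.
by rewrite /layer_weight; case: (_ <= _)%N; rewrite mulr_ge0 ?sqrtr_ge0 ?delta_ge0.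
Qed.

(** If [zr x < 1], [layer_sum] is applied twice: to the error, and to the indicator that it exceeds
    [B0]. Otherwise the crude bound [6 * s + zr x] is at most [(6 * s + 1) * zr x]. *)
Lemma pointwise_bounds_of_layers (qs : nat) (B0 : R) : 0 <= B0 ->
  (forall x, zr x < 1 ->
     (forall q, ~~ odd q -> (qs <= q <= Q)%N -> zeta mu x q < 1) -> D x <= B0) ->
  (forall x q, zr x < 1 -> ~~ odd q -> (qs <= q <= Q)%N ->
     (forall q', ~~ odd q' -> (q < q' <= Q)%N -> zeta mu x q' < 1) ->
     D x <= layer_weight q) ->
  forall x,
  D x <= B0 + \sum_(qs <= q < Q.+1 | ~~ odd q) layer_weight q * zeta mu x q +
         (6 * s + 1) * zr x /\
  (B0 < D x)%R%:R <= \sum_(qs <= q < Q.+1 | ~~ odd q) zeta mu x q + zr x.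
Proof.
move=> B00 hall hsome x; have z0 := zeta_rough_ge0 x; have s0 : 0 <= s := sqrtr_ge0 _.
have [hz|hz] := ltP (zr x) 1; last first.
  split; last first.
    apply: (@le_trans _ _ 1); first by case: (_ < _).
    apply: (le_trans hz); rewrite lerDr sumr_ge0// => q _; exact: zeta_ge0.
  have [h _] := theta_ad_le_top x.
  have : 0 <= \sum_(qs <= q < Q.+1 | ~~ odd q) layer_weight q * zeta mu x q.
    by apply: sumr_ge0 => q _; rewrite mulr_ge0 ?layer_weight_ge0 ?zeta_ge0.
  move: (\sum_(_ <= _ < _ | _) _) h => S h S0; move: (zr x) (D x) h z0 hz => Z DD h z0 hz; nra.
split.
  apply: le_trans (_ : B0 + \sum_(qs <= q < Q.+1 | ~~ odd q) layer_weight q * zeta mu x q <= _).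
    apply: layer_sum => //; first by move=> q; exact: zeta_ge0.
    - exact: layer_weight_ge0.
    - exact: hall.
    - by move=> q; exact: hsome.
  by rewrite lerDl mulr_ge0//; lra.
apply: le_trans (_ : 0 + \sum_(qs <= q < Q.+1 | ~~ odd q) 1 * zeta mu x q <= _); last first.
  by rewrite add0r; under eq_bigr do rewrite mul1r; rewrite lerDl.
apply: layer_sum => //.
- by move=> q; exact: zeta_ge0.
- by move=> /(hall _ hz); rewrite leNgt => /negbTE ->.
- by move=> q _ _ _; case: (_ < _).
Qed.

Definition rate_cst : R := rate_cst_near R + rate_cst_far R + rate_cst_top R.

Lemma rate_csts_ge0 : [/\ 0 <= rate_cst_near R, 0 <= rate_cst_far R & 0 <= rate_cst_top R].
Proof.
have a3 : 0 <= a by have := a_const_ge3 R; lra.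
rewrite /rate_cst_near /rate_cst_far /rate_cst_top; move: (a_const R) a3 => b b0.
split; rewrite ?mulr_ge0 ?addr_ge0 ?mulr_ge0 ?sqr_ge0 ?sqrtr_ge0 ?expR_ge0//.
Qed.

Lemma tail_bound_ge_half :
  ln 2 ^+ 3 * expR (- (4 / 3 * (L / 2))) <= tail_bound R n k.
Proof.
have nR : 0 < n%:R :> R by rewrite ltr0n (n_gt0_of_Lbig Lbig).
have kn : k%:R <= n%:R :> R.
  by rewrite ler_nat; apply: leq_trans (leq_subr 1 n); case/andP: k1n.
have L1 := Lbig_ge Lbig.
apply: (tail_bound_ge Lbig k1n).
rewrite (sqrtn_expR Lbig) -expRD -splitr ge_max -(natr_expR Lbig) kn/=.
by rewrite [leRHS](natr_expR Lbig) ler_expR; lra.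
Qed.

(** [a * Q > L / 2 - 4 * a], and [4/3 * 4a <= 6a]. *)
Lemma tail_bound_ge_qmax (q : nat) : Q%:R <= q%:R :> R ->
  ln 2 ^+ 3 * expR (- (4 / 3 * (a * q%:R))) <= expR (6 * a) * tail_bound R n k.
Proof.
move=> Qq; have [_ /andP[_ aQ]] := qmax_spec Lbig; have a3 := a_const_ge3 R.
apply: (@le_trans _ _ (expR (6 * a) * (ln 2 ^+ 3 * expR (- (4 / 3 * (L / 2)))))); last first.
  by rewrite ler_wpM2l ?expR_ge0// tail_bound_ge_half.
rewrite [leRHS]mulrCA ler_wpM2l ?exprn_ge0 ?ln_ge0 ?ler1n// -expRD ler_expR.
have : a * Q%:R <= a * q%:R by rewrite ler_wpM2l//; lra.
lra.
Qed.

(** The fourth clause compares the bound on the mean of [zeta qs], which leads the sum of layers,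
    with the tail bound. In the last regime [qs = qmax + 2] makes that sum empty. *)
Lemma exists_layer_bounds : exists (B0 : R) (qs : nat), [/\ (1 < qs)%N, 0 <= B0,
  B0 <= rate_cst * rate R n k,
  ln 2 ^+ 3 * expR (- (4 / 3 * (a * qs%:R))) <= expR (6 * a) * tail_bound R n k &
  forall x,
  D x <= B0 + \sum_(qs <= q < Q.+1 | ~~ odd q) layer_weight q * zeta mu x q +
         (6 * s + 1) * zr x /\
  (B0 < D x)%R%:R <= \sum_(qs <= q < Q.+1 | ~~ odd q) zeta mu x q + zr x].
Proof.
have [c1 c2 c3] := rate_csts_ge0; have r0 := rate_gt0 Lbig k1n.
have a3 := a_const_ge3 R; have Q169 := qmax_ge Lbig.
have [oQ /andP[_ aQ]] := qmax_spec Lbig.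
have Qn : (169 <= Q)%N by rewrite -(ler_nat R).
have s0 : 0 <= s := sqrtr_ge0 _.
have wE q : ~~ odd q -> (q <= Q)%N -> (Q < q + 2)%N -> layer_weight q = 6 * s.
  by move=> oq qQ; rewrite /layer_weight ltnNge => /negbTE ->.
pose near (q : nat) := [&& ~~ odd q, (1 < q)%N, (q + 2 <= Q)%N &
  k%:R <= Num.sqrt n%:R * expR (a * q%:R)].
have [/existsP[q near_q]|far] := boolP [exists q : 'I_Q, near q].
  have exq : exists q, near q by exists (q : nat).
  case: (ex_minnP exq) => qs /and4P[oqs qs1 qsQ kqs] qmin.
  exists (2 * delta R n qs), qs; split => //.
  - by rewrite mulr_ge0// delta_ge0.
  - apply: (@le_trans _ _ (rate_cst_near R * rate R n k)).
      apply: delta_le_rate => //; first by apply: leq_trans qsQ; rewrite addn2 ltnS.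
      have [qs2|qs2] := leqP qs 2; [by left; apply/eqP; rewrite eqn_leq qs2|right].
      rewrite ltNge; apply/negP => h.
      have : near (qs - 2)%N.
        apply/and4P; split; last by rewrite natrB// ltnW.
        - by rewrite oddB ?addbF// ltnW.
        - exact: even_ge4.
        - by rewrite subnK ?(ltnW qs2)// (leq_trans _ qsQ)// leq_addr.
      by move=> /qmin; rewrite leqNgt ltn_subrL (leq_trans _ qs2).
    by rewrite ler_wpM2r ?(ltW r0)// /rate_cst; lra.
  - have h : Num.max k%:R (Num.sqrt n%:R) <= Num.sqrt n%:R * expR (a * qs%:R).
      rewrite ge_max kqs/= ler_peMr ?sqrtr_ge0// -expR0 ler_expR mulr_ge0//; lra.
    apply: (le_trans (tail_bound_ge Lbig k1n h)).
    have := tail_bound_ge Lbig k1n h; have e1 : 1 <= expR (6 * a).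
      by rewrite -[leLHS]expR0 ler_expR; lra.
    move: (expR (6 * a)) e1 => e e1 h'; rewrite ler_peMl//.
    by apply: le_trans h'; rewrite mulr_ge0 ?exprn_ge0 ?ln_ge0 ?ler1n// expR_ge0.
  apply: pointwise_bounds_of_layers => //; first by rewrite mulr_ge0// delta_ge0.
    move=> x z1 hq; apply: (theta_ad_near qs1 qsQ _ oqs kqs z1 hq).
    by rewrite leqnn (leq_trans _ qsQ)// leq_addr.
  move=> x q' z1 oq' /andP[qq' q'Q] hq.
  have [h|h] := leqP (q' + 2) Q; last first.
    by rewrite (wE q' oq' q'Q h); exact: (theta_ad_le_top x).2 z1.
  rewrite /layer_weight h; apply: (theta_ad_near qs1 qsQ _ _ kqs z1).
  - by rewrite h (leq_trans qq')// leq_addr.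
  - by rewrite addn2 /= negbK.
  - by move=> q'' oq'' /andP[h1 h2]; apply: hq => //; rewrite h2 (leq_trans _ h1)// addn2 ltnW.
(* Since [Q - 2] does not qualify, [k > sqrt n * e^(a (Q - 2))], while [sqrt n < e^(a (Q + 4))]. *)
have kfar : expR (- (6 * a)) <= k%:R / n%:R.
  have Q2Q : (Q - 2 < Q)%N by rewrite ltn_subrL andTb (leq_trans _ Qn).
  have Q2 : (2 <= Q)%N by apply: leq_trans Qn.
  move: far; rewrite negb_exists => /forallP/(_ (Ordinal Q2Q)).
  rewrite /near /= subnK// leqnn oddB// addbF (negbTE oQ) ltn_subRL (leq_trans _ Qn)//= -ltNge => kQ.
  rewrite ler_pdivlMr ?ltr0n ?(n_gt0_of_Lbig Lbig)//; apply: le_trans (ltW kQ).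
  rewrite [X in _ * X](natr_expR Lbig) (sqrtn_expR Lbig) -!expRD ler_expR natrB//.
  by move: aQ; lra.
have [lQ|Ql] := leP (4 * l + 52) (Q%:R : R).
  have B0 : 0 <= delta R n Q + radius_far n l.
    by rewrite addr_ge0 ?delta_ge0 ?radius_far_ge0.
  exists (delta R n Q + radius_far n l), Q; split => //.
  - exact: leq_trans Qn.
  - apply: (le_trans (far_le_rate Lbig k1n kfar)).
    by rewrite ler_wpM2r ?(ltW r0)// /rate_cst; lra.
  - exact: tail_bound_ge_qmax.
  apply: pointwise_bounds_of_layers => //.
    by move=> x z1 hq; apply: theta_ad_far => //; apply: hq => //; rewrite leqnn.
  move=> x q z1 oq; rewrite -eqn_leq => /eqP <- _.
  have Q2 : (Q < Q + 2)%N by rewrite addn2 ltnW.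
  by rewrite (wE Q oQ (leqnn _) Q2); exact: (theta_ad_le_top x).2 z1.
exists (6 * s), (Q + 2)%N; split => //.
- by apply: leq_trans (leq_addr _ _); exact: leq_trans Qn.
- apply: (le_trans (top_le_rate Lbig k1n Ql)).
  by rewrite ler_wpM2r ?(ltW r0)// /rate_cst; lra.
- by apply: tail_bound_ge_qmax; rewrite ler_nat leq_addr.
apply: pointwise_bounds_of_layers => //.
  by move=> x z1 _; exact: (theta_ad_le_top x).2 z1.
by move=> x q _ _ /andP[h1 h2]; have := leq_trans h1 h2; rewrite addn2 ltnNge leqnSn.
Qed.
End pointwise.

(** * Expectations *)

(** The ratio is [e^(-x) <= 1 / (1 + x) <= 2/3], hence the constant 3. *)
Lemma geometric_expR_sum_le (R : realType) (x : R) (m N : nat) : 1 / 2 <= x ->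
  \sum_(m <= q < N) expR (- (x * q%:R)) <= 3 * expR (- (x * m%:R)).
Proof.
move=> x2; have [Nm|mN] := leqP N m; first by rewrite big_geq// mulr_ge0// expR_ge0.
have x0 : expR (- x) <= 2 / 3.
  rewrite expRN -[leRHS]invrK lef_pV2 ?posrE ?expR_gt0//.
  by have := expR_ge1Dx x; rewrite invf_div; lra.
rewrite -(subnK (ltnW mN)); move: (N - m)%N => d {mN}; elim: d m => [|d IH] m.
  by rewrite big_geq// mulr_ge0// expR_ge0.
rewrite addSnnS big_ltn ?leq_addl//; apply: le_trans (lerD (lexx _) (IH _)) _.
have -> : - (x * m.+1%:R) = - (x * m%:R) - x by rewrite -natr1; ring.
rewrite expRD; have := expR_ge0 (- (x * m%:R)).
by move: (expR (- (x * _))) (expR _) x0 => u w; nra.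
Qed.

Lemma expr_le_expR (R : realType) (x : R) (m : nat) : 0 <= x -> x ^+ m <= expR (m%:R * x).
Proof.
move=> x0; rewrite expRM_natl lerXn2r ?nnegrE ?expR_ge0//.
by have := expR_ge1Dx x; lra.
Qed.

(** * Numerical bounds on weights and remainders *)

Section large_sample_numerics.
Context (R : realType) (n : nat).
Local Notation a := (a_const R).
Local Notation L := (ln (n%:R : R)).
Local Notation Q := (qmax R n).
Local Notation c := (normal_density_lb R).
Local Notation s := (Num.sqrt (2 * L)).
Hypothesis Lbig : 346 * a <= L.

Lemma sqrt2L_le : 6 * s + 1 <= 13 * L.
Proof.
have L1 := Lbig_ge Lbig; have s2 : s ^+ 2 = 2 * L by rewrite sqr_sqrtr//; lra.
have := sqrtr_ge0 (2 * L); move: (Num.sqrt _) s2 => t t2 t0; nra.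
Qed.

Lemma pow4_le_expR : L ^+ 4 <= 4096 * expR (L / 2).
Proof.
have L0 : 0 <= L / 8 by have := Lbig_ge Lbig; lra.
have := expr_le_expR 4 L0.
rewrite (_ : 4%:R * (L / 8) = L / 2); last by field.
by rewrite exprMn exprVn; lra.
Qed.

Lemma pow3_le_expR : L ^+ 3 <= 729 * expR (L / 3).
Proof.
have L0 : 0 <= L / 9 by have := Lbig_ge Lbig; lra.
have := expr_le_expR 3 L0.
rewrite (_ : 3%:R * (L / 9) = L / 3); last by field.
by rewrite exprMn exprVn; lra.
Qed.

(** From [4 <= pi^2 <= 16] and [Q <= L / 6]: [36 * Q^(3/2) <= L^2], and [144^2 / 16 / 6^3 = 6]. *)
Lemma vbar_bounds : [/\ 0 < vbar R n <= 1, L ^- 2 <= vbar R n &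
  vbar R n ^- 2 <= 6 * L ^+ 3].
Proof.
have Q1 := qmax_ge Lbig; have s1 := sqrtQ_ge Lbig; have L1 := Lbig_ge Lbig.
have QL := qmax_ub Lbig; have p2 := pi_ge2 R; have p4 := pihalf_lt2 R.
have Q0 : 0 <= Q%:R :> R by [].
have sE : Num.sqrt Q%:R ^+ 2 = Q%:R :> R by rewrite sqr_sqrtr.
rewrite /vbar powR32//; move: (Num.sqrt Q%:R) sE s1 => t tE t1.
have tQ : t <= Q%:R by rewrite -tE; nra.
have Qt1 : 169 * 13 <= Q%:R * t by nra.
have pp : 4 <= (pi : R) ^+ 2 <= 16 by move: (pi : R) p2 p4 => p p2 p4; apply/andP; split; nra.
move: (pi ^+ 2 : R) pp => p2' /andP[pl pu].
have d0 : 0 < 144 * (Q%:R * t) by lra.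
split.
- rewrite divr_gt0//=; last lra.
  by rewrite ler_pdivrMr//; lra.
- rewrite -[leLHS]div1r ler_pdivrMr ?exprn_gt0//; last lra.
  rewrite mulrAC ler_pdivlMr// mul1r.
  have : Q%:R * t <= (L / 6) ^+ 2 by rewrite expr2; nra.
  have := sqr_ge0 L; nra.
rewrite -exprVn invf_div expr_div_n ler_pdivrMr ?exprn_gt0//; last lra.
have -> : (144 * (Q%:R * t)) ^+ 2 = 144 ^+ 2 * Q%:R ^+ 3 by rewrite !exprMn tE; ring.
have Q3 : Q%:R ^+ 3 <= (L / 6) ^+ 3 by rewrite lerXn2r ?nnegrE//; lra.
have L3 : 0 <= L ^+ 3 by rewrite exprn_ge0//; lra.
have : 16 <= p2' ^+ 2 by nra.
by move: Q3; rewrite exprMn exprVn; move: (p2' ^+ 2) (L ^+ 3) L3 (Q%:R ^+ 3) => u v v0 w; nra.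
Qed.

(** The gap between [n^(4/5)] and [n] is [e^(L/5) >= (L/20)^4], while [vbar] costs [L^(-2)]. It
    remains that [320000 <= c * L^2], from [320 <= c * L] and [1000 <= L]. *)
Lemma med_sparse_of_large (k : nat) : 320 / c <= L -> k%:R <= expR (4 / 5 * L) ->
  2 * k%:R <= n%:R * c * vbar R n.
Proof.
move=> Lc kL; have c0 := normal_density_lb_gt0 R; have L1 := Lbig_ge Lbig.
have [_ vl _] := vbar_bounds; have L0 : 0 < L ^+ 2 by rewrite exprn_gt0//; lra.
apply: (@le_trans _ _ (2 * expR (4 / 5 * L))); first by rewrite ler_wpM2l.
apply: (@le_trans _ _ (n%:R * c * L ^- 2)); last first.
  by rewrite ler_wpM2l// mulr_ge0// ltW.
rewrite [X in X * c](natr_expR Lbig) ler_pdivlMr//.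
have LE : L = 4 / 5 * L + 4%:R * (L / 20) by field.
rewrite [in leRHS]LE expRD.
have F : (L / 20) ^+ 4 <= expR (4%:R * (L / 20)) by apply: expr_le_expR; lra.
have cL : 320 * 1000 <= L ^+ 2 * c.
  have : 320 <= L * c by rewrite -ler_pdivrMr.
  by rewrite expr2 -mulrA; move: (L * c) => u; nra.
have {}F : L ^+ 2 * L ^+ 2 <= 400 * 400 * expR (4%:R * (L / 20)).
  by move: F; rewrite exprMn exprVn -exprD; lra.
move: (L ^+ 2) (expR (4 / 5 * L)) (expR (4%:R * (L / 20))) L0 cL F (expR_ge0 (4 / 5 * L)).
move: (normal_density_lb R) c0 {Lc} => b b0 M E E' M0 cL F E0.
have h : 2 * M <= E' * b.
  have h1 : M * (320 * 1000) <= M * (M * b) by rewrite ler_wpM2l// ltW.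
  have : M * M * b <= 400 * 400 * E' * b by rewrite ler_wpM2r// ltW.
  lra.
by rewrite mulrAC [leRHS]mulrAC -mulrA [leRHS]mulrC; nra.
Qed.

(** As [delta (q + 2)] grows like [e^(aq)], the product decays like [e^(-aq/3)]. Half of this decay
    is kept for the geometric sum; the other half, about [n^(-1/12)] at [q = Q], absorbs the weight
    [6 * s] there. The [7a] is [7/6] of the bound [6a] for [L / 2 - a * (Q - 2)]. *)
Lemma layer_weight_mul_le (q : nat) : ~~ odd q -> (1 < q <= Q)%N ->
  layer_weight R n q * expR (- (4 / 3 * (a * q%:R))) <=
  156 * expR (7 * a) / Num.sqrt n%:R * expR (- (a / 6 * q%:R)).
Proof.
move=> oq /andP[q1 qQ]; have a3 := a_const_ge3 R; have [oQ /andP[_ aQ]] := qmax_spec Lbig.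
have L1 := Lbig_ge Lbig.
have -> : - (4 / 3 * (a * q%:R)) = - (7 / 6 * (a * q%:R)) - a / 6 * q%:R by field.
rewrite expRD mulrA ler_wpM2r ?expR_ge0// (sqrtn_expR Lbig) -expRN.
have aq0 : 0 <= a * q%:R by rewrite mulr_ge0//; lra.
have E7 : 1 <= expR (7 * a) by rewrite -[leLHS]expR0 ler_expR; lra.
have expR0' := expR_ge0 (- (L / 2)).
rewrite /layer_weight; have [qQ2|qQ2] := leqP (q + 2) Q; last first.
  have qE := even_top oq oQ qQ qQ2.
  apply: (@le_trans _ _ (6 * s * (expR (7 * a) * (expR (- (L / 2)) * expR (- (L / 12)))))).
    by rewrite ler_wpM2l ?mulr_ge0 ?sqrtr_ge0// -!expRD ler_expR qE; lra.
  (* [6 * s <= 13 * L = 156 * (L / 12)]. *)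
  have h : 6 * s * expR (- (L / 12)) <= 156.
    rewrite expRN ler_pdivrMr ?expR_gt0//.
    have := sqrt2L_le; have := expR_ge1Dx (L / 12); lra.
  move: (expR (- (L / 12))) (expR (7 * a)) (expR (- (L / 2))) h E7 expR0' => u v w h v1 w0.
  have -> : 6 * s * (v * (w * u)) = 6 * s * u * (v * w) by ring.
  have -> : 156 * v * w = 156 * (v * w) by ring.
  by rewrite ler_wpM2r// mulr_ge0//; lra.
have [qQ3|qQ3] := ltnP (q + 2) Q.
  rewrite delta_ltQ//.
  have sq : 1 <= (q + 2)%:R * Num.sqrt (q + 2)%:R :> R.
    have q2 : 1 <= (q + 2)%:R :> R by rewrite ler1n addn2.
    by rewrite mulr_ege1// -[leLHS]sqrtr1 ler_wsqrtr.
  have eE : expR (2 * a) * eps_level R n (q + 2) = expR (4 * a + (a * q%:R - L / 2)).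
    by rewrite /eps_level -expRD natrD; congr expR; ring.
  apply: (@le_trans _ _ (20 * expR (4 * a + (a * q%:R - L / 2)) * expR (- (7 / 6 * (a * q%:R))))).
    rewrite ler_wpM2r ?expR_ge0// -eE mulrA ler_pdivrMr; last by rewrite (lt_le_trans ltr01).
    have : 0 <= expR (2 * a) * eps_level R n (q + 2) by rewrite eE expR_ge0.
    rewrite -[10 * _ * _]mulrA.
    by move: (expR _ * eps_level _ _ _) (_ * Num.sqrt _) sq => e m sq e0; nra.
  rewrite -[leLHS]mulrA -expRD -[leRHS]mulrA -expRD.
  have : expR (4 * a + (a * q%:R - L / 2) + - (7 / 6 * (a * q%:R))) <= expR (7 * a - L / 2).
    by rewrite ler_expR; lra.
  have := expR_ge0 (7 * a - L / 2); lra.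
have qE : (q + 2)%N = Q by apply/eqP; rewrite eqn_leq qQ2.
have d1 := delta_qmax_le1 Lbig.
have qR : q%:R = Q%:R - 2 :> R.
  by rewrite -qE natrD addrK.
rewrite qE; apply: (@le_trans _ _ (2 * (expR (7 * a) * expR (- (L / 2))))).
  apply: ler_pM => //; rewrite ?mulr_ge0 ?delta_ge0 ?expR_ge0//; first lra.
  by rewrite -expRD ler_expR qR; lra.
have : 0 <= expR (7 * a) * expR (- (L / 2)) by rewrite mulr_ge0 ?expR_ge0.
lra.
Qed.

Lemma even_sum_le (f : nat -> R) (x C : R) (qs : nat) : 1 / 2 <= x -> 0 <= C ->
  (forall q, ~~ odd q -> (qs <= q <= Q)%N -> f q <= C * expR (- (x * q%:R))) ->
  \sum_(qs <= q < Q.+1 | ~~ odd q) f q <= 3 * C * expR (- (x * qs%:R)).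
Proof.
move=> x2 C0 hf.
apply: (@le_trans _ _ (\sum_(qs <= q < Q.+1) C * expR (- (x * q%:R)))).
  rewrite big_mkcond; apply: ler_sum_nat => q; rewrite ltnS => qQ.
  case: (boolP (~~ odd q)) => [oq|_]; first exact: hf.
  by rewrite mulr_ge0 ?expR_ge0.
by rewrite -mulr_sumr [3 * C]mulrC -mulrA ler_wpM2l// geometric_expR_sum_le.
Qed.

Lemma layer_sum_le (qs : nat) : (1 < qs)%N ->
  \sum_(qs <= q < Q.+1 | ~~ odd q) layer_weight R n q * expR (- (4 / 3 * (a * q%:R)))
    <= 468 * expR (7 * a) / Num.sqrt n%:R.
Proof.
move=> qs1; have a3 := a_const_ge3 R.
have C0 : 0 <= 156 * expR (7 * a) / Num.sqrt n%:R.
  by rewrite divr_ge0 ?sqrtr_ge0// mulr_ge0// expR_ge0.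
apply: le_trans (_ : 3 * (156 * expR (7 * a) / Num.sqrt n%:R) * expR (- (a / 6 * qs%:R)) <= _).
  apply: even_sum_le => //; first lra.
  move=> q oq /andP[qq qQ]; apply: layer_weight_mul_le => //.
  by rewrite (leq_trans qs1 qq).
have E1 : expR (- (a / 6 * qs%:R)) <= 1.
  by rewrite -[leRHS]expR0 ler_expR oppr_le0 mulr_ge0//; lra.
move: (expR (- _)) E1 (expR (7 * a)) C0 => E E1 F.
move: (Num.sqrt n%:R)^-1 => G.
have -> : 468 * F * G = 3 * (156 * F * G) by ring.
by move: (156 * F * G) => H H0; nra.
Qed.

(** [2 / n] is the mean of [zeta_ext]; the rest bounds [4 / (n * (c * v)^2)] at [v = vbar], where
    [v^(-2) <= 6 * L^3]. *)
Definition rough_bound : R := (2 + 24 / c ^+ 2 * L ^+ 3) / n%:R.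

Definition rough_cst : R := 2 + 24 / c ^+ 2.

Lemma rough_bound_le : rough_bound <= rough_cst * (L ^+ 3 * expR (- L)).
Proof.
rewrite /rough_bound /rough_cst [X in _ / X <= _](natr_expR Lbig) -expRN mulrA ler_wpM2r ?expR_ge0//.
have L3 : 1 <= L ^+ 3 by rewrite exprn_ege1//; have := Lbig_ge Lbig; lra.
by rewrite [leRHS]mulrDl lerD2r; lra.
Qed.

Lemma rough_weighted_le : (6 * s + 1) * rough_bound <= 13 * 4096 * rough_cst / Num.sqrt n%:R.
Proof.
have r0 : 0 <= rough_cst by rewrite addr_ge0// divr_ge0// sqr_ge0.
have b0 : 0 <= rough_bound.
  rewrite divr_ge0// addr_ge0// mulr_ge0 ?exprn_ge0 ?divr_ge0 ?sqr_ge0//.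
  by have := Lbig_ge Lbig; lra.
apply: (@le_trans _ _ (13 * L * (rough_cst * (L ^+ 3 * expR (- L))))).
  by apply: ler_pM; rewrite ?rough_bound_le ?sqrt2L_le// addr_ge0// mulr_ge0 ?sqrtr_ge0.
rewrite (sqrtn_expR Lbig) -expRN.
have -> : - (L / 2) = L / 2 - L by field.
rewrite expRD.
have -> : 13 * L * (rough_cst * (L ^+ 3 * expR (- L))) = 13 * rough_cst * expR (- L) * L ^+ 4.
  by rewrite [L ^+ 4]exprS; ring.
have -> : 13 * 4096 * rough_cst * (expR (L / 2) * expR (- L)) =
  13 * rough_cst * expR (- L) * (4096 * expR (L / 2)) by ring.
by rewrite ler_wpM2l ?pow4_le_expR// mulr_ge0 ?expR_ge0// mulr_ge0.
Qed.

(** The target [n^(-2/3)] is the power part of the tail bound at [k = n], so the factor [L^3] may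
    cost [n^(1/3)]. *)
Lemma rough_bound_le_expR : rough_bound <= 729 * rough_cst * expR (- (4 / 3 * (L / 2))).
Proof.
have r0 : 0 <= rough_cst by rewrite addr_ge0// divr_ge0// sqr_ge0.
apply: (le_trans rough_bound_le).
have -> : - (4 / 3 * (L / 2)) = L / 3 - L by field.
rewrite expRD -[leRHS]mulrA [leRHS]mulrCA ler_wpM2l// mulrA ler_wpM2r ?expR_ge0//.
exact: pow3_le_expR.
Qed.
End large_sample_numerics.

Section integrated_bounds.
Context (R : realType) (n k : nat) (d : measure_display) (T : measurableType d).
Variables (P : probability T R) (xi : 'I_n -> {RV P >-> R}).
Variables (mu : 'I_n -> R) (i0 : 'I_n).
Hypothesis iid : iid_std_normal xi.
Hypothesis Lbig : 346 * a_const R <= ln (n%:R : R).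
Hypothesis mu0 : forall i, 0 <= mu i.
Let x (w : T) (i : 'I_n) : R := xi i w.

Let n0 : (0 < n)%N := n_gt0_of_Lbig Lbig.

Lemma measurable_zeta_rough :
  measurable_fun [set: T] (fun w => zeta_rough k mu (x w) i0).
Proof.
apply: measurable_funD; first exact: measurable_zeta_ext.
by case: (_ <= expR _) => //; exact: measurable_zeta_med.
Qed.

Lemma expectation_zeta_rough :
  (\int[P]_w (zeta_rough k mu (x w) i0)%:E <= (rough_bound R n)%:E)%E.
Proof.
have [/andP[v0 _] _ v2] := vbar_bounds Lbig; have c0 := normal_density_lb_gt0 R.
have nR : 0 < n%:R :> R by rewrite ltr0n.
have L3 : 0 <= ln n%:R ^+ 3 :> R.
  by rewrite exprn_ge0//; have := Lbig_ge Lbig; lra.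
rewrite /zeta_rough /rough_bound; under eq_integral do rewrite EFinD.
rewrite ge0_integralD//; last 4 first.
- by move=> w _; rewrite lee_fin zeta_ext_ge0.
- by apply/measurable_EFinP; exact: measurable_zeta_ext.
- by move=> w _; case: (_ <= expR _) => //; rewrite lee_fin zeta_med_ge0.
- apply/measurable_EFinP; case: (_ <= expR _) => //; exact: measurable_zeta_med.
rewrite expectation_zeta_ext//.
have -> : (2 + 24 / normal_density_lb R ^+ 2 * ln n%:R ^+ 3) / n%:R =
    2 / n%:R + 24 / normal_density_lb R ^+ 2 * ln n%:R ^+ 3 / n%:R by ring.
rewrite EFinD leeD2l//.
case: (_ <= expR _); last first.
  by rewrite integral0 lee_fin divr_ge0// mulr_ge0// divr_ge0// sqr_ge0.
apply: (le_trans (expectation_zeta_med iid n0 mu v0)).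
rewrite lee_fin; move: (vbar R n) v0 (ln n%:R ^+ 3) L3 v2 => v v0 M M0 v2.
move: (normal_density_lb R) c0 => c c0.
have -> : 4 / (n%:R * (c * v) ^+ 2) = 4 / c ^+ 2 / n%:R * v ^- 2.
  by field; rewrite !gt_eqF.
have -> : 24 / c ^+ 2 * M / n%:R = 4 / c ^+ 2 / n%:R * (6 * M) by field; rewrite !gt_eqF.
by apply: ler_wpM2l => //; rewrite divr_ge0// divr_ge0// ltW// exprn_gt0.
Qed.

(** The function [f] is arbitrary so as to serve both the error and the indicator of a large
    error. *)
Lemma expectation_le_of_layers (f : T -> R) (b : nat -> R) (B0 M : R) (s : seq nat) :
  (forall q, 0 <= b q) -> 0 <= B0 -> 0 <= M -> (forall q, q \in s -> (0 < q)%N) ->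
  measurable_fun [set: T] f -> (forall w, 0 <= f w) ->
  (forall w, f w <= B0 + \sum_(q <- s) b q * zeta mu (x w) q +
     M * zeta_rough k mu (x w) i0) ->
  (\int[P]_w (f w)%:E <=
   (B0 + \sum_(q <- s) b q * expR (- (4 / 3 * (a_const R * q%:R))) +
     M * rough_bound R n)%:E)%E.
Proof.
move=> b0 B00 M0 qs1 mf f0 hf.
have mz q : measurable_fun [set: T] (fun w => (zeta mu (x w) q)%:E).
  by apply/measurable_EFinP; exact: measurable_zeta.
have mbz q : measurable_fun [set: T] (fun w => (b q * zeta mu (x w) q)%:E).
  by apply/measurable_EFinP; apply: measurable_funM => //; exact: measurable_zeta.
have z0 q w : (0 <= (b q * zeta mu (x w) q)%:E)%E by rewrite lee_fin mulr_ge0 ?zeta_ge0.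
have ms : measurable_fun [set: T] (fun w => (\sum_(q <- s) b q * zeta mu (x w) q)%:E).
  apply/measurable_EFinP; apply: measurable_sum => q; apply: measurable_funM => //.
  exact: measurable_zeta.
have s0 w : (0 <= (\sum_(q <- s) b q * zeta mu (x w) q)%:E)%E.
  by rewrite lee_fin sumr_ge0// => q _; rewrite mulr_ge0 ?zeta_ge0.
have mr : measurable_fun [set: T] (fun w => (zeta_rough k mu (x w) i0)%:E).
  by apply/measurable_EFinP; exact: measurable_zeta_rough.
have r0 w : (0 <= (zeta_rough k mu (x w) i0)%:E)%E by rewrite lee_fin zeta_rough_ge0.
have mMr : measurable_fun [set: T] (fun w => (M * zeta_rough k mu (x w) i0)%:E).
  by under eq_fun do rewrite EFinM; exact: emeasurable_funM.
apply: (@le_trans _ _ (\int[P]_w (B0%:E + (\sum_(q <- s) b q * zeta mu (x w) q)%:E +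
     (M * zeta_rough k mu (x w) i0)%:E)))%E.
  apply: ge0_le_integral => //.
  - by move=> w _; rewrite lee_fin.
  - exact/measurable_EFinP.
  - by apply: emeasurable_funD => //; exact: emeasurable_funD.
  - by move=> w _; rewrite -!EFinD lee_fin.
rewrite ge0_integralD//; last 3 first.
- by move=> w _; rewrite adde_ge0.
- exact: emeasurable_funD.
- by move=> w _; rewrite EFinM mule_ge0.
rewrite ge0_integralD//.
have -> : (\int[P]__ B0%:E = B0%:E)%E.
  by rewrite integral_cst//= probability_setT mule1.
rewrite !EFinD; apply: leeD; first apply: leeD2l => //.
  under eq_integral do rewrite -sumEFin.
  rewrite ge0_integral_sum// -sumEFin big_seq [leRHS]big_seq; apply: lee_sum => q /qs1 q0.
  under eq_integral do rewrite EFinM.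
  rewrite ge0_integralZl ?lee_fin//; last by move=> w _; rewrite lee_fin zeta_ge0.
  rewrite [X in (_ <= X)%E]EFinM lee_wpmul2l ?lee_fin//.
  exact: (expectation_zeta iid n0 mu0 q0).
under eq_integral do rewrite EFinM.
rewrite ge0_integralZl ?lee_fin// [X in (_ <= X)%E]EFinM lee_wpmul2l ?lee_fin//.
exact: expectation_zeta_rough.
Qed.

End integrated_bounds.

(** * Tail and risk bounds for the adaptive estimator *)

Lemma theta_ad_bounds (R : realType) (n k : nat) (theta : R) (mu : 'I_n -> R)
    (d : measure_display) (T : measurableType d) (P : probability T R)
    (xi : 'I_n -> {RV P >-> R}) :
  346 * a_const R <= ln (n%:R : R) -> 320 / normal_density_lb R <= ln n%:R ->
  (1 <= k <= n - 1)%N -> sparse_nonneg k mu -> iid_std_normal xi ->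
  let D (w : T) := `|theta_ad (observation theta mu xi w) - theta| in
  measurable_fun [set: T] (fun w => theta_ad (observation theta mu xi w)) /\
  (P [set w | (rate_cst R * rate R n k < D w)%R] <=
     ((3 * expR (6 * a_const R) + 729 * rough_cst R) / ln 2 ^+ 3 * tail_bound R n k)%:E)%E /\
  (\int[P]_w (D w)%:E <= ((rate_cst R +
     4 * (468 * expR (7 * a_const R) + 13 * 4096 * rough_cst R)) * rate R n k)%:E)%E.
Proof.
move=> Lbig Lc k1n smu iid D; have n0 := n_gt0_of_Lbig Lbig.
pose x (w : T) (i : 'I_n) : R := xi i w.
have mad : measurable_fun [set: T] (fun w => theta_ad (observation theta mu xi w)).
  apply: measurable_theta_ad => // i; apply: measurable_funD => //.
have mD : measurable_fun [set: T] D.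
  by apply: measurableT_comp => //; exact: measurable_funB.
(* [k <= n - 1] leaves at least one uncontaminated observation. *)
have [i0 mui0] : exists i0, mu i0 = 0.
  apply/not_existsP => hmu; have := smu.2; rewrite leqNgt => /negP; apply.
  rewrite (_ : #|_| = n).
    by move: k1n n0; case: (n) => // m; rewrite subn1 /= ltnS => /andP[].
  rewrite -[RHS]card_ord; apply: eq_card => i; rewrite !inE; apply/eqP; exact: hmu.
have [v01 _ _] := vbar_bounds Lbig.
have [B0 [qs [qs1 B00 Brate Btail hx]]] := exists_layer_bounds theta Lbig k1n smu mui0 v01
  (@med_sparse_of_large R n Lbig k Lc).
have rough0 : 0 <= rough_cst R by rewrite addr_ge0// divr_ge0// sqr_ge0.
pose s := [seq q <- index_iota qs (qmax R n).+1 | ~~ odd q].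
have s_gt0 q : q \in s -> (0 < q)%N.
  rewrite mem_filter mem_index_iota => /andP[_ /andP[qq _]].
  by rewrite (leq_trans _ qq)// ltnW.
have s6 : 0 <= 6 * Num.sqrt (2 * ln (n%:R : R)) + 1 by rewrite addr_ge0// mulr_ge0 ?sqrtr_ge0.
have tail0 := tail_bound_ge_half Lbig k1n.
have l2 : 0 < ln 2 ^+ 3 :> R by rewrite exprn_gt0// ln_gt0// ltr1n.
split=> //; split.
  pose A := [set w | (rate_cst R * rate R n k < D w)%R].
  have mA : measurable A.
    have -> : A = [set: T] `&` D @^-1` `]rate_cst R * rate R n k, +oo[.
      by rewrite setTI; apply/seteqP; split => w /=; rewrite in_itv/= andbT.
    exact: mD.
  rewrite -[X in P X]setIT -/A -integral_indic//.
  apply: (le_trans (@expectation_le_of_layers R n k d T P xi mu i0 iid Lbig smu.1 \1_A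
    (fun=> 1) 0 1 s _ _ _ s_gt0 _ _ _)) => //.
  - move=> w; rewrite add0r mul1r big_filter; under eq_bigr do rewrite mul1r.
    apply: le_trans (hx (x w)).2; rewrite indicE; case: (boolP (w \in A)) => //.
    by rewrite inE => Aw; rewrite (le_lt_trans Brate Aw).
  rewrite lee_fin add0r mul1r big_filter; under eq_bigr do rewrite mul1r mulrA.
  have a3 := a_const_ge3 R.
  have h1 : \sum_(qs <= q < (qmax R n).+1 | ~~ odd q) expR (- (4 / 3 * a_const R * q%:R)) <=
      3 * 1 * expR (- (4 / 3 * a_const R * qs%:R)).
    by apply: even_sum_le => [||q _ _]; rewrite ?mul1r//; lra.
  have h2 := rough_bound_le_expR Lbig.
  apply: (le_trans (lerD h1 h2)).
  rewrite [4 / 3 * (_ * _)]mulrA in Btail; rewrite [leRHS]mulrAC ler_pdivlMr//.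
  move: (expR (- (4 / 3 * a_const R * qs%:R))) (expR (- (4 / 3 * (ln n%:R / 2))))
    (tail_bound R n k) (expR (6 * a_const R)) (ln 2 ^+ 3) (rough_cst R) rough0 tail0 Btail.
  move=> e1 e2 t e6 l3 rc rough0 tail0 Btail.
  have : rc * (l3 * e2) <= rc * t by rewrite ler_wpM2l.
  lra.
apply: (le_trans (@expectation_le_of_layers R n k d T P xi mu i0 iid Lbig smu.1 D
    (layer_weight R n) B0 _ s (@layer_weight_ge0 R n) B00 s6 s_gt0 mD (fun=> normr_ge0 _) _)) => //.
  by move=> w; rewrite big_filter; exact: (hx (x w)).1.
rewrite lee_fin big_filter.
have h1 := layer_sum_le Lbig qs1; have h2 := rough_weighted_le Lbig.
have h3 := rate_ge_inv_sqrt Lbig k1n.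
have h4 : (Num.sqrt n%:R)^-1 <= 4 * rate R n k.
  by rewrite (_ : _^-1 = 4 * (1 / (4 * Num.sqrt n%:R))) ?ler_wpM2l// div1r invfM mulVKf.
have scale (C : R) : 0 <= C -> C / Num.sqrt n%:R <= C * (4 * rate R n k).
  by move=> C0; apply: ler_wpM2l.
have E7 : 0 <= 468 * expR (7 * a_const R).
  by have := expR_ge0 (7 * a_const R); move: (expR _) => e; lra.
have E13 : 0 <= 13 * 4096 * rough_cst R by move: rough0; move: (rough_cst R) => e; lra.
apply: (le_trans (lerD (lerD Brate (le_trans h1 (scale _ E7))) (le_trans h2 (scale _ E13)))).
move: (rate_cst R) (rate R n k) (468 * _) (13 * 4096 * _) => c r u v.
by rewrite le_eqVlt; apply/orP; left; apply/eqP; ring.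
Qed.

Theorem theorem2p7 (R : realType) :
  exists (c1 c2 c3 : R) (n0 : nat),
    [/\ 0 < c1, 0 < c2, 0 < c3, (0 < n0)%N &
    forall (n k : nat) (theta : R) (mu : 'I_n -> R),
      (n0 <= n)%N -> (1 <= k <= n - 1)%N -> sparse_nonneg k mu ->
    forall (d : measure_display) (T : measurableType d) (P : probability T R)
      (xi : 'I_n -> {RV P >-> R}),
      iid_std_normal xi ->
      let Y : T -> 'I_n -> R := observation theta mu xi in
      [/\ measurable_fun [set: T] (fun w => theta_ad (Y w)),
          (P [set w | (c1 * rate R n k < `|theta_ad (Y w) - theta|)%R]
             <= (c2 * tail_bound R n k)%:E)%E &
          ('E_P[fun w => `|theta_ad (Y w) - theta|%R]
             <= (c3 * rate R n k)%:E)%E]].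
Proof.
have c0 := normal_density_lb_gt0 R; have [r1 r2 r3] := rate_csts_ge0 R.
have rough0 : 0 <= rough_cst R by rewrite addr_ge0// divr_ge0// sqr_ge0.
have rate0 : 0 < rate_cst R.
  rewrite /rate_cst; have : 0 < rate_cst_top R; last lra.
  have := a_const_ge3 R; rewrite /rate_cst_top; move: (a_const R) => a a3.
  by rewrite mulr_gt0// exprn_gt0//; lra.
have l2 : 0 < ln 2 ^+ 3 :> R by rewrite exprn_gt0// ln_gt0// ltr1n.
pose c2 := (3 * expR (6 * a_const R) + 729 * rough_cst R) / ln 2 ^+ 3.
pose c3 := rate_cst R + 4 * (468 * expR (7 * a_const R) + 13 * 4096 * rough_cst R).
pose L0 := Num.max (346 * a_const R) (320 / normal_density_lb R).
have c20 : 0 < c2.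
  apply: divr_gt0 l2; have := expR_gt0 (6 * a_const R).
  by move: (expR _) (rough_cst R) rough0 => e r r0 e0; lra.
have c30 : 0 < c3.
  rewrite /c3; have := expR_gt0 (7 * a_const R).
  by move: (expR _) (rough_cst R) rough0 (rate_cst R) rate0 => e r r0 u u0 e0; lra.
exists (rate_cst R), c2, c3, (Num.truncn (expR L0)).+1; split=> [||||n k theta mu n0n k1n smu].
- exact: rate0.
- exact: c20.
- exact: c30.
- by [].
move=> d T P xi iid Y.
have LL : L0 <= ln n%:R.
  rewrite -[leLHS]expRK ler_ln ?posrE ?expR_gt0//; last first.
    by rewrite ltr0n (leq_trans _ n0n).
  by rewrite (le_trans (ltW (truncnS_gt _)))// ler_nat.
move: LL; rewrite ge_max => /andP[La Lc].
have [mY [hP hE]] := theta_ad_bounds theta La Lc k1n smu iid.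
by split; [exact: mY|exact: hP|rewrite unlock; exact: hE].
Qed.
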